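(* Fix $m\ge 1$ and $1\le n\le m$, and let $X^n(t)=(X^n_1(t),\dots,X^n_n(t))$, $t=0,1,2,\dots$, be the $n$-th component of the Aztec diamond particle process $(X^1(t),\dots,X^m(t))$. For $N\ge1$ and real $t\ge 0$ put $$\tilde X^n_i(t)=\frac{X^n_i(Nt)-\frac12 Nt}{\frac12\sqrt N},\qquad i=1,\dots,n,$$ where $X^n_i(\cdot)$ is defined by linear interpolation for non-integer values of $Nt$. Then, as $N\to\infty$, the process $\tilde X^n(t)=(\tilde X^n_1(t),\dots,\tilde X^n_n(t))$ converges, in the sense of convergence of finite dimensional distributions, to a Dyson Brownian motion of $n$ particles with all particles started at the origin.
   Context: Aztec diamond particle process on $m$ lines: $(X^1(t),\dots,X^m(t))_{t=0,1,2,\dots}$ with $X^k(t)=(X^k_1(t),\dots,X^k_k(t))\in\mathbb Z^k$. Let $\beta^j_i(t)$ ($1\le i\le j\le m$, $t\ge1$) be i.i.d. with $\mathbb P[\beta^j_i(t)=0]=\mathbb P[\beta^j_i(t)=1]=\frac12$. Initial condition: $X^j_i(0)=i$ for $1\le i\le j\le m$. For $t=1,2,\dots$: - $X^1_1(t)=X^1_1(t-1)+\beta^1_1(t)$; - for $j\ge2$: $X^j_1(t)=X^j_1(t-1)+\beta^j_1(t)-\mathbf 1\{X^j_1(t-1)+\beta^j_1(t)=X^{j-1}_1(t)+1\}$; - for $j\ge2$: $X^j_j(t)=X^j_j(t-1)+\beta^j_j(t)+\mathbf 1\{X^j_j(t-1)+\beta^j_j(t)=X^{j-1}_{j-1}(t)\}$;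 - for $j\ge3$, $1<i<j$: $X^j_i(t)=X^j_i(t-1)+\beta^j_i(t)-\mathbf 1\{X^j_i(t-1)+\beta^j_i(t)=X^{j-1}_i(t)+1\}+\mathbf 1\{X^j_i(t-1)+\beta^j_i(t)=X^{j-1}_{i-1}(t)\}$. Dyson Brownian motion of $n$ particles started at the origin: the Markov process $(Y(t))_{t\ge0}$ with $Y(0)=0$ which for $t>0$ takes values in $\{y\in\mathbb R^n:y_1<\dots<y_n\}$, has one-time densities (entrance law) $$\mu^n_t(y)=\frac1{Z_n}t^{-n^2/2}\exp\Big\{-\sum_i \frac{y_i^2}{2t}\Big\}\prod_{i<j}(y_j-y_i)^2,\qquad Z_n=(2\pi)^{n/2}\prod_{j<n}j!,$$ and transition densities $$p^{n,+}_t(y,y')=\frac{h_n(y')}{h_n(y)}\det\big[\varphi_t(y'_j-y_i)\big]_{1\le i,j\le n},$$ where $h_n(y)=\prod_{i<j}(y_j-y_i)$ and $\varphi_t(x)=(2\pi t)^{-1/2}e^{-x^2/2t}$. (This is $n$ Brownian motions conditioned never to intersect.) *)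

(* Defs.v *)
From HB Require Import structures.
From mathcomp Require Import all_boot all_order all_algebra.
From mathcomp Require Import all_classical all_reals all_analysis.
Set Implicit Arguments.
Unset Strict Implicit.
Unset Printing Implicit Defensive.
Import Order.TTheory GRing.Theory Num.Theory.
Import numFieldNormedType.Exports.
Local Open Scope classical_set_scope.
Local Open Scope ring_scope.

(* Lines and particles are numbered from 1: [beta j i t], t >= 1, is the bit
   beta^j_i(t) and [aztec beta t j i], t >= 0, is X^j_i(t).  Entries outside
   1 <= i <= j are junk, never read by the rules for entries in that range. *)

(* One time step: [x] is the configuration at time t-1, [b] the bits at time t
   and [y] line j-1 at time t. *)
Fixpoint aztec_step (x : nat -> nat -> int) (b : nat -> nat -> bool)
    (j : nat) : nat -> int :=
  if j is j'.+1 then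
    let y := aztec_step x b j' in
    fun i =>
      let z := x j i + (b j i)%:Z in
      if j == 1%N then z
      else if i == 1%N then z - (z == y 1%N + 1)%:Z
      else if i == j then z + (z == y j')%:Z
      else z - (z == y i + 1)%:Z + (z == y i.-1)%:Z
  else fun=> 0.

Fixpoint aztec (beta : nat -> nat -> nat -> bool) (t : nat) :
    nat -> nat -> int :=
  if t is t'.+1 then aztec_step (aztec beta t') (fun j i => beta j i t)
  else fun _ i => i%:Z.

Definition linear_interp (R : realType) (u : nat -> R) (s : R) : R :=
  let k := Num.truncn s in u k + (s - k%:R) * (u k.+1 - u k).

Definition aztec_rescaled (R : realType) (beta : nat -> nat -> nat -> bool)
    (n N : nat) (t : R) : n.-tuple R :=
  [tuple (linear_interp (fun s => (aztec beta s n i.+1)%:~R) (N%:R * t)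
           - 2^-1 * (N%:R * t)) / (2^-1 * Num.sqrt N%:R) | i < n].

Definition mutually_independent d d' (T : measurableType d)
    (T' : measurableType d') (R : realType) (P : probability T R)
    (I : choiceType) (D : set I) (X : I -> {RV P >-> T'}) : Prop :=
  forall s : seq I, uniq s -> [set` s] `<=` D ->
  forall B : I -> set T', (forall i, measurable (B i)) ->
    P (\bigcap_(i in [set` s]) (X i @^-1` B i)) =
    (\prod_(i <- s) fine (P (X i @^-1` B i)))%:E.

Definition fair_bits d (T : measurableType d) (R : realType)
    (P : probability T R) (m : nat)
    (beta : nat -> nat -> nat -> {RV P >-> bool}) : Prop :=
  let D : set (nat * nat * nat) :=
    [set a | (1 <= a.1.2 <= a.1.1)%N /\ (a.1.1 <= m)%N /\ (1 <= a.2)%N] in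
  mutually_independent D (fun a => beta a.1.1 a.1.2 a.2) /\
  (forall a, D a -> forall v : bool,
     P (beta a.1.1 a.1.2 a.2 @^-1` [set v]) = (2^-1)%:E).

Section lebesgue_tuple.
Context (R : realType) (n : nat).

(* [measurableTypeR R] is [R] with the Borel sigma-algebra as a generated
   sigma-algebra; this is the type on which [lebesgue_measure] lives. *)
Definition cons_pair (p : measurableTypeR R * n.-tuple R) : n.+1.-tuple R :=
  [tuple of (p.1 : R) :: p.2].

Lemma measurable_cons_pair :
  measurable_fun [set: measurableTypeR R * n.-tuple R] cons_pair.
Proof.
apply: (@measurable_cons _ _ _ R (fun p => p.1) n (fun p => p.2)).
  exact: (@measurable_fst _ _ (measurableTypeR R) (n.-tuple R)).
exact: measurable_snd.
Qed.

Variable nu : {sigma_finite_measure set (n.-tuple R) -> \bar R}.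

Definition lebesgue_cons : set (n.+1.-tuple R) -> \bar R :=
  pushforward (lebesgue_measure \x nu)%E cons_pair.

Let lebesgue_cons0 : lebesgue_cons set0 = 0%E.
Proof. by rewrite /lebesgue_cons /pushforward preimage_set0 measure0. Qed.

Let lebesgue_cons_ge0 A : (0 <= lebesgue_cons A)%E.
Proof.
exact: (@measure_ge0 _ _ _
  (measure_function_pushforward__canonical__measure_function_Measure
     (lebesgue_measure \x nu)%E measurable_cons_pair)).
Qed.

Let lebesgue_cons_sigma_additive : semi_sigma_additive lebesgue_cons.
Proof.
rewrite /lebesgue_cons.
exact: (@measure_semi_sigma_additive _ _ _
  (measure_function_pushforward__canonical__measure_function_Measure
     (lebesgue_measure \x nu)%E measurable_cons_pair)).
Qed.

HB.instance Definition _ := isMeasure.Build _ _ _ lebesgue_cons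
  lebesgue_cons0 lebesgue_cons_ge0 lebesgue_cons_sigma_additive.

Let lebesgue_cons_sigma_finite : sigma_finite setT lebesgue_cons.
Proof.
have [F FT Foo] : sigma_finite setT (lebesgue_measure \x nu)%E.
  have /sigma_finiteP[G [GT ndG Goo]] := sigma_finiteT (@lebesgue_measure R).
  have /sigma_finiteP[H [HT ndH Hoo]] := sigma_finiteT nu.
  exists (fun k => G k `*` H k).
    rewrite -setXTT GT HT predeqE => -[x y]; split; last first.
      by move=> [k _ []/= ? ?]; split; exists k.
    move=> [/= [k _ Gkx] [l _ Hly]]; exists (maxn k l) => //; split.
    - by move: x Gkx; exact/subsetPset/ndG/leq_maxl.
    - by move: y Hly; exact/subsetPset/ndH/leq_maxr.
  move=> k; have [mG Gk] := Goo k; have [mH Hk] := Hoo k.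
  split; first exact: measurableX.
  by rewrite product_measure1E// lte_mul_pinfty// ge0_fin_numE.
pose uncons (v : n.+1.-tuple R) : measurableTypeR R * n.-tuple R :=
  (thead v, [tuple of behead v]).
have consK : cancel cons_pair uncons.
  by move=> [x v]; congr (_, _); apply/val_inj.
have unconsK : cancel uncons cons_pair.
  by move=> v; rewrite [RHS]tuple_eta; apply/val_inj.
have muncons : measurable_fun setT uncons.
  apply/measurable_fun_pairP; split; last exact: measurable_behead.
  exact: measurable_tnth.
exists (fun k => uncons @^-1` F k).
  by rewrite -preimage_bigcup -FT preimage_setT.
move=> k; have [mF Fk] := Foo k; split.
  by rewrite -[X in measurable X]setTI; exact: muncons.
rewrite /= /lebesgue_cons /pushforward -comp_preimage.
by rewrite (_ : uncons \o cons_pair = id)//; apply/funext => p; exact: consK.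
Qed.

HB.instance Definition _ := Measure_isSigmaFinite.Build _ _ _ lebesgue_cons
  lebesgue_cons_sigma_finite.

End lebesgue_tuple.

(* Lebesgue measure on R^n; the Borel sigma-algebra of R^n is the one the
   library puts on [n.-tuple R]. *)
Fixpoint lebesgue_tuple (R : realType) (n : nat) :
    {sigma_finite_measure set (n.-tuple R) -> \bar R} :=
  match n return {sigma_finite_measure set (n.-tuple R) -> \bar R} with
  | 0 => dirac ([tuple] : 0.-tuple R)
  | n'.+1 => lebesgue_cons (lebesgue_tuple R n')
  end.

Section dyson.
Context (R : realType) (n : nat).
Implicit Types (t : R) (y z : n.-tuple R).

Definition weyl_chamber : set (n.-tuple R) :=
  [set y | forall i j : 'I_n, (i < j)%N -> tnth y i < tnth y j].

Definition vandermonde y : R :=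
  \prod_(i < n) \prod_(j < n | (i < j)%N) (tnth y j - tnth y i).

Definition dyson_norm : R :=
  (2 * pi) `^ (n%:R / 2) * \prod_(j < n) (j`!)%:R.

Definition dyson_entrance t y : R :=
  dyson_norm^-1 * t `^ (- (n ^ 2)%:R / 2)
  * expR (- \sum_(i < n) (tnth y i) ^+ 2 / (2 * t))
  * \prod_(i < n) \prod_(j < n | (i < j)%N) (tnth y j - tnth y i) ^+ 2.

Definition heat_kernel t (x : R) : R :=
  (2 * pi * t) `^ (- 2^-1) * expR (- x ^+ 2 / (2 * t)).

Definition dyson_transition t y z : R :=
  vandermonde z / vandermonde y
  * \det (\matrix_(i < n, j < n) heat_kernel t (tnth z j - tnth y i)).

Definition natural_filtration d (T : measurableType d) (P : probability T R)
    (Y : R -> {RV P >-> n.-tuple R}) t : set (set T) :=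
  <<s [set A | exists s (B : set (n.-tuple R)),
         [/\ 0 <= s <= t, measurable B & A = Y s @^-1` B]] >>.

(* The last clause is the Markov property with respect to the natural
   filtration, with the conditional expectation
   P(Y (s + t) \in B | F_s) = \int[lebesgue]_(z in B) p_t(Y s, z) dz
   spelled out: both sides have the same integral over each A in F_s. *)
Definition dyson_brownian_motion d (T : measurableType d)
    (P : probability T R) (Y : R -> {RV P >-> n.-tuple R}) : Prop :=
  [/\ {ae P, forall w, Y 0 w = [tuple 0 | _ < n]},
      forall t, 0 < t -> {ae P, forall w, weyl_chamber (Y t w)},
      forall t (B : set (n.-tuple R)), 0 < t -> measurable B ->
        P (Y t @^-1` B) =
        (\int[lebesgue_tuple R n]_(y in B `&` weyl_chamber)
           (dyson_entrance t y)%:E)%E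
    & forall s t (A : set T) (B : set (n.-tuple R)), 0 < s -> 0 < t ->
        natural_filtration Y s A -> measurable B ->
        P (A `&` Y (s + t) @^-1` B) =
        (\int[P]_(w in A) \int[lebesgue_tuple R n]_(z in B `&` weyl_chamber)
           (dyson_transition t (Y s w) z)%:E)%E].

Definition fdd_matrix (k : nat) (v : 'I_k -> n.-tuple R) : 'M[R]_(k, n) :=
  \matrix_(a < k, i < n) tnth (v a) i.

(* For all finitely many times tau_0, ..., tau_(k-1) >= 0, the joint laws at
   those times converge weakly on (R^n)^k, identified with k x n matrices.
   The two processes may live on different probability spaces. *)
Definition fdd_cvg d (T : measurableType d) (P : probability T R)
    (X : nat -> R -> T -> n.-tuple R)
    d' (T' : measurableType d') (P' : probability T' R)
    (Y : R -> T' -> n.-tuple R) : Prop :=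
  forall (k : nat) (tau : 'I_k -> R) (f : 'M[R]_(k, n) -> R),
    (forall a, 0 <= tau a) -> continuous f ->
    (exists M : R, forall v, `|f v| <= M) ->
    ('E_P[fun w => f (fdd_matrix (fun a => X N (tau a) w))]%E
       @[N --> \oo]) -->
    'E_P'[fun w => f (fdd_matrix (fun a => Y (tau a) w))]%E.

End dyson.

(* Main.v *)
Require Import Defs.
From HB Require Import structures.
From mathcomp Require Import all_boot all_order all_algebra perm.
From mathcomp Require Import all_classical all_reals all_analysis.
From mathcomp Require Import measurable_realfun.
From mathcomp Require Import zify ring lra.
Set Implicit Arguments.
Unset Strict Implicit.
Unset Printing Implicit Defensive.
Import Order.TTheory GRing.Theory Num.Theory.
Import numFieldNormedType.Exports.
Local Open Scope classical_set_scope.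
Local Open Scope ring_scope.

(** Fix a line [n].  If line [n] starts from a configuration weighted by the
    number of Gelfand-Tsetlin patterns below it, a two-line identity shows that
    line [n] alone is a walk with independent Bernoulli steps, killed when two
    particles collide, h-transformed by this number, which is a Vandermonde
    determinant.  The packed initial condition has exactly one pattern.  By
    Karlin-McGregor the killed walk has determinantal transition probabilities
    with binomial entries, and the local limit theorem turns these into the
    transition densities of Dyson Brownian motion.

    Only one-sided bounds are used: a lower bound for the probability of each
    path of line [n] and Fatou's lemma, applied to lattice cells, give
    [liminf E g(X_N) >= E g(Y)] for every continuous [g >= 0].  Applying this to
    [B + f] and [B - f], where [|f| <= B], gives the convergence; no
    normalisation or tightness argument is needed. *)

(** * Determinants *)

(** The obstacle is the start. After rescaling, the packed configuration tends to the origin, where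
    the Vandermonde determinant vanishes for [n >= 2]: the h-transform becomes 0/0 there, and
    entrywise limits cannot give the entrance law. The first observation therefore uses a closed
    form of the determinant for the packed start; only later steps take limits entry by entry.
    Rounding [N t] and interpolating displaces the sampled points by [O(1 / sqrt N)], and the test
    function is continuous but perhaps not uniformly so. The functional is therefore allowed to
    depend on [N]: it is the infimum of the test function over a ball of that radius, and continuity
    preserves the lower bound in the limit. Configurations live in a finite window growing with [N],
    so that sums over them are finite; steps go only upwards, so a path that ends in the window
    never left it. On the continuous side the Markov property is given for events only. It is
    extended to functionals of the whole past, which identifies iterated integrals of the kernels
    with the finite-dimensional laws. *)

Section determinants.

(** Multilinearity: one summand is chosen in each row. With [J] the set of positions, the choices
    [f] are themselves particle configurations. *)
Lemma det_sum_rows (R : comNzRingType) n (J : finType)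
    (A : 'I_n -> J -> 'I_n -> R) :
  \det (\matrix_(i, j) \sum_k A i k j) =
  \sum_(f : {ffun 'I_n -> J}) \det (\matrix_(i, j) A i (f i) j).
Proof.
rewrite /determinant exchange_big /=; apply: eq_bigr => s _.
rewrite -big_distrr /=; congr (_ * _).
rewrite (eq_bigr (fun i => \sum_k A i k (s i))) => [|i _]; last by rewrite mxE.
rewrite bigA_distr_bigA; apply: eq_bigr => f _.
by apply: eq_bigr => i _; rewrite mxE.
Qed.

Lemma det_scale_rows (R : comNzRingType) n (c : 'I_n -> R)
    (A : 'I_n -> 'I_n -> R) :
  \det (\matrix_(i, j) (c i * A i j)) =
  (\prod_i c i) * \det (\matrix_(i, j) A i j).
Proof.
have -> : \matrix_(i, j) (c i * A i j) =
    diag_mx (\row_i c i) *m \matrix_(i, j) A i j.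
  by apply/matrixP => i j; rewrite mul_diag_mx !mxE.
rewrite det_mulmx det_diag; congr (_ * _).
by apply: eq_bigr => i _; rewrite mxE.
Qed.

Lemma det_scale_cols (R : comNzRingType) n (c : 'I_n -> R)
    (A : 'I_n -> 'I_n -> R) :
  \det (\matrix_(i, j) (c j * A i j)) =
  (\prod_i c i) * \det (\matrix_(i, j) A i j).
Proof.
rewrite -det_tr -[X in _ = _ * X]det_tr.
have -> : (\matrix_(i, j) A i j)^T = \matrix_(i, j) A j i.
  by apply/matrixP => i j; rewrite !mxE.
by rewrite -det_scale_rows; congr (\det _); apply/matrixP => i j; rewrite !mxE.
Qed.

Lemma det_mxsub_rev (R : comNzRingType) n (A : 'M[R]_n) :
  \det (\matrix_(i, j) A (rev_ord i) (rev_ord j)) = \det A.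
Proof.
have -> : \matrix_(i, j) A (rev_ord i) (rev_ord j) =
    row_perm (perm rev_ord_inj) (col_perm (perm rev_ord_inj) A).
  by apply/matrixP => i j; rewrite !mxE !permE.
rewrite row_permE col_permE !det_mulmx !det_perm mulrCA.
by rewrite odd_permV -signr_addb addbb expr0 mulr1.
Qed.

(** In the monomial basis the coefficient matrix is lower triangular. *)
Lemma det_poly_vandermonde (R : comNzRingType) n (p : 'I_n -> {poly R})
    (x : 'I_n -> R) : (forall i, (size (p i) <= i.+1)%N) ->
  \det (\matrix_(i, j) (p i).[x j]) =
  (\prod_i (p i)`_i) * \prod_(i < n) \prod_(j < n | (i < j)%N) (x j - x i).
Proof.
move=> sz.
have -> : \matrix_(i, j) (p i).[x j] =
    (\matrix_(i, k < n) (p i)`_k) *m Vandermonde n (\row_j x j).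
  apply/matrixP => i j; rewrite !mxE (horner_coef_wide _ (n := n)).
    by apply: eq_bigr => k _; rewrite !mxE.
  exact: leq_trans (sz i) (ltn_ord i).
rewrite det_mulmx det_Vandermonde det_trig; last first.
  by apply/is_trig_mxP => i j ij; rewrite mxE nth_default// (leq_trans (sz i)).
congr (_ * _); first by apply: eq_bigr => i _; rewrite mxE.
by apply: eq_bigr => i _; apply: eq_bigr => j _; rewrite !mxE.
Qed.

Definition ffact_poly (R : comNzRingType) k : {poly R} :=
  \prod_(l < k) ('X - (l%:R)%:P).

Lemma size_ffact_poly (R : comNzRingType) k : size (ffact_poly R k) = k.+1.
Proof.
by rewrite /ffact_poly size_prod_XsubC /index_enum -enumT size_enum_ord.
Qed.

Lemma coef_ffact_poly (R : comNzRingType) k : (ffact_poly R k)`_k = 1.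
Proof.
have /monicP : ffact_poly R k \is monic by apply: monic_prod_XsubC.
by rewrite /lead_coef size_ffact_poly.
Qed.

Lemma horner_ffact_poly (R : comNzRingType) k x :
  (ffact_poly R k).[x%:R] = (x ^_ k)%:R.
Proof.
rewrite /ffact_poly horner_prod.
elim: k => [|k IH]; first by rewrite big_ord0 ffactn0.
rewrite big_ord_recr /= IH !hornerE ffactnSr natrM.
have [kx|xk] := leqP k x; first by rewrite natrB.
by rewrite ffact_small// mul0r mul0r.
Qed.

Lemma det_ffact_vandermonde (R : comNzRingType) n (x : 'I_n -> nat) :
  \det (\matrix_(i, j < n) (x j ^_ i)%:R) =
  \prod_(i < n) \prod_(j < n | (i < j)%N) ((x j)%:R - (x i)%:R) :> R.
Proof.
have := @det_poly_vandermonde R n (fun i : 'I_n => ffact_poly R i)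
  (fun j => (x j)%:R) (fun i => eq_leq (size_ffact_poly R i)).
rewrite big1 ?mul1r => [<-|i _]; last exact: coef_ffact_poly.
by congr (\det _); apply/matrixP => i j; rewrite !mxE horner_ffact_poly.
Qed.

Lemma det_bin_vandermonde (R : numFieldType) n (x : 'I_n -> nat) :
  \det (\matrix_(i, j < n) ('C(x i, j))%:R) =
  (\prod_(i < n) (i`!)%:R)^-1 *
  \prod_(i < n) \prod_(j < n | (i < j)%N) ((x j)%:R - (x i)%:R) :> R.
Proof.
rewrite -det_ffact_vandermonde -det_tr -prodfV -det_scale_rows.
congr (\det _); apply/matrixP => i j; rewrite !mxE -bin_ffact natrM.
by rewrite mulrC mulfK// pnatr_eq0 -lt0n fact_gt0.
Qed.

(* Adding multiples of rows turns the rows [C(s, y - i)] into [C(s + i, y)],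
   whose ratio to [C(s + n - 1, y)] is a polynomial in [y] of degree
   [n - 1 - i]. *)
Lemma det_bin_shift (R : numFieldType) s n (y : 'I_n -> nat) :
  \det (\matrix_(i, j < n)
    (if (i <= y j)%N then 'C(s, y j - i) else 0)%:R) =
  (\prod_(j < n) ('C(s + n.-1, y j))%:R) *
  (\prod_(i < n) ((s + n.-1) ^_ i)%:R)^-1 *
  \prod_(i < n) \prod_(j < n | (i < j)%N) ((y j)%:R - (y i)%:R) :> R.
Proof.
set A := (X in \det X = _).
have detA : \det A = \det (\matrix_(i, j < n) ('C(s + i, y j))%:R : 'M[R]_n).
  (* The unipotent matrix of the [C(i, l)] performs the row operations; entrywise the product is the
     Vandermonde convolution. *)
  transitivity (\det (\matrix_(i, l < n) ('C(i, l))%:R *m A)).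
    rewrite det_mulmx det_trig ?big1 ?mul1r// => [i _|].
      by rewrite mxE binn.
    by apply/is_trig_mxP => i j ij; rewrite mxE bin_small.
  congr (\det _); apply/matrixP => i j; rewrite !mxE.
  rewrite addnC -binomial.Vandermonde natr_sum.
  rewrite [LHS](eq_bigr (fun l : 'I_n => ('C(i, l) *
    (if (l <= y j)%N then 'C(s, y j - l) else 0))%:R)); last first.
    by move=> l _; rewrite /A !mxE natrM.
  pose g (l : nat) : R :=
    ('C(i, l) * (if (l <= y j)%N then 'C(s, y j - l) else 0))%:R.
  transitivity (\sum_(l < n + (y j).+1) g l).
    rewrite -(big_mkord xpredT g) -(big_mkord xpredT g).
    rewrite [RHS](@big_cat_nat _ _ _ n)//= ?leq_addr//.
    rewrite [X in _ = _ + X]big_nat_cond [X in _ = _ + X]big1 ?addr0// => l.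
    rewrite /g andbT => /andP[nl _]; rewrite bin_small ?mul0n//.
    exact: leq_trans (ltn_ord i) nl.
  rewrite -(big_mkord xpredT g).
  rewrite (@big_cat_nat _ _ _ (y j).+1)//= ?leq_addl//.
  rewrite big_mkord [X in _ + X]big_nat_cond [X in _ + X]big1 ?addr0//.
    by apply: eq_bigr => l _; rewrite /g -ltnS ltn_ord.
  move=> l; rewrite /g andbT => /andP[nl _].
  by rewrite leqNgt nl/= muln0.
rewrite detA {A detA}.
have [n0|n0] := posnP n; first by subst n; rewrite det_mx00 !big_ord0 invr1 !mulr1.
set S := (s + n.-1)%N.
have ffS (k : 'I_n) : (S ^_ k)%:R != 0 :> R.
  by rewrite pnatr_eq0 -lt0n ffact_gt0 /S; have := ltn_ord k; lia.
pose z (j : 'I_n) := (S - y (rev_ord j))%N.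
(* A column with [y j > S] vanishes together with the factor [C(S, y j)]; otherwise the truncated
   differences [S - y j] are exact. *)
have [/existsP[j0 yS]|/existsPn yS] := boolP [exists j, (S < y j)%N].
  rewrite (expand_det_col _ j0) big1 => [|i _]; last first.
    rewrite mxE bin_small ?mul0r//; apply: leq_ltn_trans yS.
    by rewrite /S leq_add2l -ltnS prednK//.
  by rewrite (bigD1 j0)//= bin_small// !mul0r.
(* Row [i] corresponds to [k = n - 1 - i], and [S^_k C(S - k, y) = C(S, y) (S - y)^_k]. The degree
   decreases with [i], hence the later reversal of rows and columns. *)
transitivity (\det (\matrix_(i, j < n)
   ((S ^_ (rev_ord i))%:R^-1 * (('C(S, y j))%:R *
     ((S - y j) ^_ (rev_ord i))%:R)) : 'M[R]_n)).
  congr (\det _); apply/matrixP => i j; rewrite !mxE.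
  apply: (mulfI (ffS (rev_ord i))); rewrite mulVKf// -!natrM.
  congr (_%:R); have := yS j; rewrite -leqNgt => yjS.
  have -> : (s + i = S - rev_ord i)%N.
    by rewrite /S/=; have := ltn_ord i; lia.
  set k : nat := rev_ord i.
  have kS : (k <= S)%N by rewrite /k/= /S; have := ltn_ord i; lia.
  have [ky|ky] := leqP (y j + k) S.
    have e1 := ffact_fact kS.
    have e2 : ((S - y j) ^_ k * (S - y j - k)`! = (S - y j)`!)%N.
      by apply: ffact_fact; lia.
    have e3 := bin_fact yjS.
    have e4 : ('C(S - k, y j) * ((y j)`! * (S - k - y j)`!) = (S - k)`!)%N.
      by apply: bin_fact; lia.
    apply/eqP; rewrite -(eqn_pmul2r (fact_gt0 (S - k - y j))).
    rewrite -(eqn_pmul2r (fact_gt0 (y j))); apply/eqP.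
    transitivity (S`!)%N.
      by rewrite -e1 -e4; ring.
    rewrite -e3 -e2.
    have -> : (S - y j - k = S - k - y j)%N by lia.
    by ring.
  by rewrite bin_small ?muln0 ?(@ffact_small (S - y j))//; lia.
rewrite det_scale_rows det_scale_cols.
rewrite prodfV mulrA [X in _ = X * _]mulrC; congr (_^-1 * _ * _).
  by rewrite [RHS](reindex_inj rev_ord_inj).
transitivity (\det (\matrix_(i, j < n) (z j ^_ i)%:R : 'M[R]_n)).
  rewrite -[RHS]det_mxsub_rev; apply: (congr1 determinant); apply/matrixP => i j.
  by rewrite !mxE /z rev_ordK.
rewrite det_ffact_vandermonde.
under eq_bigr => i _ do rewrite big_mkcond.
under [RHS]eq_bigr => i _ do rewrite big_mkcond.
rewrite exchange_big (reindex_inj rev_ord_inj) /=.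
apply: eq_bigr => i _; rewrite (reindex_inj rev_ord_inj) /=.
apply: eq_bigr => j _; rewrite /z !rev_ordK.
have := yS i; have := yS j; rewrite -!leqNgt => yj yi.
rewrite !natrB//.
have -> : ((n - j.+1 < n - i.+1) = (i < j))%N.
  by have := ltn_ord i; have := ltn_ord j; lia.
by case: ifP => // _; ring.
Qed.

End determinants.

(** * Killed Bernoulli walks and Gelfand-Tsetlin patterns *)

Section lines.
Variable (R : realFieldType) (M : nat).

Definition line n := {ffun 'I_n -> 'I_M}.

Definition strict n (u : line n) : bool :=
  [forall i : 'I_n, forall j : 'I_n, (i < j)%N ==> (u i < u j)%N].

(** [lift ord_max i] is the index [i] and [lift ord0 i] the index [i + 1]: the condition is
    [u_i <= v_i < u_(i+1)]. A particle may share the position of the lower particle that blocks it,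
    but stays strictly beyond the one that pushes it. *)
Definition interlace n (u : line n.+1) (v : line n) : bool :=
  [forall i : 'I_n, (u (lift ord_max i) <= v i < u (lift ord0 i))%N].

Definition jump n (u v : line n) : bool :=
  [forall i, (v i == u i :> nat) || (v i == (u i).+1 :> nat)].

Definition bern_kernel n (u v : line n) : R :=
  2^-1 ^+ n * (jump u v && strict v)%:R.

(* The new position of particle [i] of [u] given the new lower line [v] and the
   bit [e]; [unlift ord_max] and [unlift ord0] select the lower neighbours that
   block and push it. *)
Definition moved n (u : line n.+1) (v : line n) (i : 'I_n.+1) (e : bool) : int :=
  let z := (u i)%:Z + e%:Z in
  z - (if unlift ord_max i is Some k then z == (v k)%:Z + 1 else false)%:Z
    + (if unlift ord0 i is Some k then z == (v k)%:Z else false)%:Z.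

(** Conditional probability that the upper line moves from [u] to [u'] once the new lower line [v]
    is known; the particles use separate bits, whence the product. *)
Definition move_weight n (u : line n.+1) (v : line n) (u' : line n.+1) : R :=
  \prod_i (2^-1 * \sum_(e : bool) (moved u v i e == (u' i)%:Z)%:R).

Lemma strictP n (u : line n) :
  reflect (forall i j : 'I_n, (i < j)%N -> (u i < u j)%N) (strict u).
Proof.
apply: (iffP forallP) => [H i j ij|H i]; first exact: (implyP (forallP (H i) j)).
by apply/forallP => j; apply/implyP; exact: H.
Qed.

Lemma interlace_strict n (u : line n.+1) (v : line n) :
  strict u -> interlace u v -> strict v.
Proof.
move=> /strictP su /forallP uv; apply/strictP => i j ij.
have /andP[_ vi] := uv i; have /andP[vj _] := uv j.
apply: leq_trans vi (leq_trans _ vj).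
have [->//|ne] := eqVneq (lift ord0 i) (lift ord_max j).
apply/ltnW/su; rewrite ltn_neqAle; apply/andP; split => //.
by rewrite /= /bump /= (leqNgt n) ltn_ord.
Qed.

Lemma natr_forall (I : finType) (b : pred I) :
  \prod_i (b i)%:R = [forall i, b i]%:R :> R.
Proof.
have [/forallP H|/forallPn[i Hi]] := boolP [forall i, b i].
  by rewrite big1// => i _; rewrite H.
by rewrite (bigD1 i)//= (negbTE Hi) mul0r.
Qed.

(** An interior [x] has the two predecessors [x] and [x - 1]; an end of [[a, c]] has only one, and
    there a factor 2 compensates. The same factors come out of [count_moves]. *)
Lemma count_before (a c : nat) (x : 'I_M) : (a < c)%N ->
  (\sum_(k : 'I_M)
    [&& (a <= k)%N, (k < c)%N & (x == k :> nat) || (x == k.+1 :> nat)]%:R)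
    * (1 + (x == a :> nat)%:R) * (1 + (x == c :> nat)%:R)
  = 2 * (a <= x <= c)%N%:R :> R.
Proof.
move=> ac.
have -> : \sum_(k : 'I_M) [&& (a <= k)%N, (k < c)%N &
    (x == k :> nat) || (x == k.+1 :> nat)]%:R =
    (a <= x < c)%N%:R + (a < x <= c)%N%:R :> R.
  rewrite (bigD1 x)//= eqxx/= andbT; congr (_ + _).
  have [x0|x0] := posnP x.
    rewrite x0 ltn0/= big1// => k kx.
    have /negbTE -> : 0%N != k :> nat by rewrite eq_sym -x0.
    by rewrite /= !andbF.
  have xM : (x.-1 < M)%N by have := ltn_ord x; lia.
  rewrite (bigD1 (Ordinal xM)) ?big1 ?addr0//=.
  - have -> : (x == x.-1.+1 :> nat) by lia.
    rewrite orbT andbT addr0; congr (_%:R); congr nat_of_bool; lia.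
  - move=> k /andP[kx kx1].
    have /negbTE -> : x != k :> nat by rewrite eq_sym.
    have /negbTE -> : x != k.+1 :> nat.
      by apply: contra kx1 => /eqP e; apply/eqP/val_inj => /=; lia.
    by rewrite /= !andbF.
  - by apply/eqP => /(congr1 val)/=; lia.
have [xa|xa] := eqVneq (x : nat) a.
  have [xc|xc] := eqVneq (x : nat) c; first by move: ac; rewrite -xa -xc ltnn.
  have -> : (a <= x < c)%N by lia.
  have -> : (a < x <= c)%N = false by lia.
  have -> : (a <= x <= c)%N by lia.
  by rewrite /=; ring.
have [xc|xc] := eqVneq (x : nat) c.
  have -> : (a <= x < c)%N = false by lia.
  have -> : (a < x <= c)%N by lia.
  have -> : (a <= x <= c)%N by lia.
  by rewrite /=; ring.
have [xac|xac] := boolP (a <= x <= c)%N.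
  have -> : (a <= x < c)%N by lia.
  have -> : (a < x <= c)%N by lia.
  by rewrite /=; ring.
have -> : (a <= x < c)%N = false by lia.
have -> : (a < x <= c)%N = false by lia.
by rewrite /=; ring.
Qed.

(** [r] is the blocking and [l] the pushing neighbour. If the blocker sits at [u], both bits leave
    the particle at [u]; if the pusher does, both bring it to [u + 1]. Otherwise each admissible
    target is reached by exactly one bit. *)
Lemma count_moves (u u' : nat) (l r : option nat) :
  (if r is Some x then u <= x else true)%N ->
  (if l is Some x then x <= u else true)%N ->
  ~~ ((r == Some u) && (l == Some u)) ->
  \sum_(e : bool)
    (let z := u%:Z + e%:Z in
     z - (if r is Some x then z == x%:Z + 1 else false)%:Z
       + (if l is Some x then z == x%:Z else false)%:Z == u'%:Z)%:R =
  (1 + (r == Some u)%:R) * (1 + (l == Some u)%:R) *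
  [&& (u' == u) || (u' == u.+1), (if r is Some x then u' <= x else true)%N
    & (if l is Some x then x < u' else true)%N]%:R :> R.
Proof.
move=> Hr Hl Hlr; rewrite big_bool /=.
set A1 := nat_of_bool (_ == _); set A0 := nat_of_bool (_ == _).
suff H : (A1 + A0 = (1 + (r == Some u)) * (1 + (l == Some u)) *
  [&& (u' == u) || (u' == u.+1), (if r is Some x then u' <= x else true)
    & (if l is Some x then x < u' else true)])%N.
  by rewrite -natrD H !natrM !natrD.
rewrite {}/A1 {}/A0; case: r Hr Hlr => [x|] Hr; case: l Hl => [y|] Hl //=;
  rewrite ?(inj_eq Some_inj).
- move=> Hxy /=.
  have [xu|xu] := eqVneq x u; have [yu|yu] := eqVneq y u => /=.
  + by move: Hxy; rewrite xu yu eqxx.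
  + have -> : (u%:Z + 1 == x%:Z + 1) by lia.
    have -> : (u%:Z + 1 == y%:Z) = false by lia.
    have -> : (u%:Z + 0 == x%:Z + 1) = false by lia.
    have -> : (u%:Z + 0 == y%:Z) = false by lia.
    by lia.
  + have -> : (u%:Z + 1 == x%:Z + 1) = false by lia.
    have -> : (u%:Z + 1 == y%:Z) = false by lia.
    have -> : (u%:Z + 0 == x%:Z + 1) = false by lia.
    have -> : (u%:Z + 0 == y%:Z) by lia.
    by lia.
  + have -> : (u%:Z + 1 == x%:Z + 1) = false by lia.
    have -> : (u%:Z + 1 == y%:Z) = false by lia.
    have -> : (u%:Z + 0 == x%:Z + 1) = false by lia.
    have -> : (u%:Z + 0 == y%:Z) = false by lia.
    by lia.
- move=> _ /=.
  have [xu|xu] := eqVneq x u => /=.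
  + have -> : (u%:Z + 1 == x%:Z + 1) by lia.
    have -> : (u%:Z + 0 == x%:Z + 1) = false by lia.
    by lia.
  + have -> : (u%:Z + 1 == x%:Z + 1) = false by lia.
    have -> : (u%:Z + 0 == x%:Z + 1) = false by lia.
    by lia.
- move=> _ /=.
  have [yu|yu] := eqVneq y u => /=.
  + have -> : (u%:Z + 1 == y%:Z) = false by lia.
    have -> : (u%:Z + 0 == y%:Z) by lia.
    by lia.
  + have -> : (u%:Z + 1 == y%:Z) = false by lia.
    have -> : (u%:Z + 0 == y%:Z) = false by lia.
    by lia.
- by move=> _; lia.
Qed.

(* Both sides vanish unless [u'] is a step of [u] interlacing with [v'].  Then
   the sum over [v] factorises: particle [k] of [v'] has two possible
   predecessors, or one if it sits at an end of its interlacing interval, and in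
   the latter case both bits of the neighbour of [u] give the same move. *)
Lemma bern_interlace n (u u' : line n.+1) (v' : line n) : strict u ->
  (\sum_(v | interlace u v) bern_kernel v v') * move_weight u v' u' =
  bern_kernel u u' * (interlace u' v')%:R.
Proof.
move=> su; have [sv'|sv'] := boolP (strict v'); last first.
  rewrite big1 ?mul0r => [|v _]; last by rewrite /bern_kernel (negbTE sv') andbF mulr0.
  rewrite /bern_kernel; have [ui|_] := boolP (interlace u' v'); last by rewrite mulr0.
  have [su'|su'] := boolP (strict u'); last by rewrite andbF mulr0 mul0r.
  by rewrite (interlace_strict su' ui) in sv'.
have lt_u (i : 'I_n) : (u (lift ord_max i) < u (lift ord0 i))%N.
  by apply: (elimT (strictP u)) => //; rewrite lift_max lift0.
have -> : \sum_(v | interlace u v) bern_kernel v v' =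
    2^-1 ^+ n * \prod_i \sum_(k : 'I_M)
    [&& (u (lift ord_max i) <= k)%N, (k < u (lift ord0 i))%N &
      (v' i == k :> nat) || (v' i == k.+1 :> nat)]%:R.
  rewrite bigA_distr_bigA big_distrr /= big_mkcond; apply: eq_bigr => v _.
  rewrite natr_forall /bern_kernel sv' andbT.
  case: ifP => [/forallP uv|uv].
    congr (_ * (nat_of_bool _)%:R).
    by apply: eq_forallb => i; have /andP[-> ->] := uv i.
  rewrite (_ : [forall _, _] = false) ?mulr0//.
  apply: contraFF uv => /forallP H; apply/forallP => i.
  by have /and3P[-> -> _] := H i.
have [/forallP uv|/forallPn[i0 uv]] := boolP [forall i,
    (u (lift ord_max i) <= v' i <= u (lift ord0 i))%N]; last first.
  (* Here [v' i0] has no predecessor in its interval, and no step [u'] of [u] can interlace with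
     [v']. *)
  rewrite (bigD1 i0)//= big1 => [|k _]; last first.
    case: and3P => //= -[uk ku /orP[]/eqP vk]; move: uv; rewrite vk.
      by rewrite uk ltnW.
    by rewrite (leqW uk) ku.
  rewrite mul0r mulr0 mul0r.
  rewrite /bern_kernel.
  have [/andP[/forallP uu' _]|_] := boolP (jump u u' && strict u'); last first.
    by rewrite mulr0 mul0r.
  have [/forallP u'v|_] := boolP (interlace u' v'); last by rewrite mulr0.
  by have := u'v i0; have := uu' (lift ord_max i0); have := uu' (lift ord0 i0); lia.
pose nbr (k : option 'I_n) := if k is Some k then Some (v' k : nat) else None.
pose rho i : R := 1 + (nbr (unlift ord_max i) == Some (u i : nat))%:R.
pose lam i : R := 1 + (nbr (unlift ord0 i) == Some (u i : nat))%:R.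
pose ok i := [&& (u' i == u i :> nat) || (u' i == (u i).+1 :> nat),
  (if nbr (unlift ord_max i) is Some x then u' i <= x else true)%N
  & (if nbr (unlift ord0 i) is Some x then x < u' i else true)%N].
have -> : move_weight u v' u' =
    2^-1 ^+ n.+1 * (\prod_i rho i * \prod_i lam i * \prod_i (ok i)%:R).
  have -> : 2^-1 ^+ n.+1 = \prod_(i < n.+1) 2^-1 :> R.
    by rewrite prodr_const card_ord.
  rewrite -!big_split /=.
  apply: eq_bigr => i _; congr (_ * _).
  rewrite -count_moves.
  - apply: eq_bigr => e _; rewrite /moved /nbr.
    by case: (unlift ord_max i) => [k|]; case: (unlift ord0 i) => [l|].
  - by rewrite /nbr; case: unliftP => // k ->; have /andP[] := uv k.
  - by rewrite /nbr; case: unliftP => // k ->; have /andP[] := uv k.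
  - rewrite /nbr; case: unliftP => [k ik|_]; case: unliftP => [l il|_]//=.
    + apply/negP => /andP[/eqP[ki] /eqP[li]].
      have : (v' l < v' k)%N; last by rewrite ki li ltnn.
      apply: (elimT (strictP v')) => //.
      by have := lift_max k; rewrite -ik il lift0 => <-.
    + by rewrite andbF.
have -> : \prod_i rho i = \prod_k (1 + (v' k == u (lift ord_max k) :> nat)%:R).
  rewrite (bigD1_ord ord_max)//= {1}/rho unlift_none /= addr0 mul1r.
  by apply: eq_bigr => k _; rewrite /rho liftK.
have -> : \prod_i lam i = \prod_k (1 + (v' k == u (lift ord0 k) :> nat)%:R).
  rewrite (bigD1_ord ord0)//= {1}/lam unlift_none /= addr0 mul1r.
  by apply: eq_bigr => k _; rewrite /lam liftK.
rewrite natr_forall.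
set X := \prod_i \sum_k _; set Y := \prod_k _; set Z := \prod_k _.
(* Each interlacing interval contributes exactly 2, which cancels the [2^-1 ^+ n] of the lower line;
   what remains are the constraints [ok]. *)
have XYZ : X * Y * Z = 2 ^+ n.
  rewrite /X /Y /Z -!big_split /= -[in RHS](card_ord n) -prodr_const.
  by apply: eq_bigr => k _; rewrite count_before// uv mulr1.
transitivity (2^-1 ^+ n * (X * Y * Z) * (2^-1 ^+ n.+1 * [forall i, ok i]%:R)).
  by ring.
rewrite XYZ -exprMn mulVf ?pnatr_eq0// expr1n mul1r /bern_kernel -mulrA -natrM.
rewrite mulnb; congr (_ * (nat_of_bool _)%:R).
apply/forallP/andP => [H|[/andP[/forallP uu' /strictP su'] /forallP u'v] i].
  have u'v : interlace u' v'.
    apply/forallP => k; have /and3P[_ + _] := H (lift ord_max k).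
    rewrite liftK /= => ->; have /and3P[_ _ +] := H (lift ord0 k).
    by rewrite liftK.
  split => //; apply/andP; split; first by apply/forallP => i; have /and3P[] := H i.
  (* Strictness of [u'] is implied by interlacing: [u'_i <= v'_i <= v'_(j-1) < u'_j]. *)
  apply/strictP => i j ij.
  have [i1 ei] : exists i1, i = lift ord_max i1.
    case: (unliftP ord_max i) => [k|] ei; first by exists k.
    by move: ij; rewrite ei /= ltnNge -ltnS ltn_ord.
  have [j1 ej] : exists j1, j = lift ord0 j1.
    case: (unliftP ord0 j) => [k|] ej; first by exists k.
    by move: ij; rewrite ej.
  have /andP[h1 _] := forallP u'v i1; have /andP[_ h2] := forallP u'v j1.
  rewrite ei ej; apply: leq_ltn_trans h1 (leq_ltn_trans _ h2).
  have [->//|ne] := eqVneq i1 j1; apply/ltnW/(elimT (strictP v') sv').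
  rewrite ltn_neqAle; apply/andP; split=> //.
  by move: ij; rewrite ei ej lift_max lift0.
apply/and3P; split; first exact: uu'.
  by rewrite /nbr; case: unliftP => // k ->; have /andP[] := u'v k.
by rewrite /nbr; case: unliftP => // k ->; have /andP[] := u'v k.
Qed.

(* The number of Gelfand-Tsetlin patterns with top line [u]. *)
Fixpoint gt_count n : line n -> nat :=
  if n is n'.+1 then fun u => \sum_(v | interlace u v) gt_count v else fun=> 1%N.

(** Hockey-stick identity: a discrete integration, raising the degree by one. *)
Lemma sum_bin (a c j : nat) : (a <= c <= M)%N ->
  \sum_(k : 'I_M) (a <= k < c)%N%:R * ('C(k, j))%:R =
  ('C(c, j.+1))%:R - ('C(a, j.+1))%:R :> R.
Proof.
move=> /andP[ac cM].
transitivity (\sum_(a <= k < c) ('C(k, j))%:R : R).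
  under eq_bigr => k _ do rewrite -natrM mulnbl.
  rewrite -(big_mkord xpredT (fun k => (if (a <= k < c)%N then 'C(k, j) else 0)%:R)).
  rewrite (big_cat_nat (n := a))//= ?(leq_trans ac)//.
  rewrite (big_cat_nat (m := a) (n := c))//=.
  rewrite big_nat_cond big1 ?add0r => [|k]; last first.
    by rewrite andbT => /andP[_ ka]; rewrite leqNgt ka.
  rewrite [X in _ + X]big_nat_cond [X in _ + X]big1 ?addr0 => [|k]; last first.
    by rewrite andbT => /andP[ck _]; rewrite (ltnNge k) ck andbF.
  by apply: eq_big_nat => k ->.
rewrite -(subnKC ac); elim: (c - a)%N => [|d IH].
  by rewrite addn0 big_geq// subrr.
rewrite addnS big_nat_recr ?leq_addr//= IH binS natrD; ring.
Qed.

(** The sum over interlacing [v] factorises row by row, and by [sum_bin] row [i] becomes the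
    difference of rows [i + 1] and [i] of the larger matrix. These differences are the row
    operations that clear its first column of ones below the top entry. *)
Lemma gt_count_det n (u : line n) : strict u ->
  (gt_count u)%:R = \det (\matrix_(i, j < n) ('C(u i, j))%:R) :> R.
Proof.
elim: n u => [|n IH] u su; first by rewrite det_mx00.
have su' := elimT (strictP u) su.
have lt_u (i : 'I_n) : (u (lift ord_max i) < u (lift ord0 i))%N.
  by apply: su' => //; rewrite lift_max lift0.
transitivity (\det (\matrix_(i, j < n)
   (('C(u (lift ord0 i), j.+1))%:R - ('C(u (lift ord_max i), j.+1))%:R) : 'M[R]_n)).
  rewrite /= natr_sum.
  transitivity (\sum_(v : line n) \det (\matrix_(i, j < n)
      ((u (lift ord_max i) <= v i < u (lift ord0 i))%N%:R * ('C(v i, j))%:R) : 'M[R]_n)).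
    rewrite [LHS]big_mkcond; apply: eq_bigr => v _.
    rewrite det_scale_rows natr_forall -/(interlace u v).
    have [uv|_] := boolP (interlace u v); last by rewrite mul0r.
    by rewrite mul1r IH// (interlace_strict su uv).
  rewrite -(det_sum_rows (fun i (k : 'I_M) j =>
    (u (lift ord_max i) <= k < u (lift ord0 i))%N%:R * ('C(k, j))%:R)).
  congr (\det _); apply/matrixP => i j; rewrite !mxE sum_bin//.
  by rewrite ltnW//= ltnW.
pose L : 'M[R]_n.+1 :=
  \matrix_(i, k) ((i == k)%:R - (i == k.+1 :> nat)%:R).
set A := (X in _ = \det X).
have detL : \det L = 1.
  rewrite det_trig ?big1// => [i _|].
    by rewrite mxE eqxx (ltn_eqF (ltnSn i)) subr0.
  apply/is_trig_mxP => i k ik; rewrite mxE.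
  have /negbTE -> : i != k by rewrite neq_ltn ik.
  by rewrite (ltn_eqF (leqW ik)) subr0.
have LA0 j : (L *m A) ord0 j = A ord0 j.
  rewrite mxE (bigD1 ord0)//= big1 ?addr0 => [|k k0]; last first.
    by rewrite mxE eq_sym (negbTE k0) subr0 mul0r.
  by rewrite mxE eqxx subr0 mul1r.
have LA i j : (L *m A) (lift ord0 i) j = A (lift ord0 i) j - A (lift ord_max i) j.
  rewrite mxE (bigD1 (lift ord0 i))//= (bigD1 (lift ord_max i))//=; last first.
    by apply/eqP => /(congr1 (@nat_of_ord _)); rewrite lift_max lift0; lia.
  rewrite big1 ?addr0 => [|k /andP[k0 k1]]; last first.
    rewrite mxE eq_sym (negbTE k0) [_ == _](_ : _ = false) ?subr0 ?mul0r//.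
    apply: contraNF k1 => /eqP; rewrite lift0 => -[ik].
    by apply/eqP/ord_inj; rewrite lift_max ik.
  rewrite !mxE eqxx (_ : (_ == _.+1 :> nat) = false) ?subr0 ?mul1r; last first.
    by rewrite ltn_eqF.
  rewrite [_ == lift ord_max i](_ : _ = false); last first.
    by apply/eqP => /(congr1 (@nat_of_ord _)); rewrite lift_max lift0; lia.
  rewrite (_ : (_ == (lift ord_max i).+1 :> nat)) ?sub0r ?mulN1r//.
  by rewrite lift_max lift0.
have <- : \det (L *m A) = \det A by rewrite det_mulmx detL mul1r.
rewrite (expand_det_col _ ord0) (bigD1_ord ord0)//=.
rewrite [X in _ + X]big1 ?addr0 => [|i _]; last first.
  by rewrite LA !mxE !bin0 subrr mul0r.
rewrite LA0 mxE bin0 mul1r /cofactor expr0 mul1r; congr (\det _).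
apply/matrixP => i j; rewrite mxE [RHS]mxE [RHS]mxE LA !mxE.
by [].
Qed.

Lemma gt_count_vandermonde n (u : line n) : strict u ->
  (gt_count u)%:R = (\prod_(i < n) (i`!)%:R)^-1 *
  \prod_(i < n) \prod_(j < n | (i < j)%N) ((u j)%:R - (u i)%:R) :> R.
Proof. by move=> su; rewrite gt_count_det// det_bin_vandermonde. Qed.

(** * Transition probabilities of the killed walk *)

Definition binom_pmf r (a b : nat) : R :=
  (if (a <= b)%N then 'C(r, b - a) else 0)%:R / 2 ^+ r.

Lemma binom_pmfS r a b :
  binom_pmf r.+1 a b = 2^-1 * (binom_pmf r a b + binom_pmf r a.+1 b).
Proof.
rewrite /binom_pmf exprS invfM mulrCA -mulrDl -natrD; congr (_ * (_%:R / _)).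
case: (ltngtP a b) => [ab|//|->]; last by rewrite subnn !bin0.
by rewrite -(subnSK ab) binS addnC.
Qed.

Fixpoint bern_iter r n (u w : line n) : R :=
  if r is r'.+1 then \sum_v bern_kernel u v * bern_iter r' v w else (u == w)%:R.

Lemma bern_kernel_ge0 n (u v : line n) : 0 <= bern_kernel u v.
Proof. by rewrite mulr_ge0// exprn_ge0// invr_ge0. Qed.

Lemma bern_iter_ge0 r n (u w : line n) : 0 <= bern_iter r u w.
Proof.
elim: r u => [|r IH] u //=.
by apply: sumr_ge0 => v _; rewrite mulr_ge0// bern_kernel_ge0.
Qed.

Lemma strict_inj n (u w : line n) : strict u -> strict w ->
  (forall i, exists j, u i = w j :> nat) ->
  (forall i, exists j, w i = u j :> nat) -> u = w.
Proof.
move=> su sw uw wu.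
have srt (v : line n) : strict v ->
    sorted ltn [seq (v i : nat) | i <- enum 'I_n].
  move=> /strictP sv; rewrite sorted_map.
  apply: (@sub_sorted _ (relpre val ltn)) => [i j|]; first exact: sv.
  by rewrite -sorted_map val_enum_ord iota_ltn_sorted.
have e : [seq (u i : nat) | i <- enum 'I_n] = [seq (w i : nat) | i <- enum 'I_n].
  apply: (irr_sorted_eq ltn_trans ltnn) => [||k]; rewrite ?srt//.
  apply/mapP/mapP => -[i _ ->].
    by have [j ->] := uw i; exists j; rewrite ?mem_enum.
  by have [j ->] := wu i; exists j; rewrite ?mem_enum.
apply/ffunP => i; apply: val_inj; move: e => /eq_in_map; apply.
by rewrite mem_enum.
Qed.

(* Karlin-McGregor: a step [v] of [u] that is not strictly increasing has two
   equal entries, so that it contributes a vanishing determinant. *)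
Lemma det_binom_pmf r n (u w : line n) : strict u -> strict w ->
  \det (\matrix_(i, j < n) binom_pmf r (u i) (w j)) = bern_iter r u w.
Proof.
move=> + sw; elim: r u => [|r IH] u su /=.
  have [->|uw] := eqVneq u w.
    rewrite (_ : \matrix_(i, j) _ = 1%:M) ?det1//.
    apply/matrixP => i j; rewrite !mxE /binom_pmf expr0 divr1; congr (_%:R).
    case: ifP => wij; last first.
      by rewrite [i == j](_ : _ = false)//; apply: contraFF wij => /eqP->.
    have [->|ij] := eqVneq i j; first by rewrite subnn.
    rewrite bin0n; have := elimT (strictP w) sw i j; have := elimT (strictP w) sw j i.
    case: (ltngtP i j) => [||/val_inj] e; last by rewrite e eqxx in ij.
      by move=> _ /(_ isT); lia.
    by move=> /(_ isT); lia.
  have [/forallP H1|/forallPn[i0 H]] := boolP [forall i, exists j, u i == w j :> nat].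
    have [/forallP H2|/forallPn[j0 H]] := boolP [forall j, exists i, w j == u i :> nat].
      case/eqP: uw; apply: strict_inj => // i.
        by have /existsP[j /eqP] := H1 i; exists j.
      by have /existsP[j /eqP] := H2 i; exists j.
    rewrite (expand_det_col _ j0) big1// => i _; rewrite mxE /binom_pmf.
    move/existsPn : H => /(_ i) ne; case: ifP => le; last by rewrite !mul0r.
    by rewrite bin0n subn_eq0 leqNgt ltn_neqAle eq_sym ne le !mul0r.
  rewrite (expand_det_row _ i0) big1// => j _; rewrite mxE /binom_pmf.
  move/existsPn : H => /(_ j) ne; case: ifP => le; last by rewrite !mul0r.
  by rewrite bin0n subn_eq0 leqNgt ltn_neqAle ne le !mul0r.
have -> : \matrix_(i, j) binom_pmf r.+1 (u i) (w j) =
  \matrix_(i, j) \sum_(k : 'I_M) (2^-1 * ((k == u i :> nat) || (k == (u i).+1 :> nat))%:R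
     * binom_pmf r k (w j)).
  apply/matrixP => i j; rewrite !mxE binom_pmfS mulrDr.
  rewrite [RHS](bigD1 (u i))//= eqxx/= mulr1; congr (_ + _).
  have [uM|uM] := ltnP (u i).+1 M.
    rewrite (bigD1 (Ordinal uM)) ?big1/= ?eqxx ?orbT ?mulr1 ?addr0//.
      move=> k /andP[k1 k2]; rewrite -!val_eqE /= in k1 k2.
      by rewrite (negbTE k1) (negbTE k2) mulr0 mul0r.
    by rewrite -val_eqE /= gtn_eqF.
  (* The step out of the window is missing from the sum, but its target exceeds every [w j], so its
     binomial term is 0. *)
  rewrite big1 => [|k k1].
    by rewrite /binom_pmf leqNgt (leq_trans (ltn_ord (w j)))// !mul0r mulr0.
  rewrite -val_eqE /= in k1; rewrite (negbTE k1) (_ : (_ == _.+1 :> nat) = false).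
    by rewrite mulr0 mul0r.
  by rewrite ltn_eqF// (leq_trans (ltn_ord k)).
rewrite det_sum_rows; apply: eq_bigr => v _.
rewrite det_scale_rows big_split /= prodr_const card_ord natr_forall /bern_kernel.
rewrite -/(jump u v).
have [uv|_] := boolP (jump u v); last by rewrite mulr0 !mul0r.
have [sv|sv] := boolP (strict v).
  by rewrite !mulr1 IH.
rewrite mulr0 mul0r mulr1.
(* Steps have size at most 1, so particles that were ordered and no longer are must meet. *)
have [i [j [ij vij]]] : exists i j : 'I_n, i != j /\ v i = v j :> nat.
  move: sv => /forallPn[i /forallPn[j]]; rewrite negb_imply => /andP[ij vij].
  exists i, j; split; first by rewrite neq_ltn ij.
  rewrite -leqNgt in vij.
  have arith (a b c d : nat) : (c == a) || (c == a.+1) ->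
      (d == b) || (d == b.+1) -> (a < b -> d <= c -> c = d)%N by lia.
  exact: arith (forallP uv i) (forallP uv j) (elimT (strictP u) su _ _ ij) vij.
rewrite (determinant_alternate ij) ?mulr0// => k.
by rewrite !mxE vij.
Qed.

End lines.

(** * The local limit theorem for binomial coefficients *)

Section binomial_shape.
Variable R : realType.

Lemma ln1D_quad (a : R) : `|a| <= 2^-1 -> `|ln (1 + a) - a| <= 2 * a ^+ 2.
Proof.
move=> ha; have /andP[a1 a2] : - 2^-1 <= a <= 2^-1 by rewrite -ler_norml.
have a1p : 0 < 1 + a by lra.
have le1 : ln (1 + a) <= a by apply: le_ln1Dx; lra.
have ge1 : a / (1 + a) <= ln (1 + a).
  rewrite -lerN2 -lnV ?posrE//.
  rewrite [X in ln X](_ : _ = 1 + - (a / (1 + a))); last first.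
    by field; rewrite gt_eqF.
  apply: le_ln1Dx.
  by rewrite ltrN2 ltr_pdivrMr// mul1r; lra.
rewrite ler_norml lerBrDr lerBlDr; apply/andP; split; last first.
  by have := sqr_ge0 a; lra.
apply: le_trans ge1; rewrite ler_pdivlMr//.
by have := sqr_ge0 a; nra.
Qed.

Lemma cvg_sqrt_natr : (Num.sqrt N%:R : R) @[N --> \oo] --> +oo.
Proof.
apply/cvgryPge => A; near=> N.
have [A0|A0] := leP A 0; first by rewrite (le_trans A0)// sqrtr_ge0.
have <- : Num.sqrt (A ^+ 2) = A by rewrite sqrtr_sqr ger0_norm// ltW.
rewrite ler_wsqrtr//; near: N; exact: nbhs_infty_ger.
Unshelve. all: by end_near.
Qed.

Lemma cvg_sqrt_natrV : (Num.sqrt N%:R : R)^-1 @[N --> \oo] --> (0 : R).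
Proof.
apply/gtr0_cvgV0; last exact: cvg_sqrt_natr.
by near=> N; rewrite sqrtr_gt0 ltr0n; near: N; exact: nbhs_infty_gt.
Unshelve. all: by end_near.
Qed.

(** With [h = y / sqrt N], [m = k + l] and [d = k - l], the logarithm is [m / 2 * ln (1 - h^2) + d /
    2 * (ln (1 + h) - ln (1 - h))]. Since [m] has order [N] and [d] order [sqrt N], the leading term
    of each expansion suffices. *)
Lemma cvg_binomial_shape (k l : nat -> nat) (D x y : R) :
  ((k N)%:R + (l N)%:R) / N%:R @[N --> \oo] --> D ->
  ((k N)%:R - (l N)%:R) / Num.sqrt N%:R @[N --> \oo] --> x ->
  (1 + y / Num.sqrt N%:R) ^+ k N * (1 - y / Num.sqrt N%:R) ^+ l N
    @[N --> \oo] --> expR (x * y - D * y ^+ 2 / 2).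
Proof.
move=> kD kx.
pose h (N : nat) : R := y / Num.sqrt N%:R.
have sqrtV0 := cvg_sqrt_natrV.
have h0 : h N @[N --> \oo] --> (0 : R).
  by rewrite -(mulr0 y); apply: cvgM => //; exact: cvg_cst.
pose m (N : nat) : R := (k N)%:R + (l N)%:R.
pose d (N : nat) : R := (k N)%:R - (l N)%:R.
have mh2 : m N * h N ^+ 2 @[N --> \oo] --> D * y ^+ 2.
  suff : (m N / N%:R) * y ^+ 2 @[N --> \oo] --> D * y ^+ 2.
    apply: cvg_trans; apply: near_eq_cvg; near=> N.
    by rewrite /h expr_div_n sqr_sqrtr//; ring.
  by apply: cvgM => //; exact: cvg_cst.
have dh : d N * h N @[N --> \oo] --> x * y.
  suff : (d N / Num.sqrt N%:R) * y @[N --> \oo] --> x * y.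
    apply: cvg_trans; apply: near_eq_cvg; near=> N.
    by rewrite /h; ring.
  by apply: cvgM => //; exact: cvg_cst.
pose err N : R := m N * h N ^+ 2 * h N ^+ 2 + 2 * `|d N * h N * h N|.
have err0 : err N @[N --> \oo] --> (0 : R).
  rewrite (_ : 0 = D * y ^+ 2 * (0 * 0) + 2 * `|x * y * 0|); last first.
    by rewrite !mulr0 normr0 mulr0 addr0.
  apply: cvgD; first by apply: cvgM => //; apply: cvgM.
  by apply: cvgM; [exact: cvg_cst|apply: cvg_norm; exact: cvgM].
suff lim : (k N)%:R * ln (1 + h N) + (l N)%:R * ln (1 - h N)
    @[N --> \oo] --> x * y - D * y ^+ 2 / 2.
  have : expR ((k N)%:R * ln (1 + h N) + (l N)%:R * ln (1 - h N))
      @[N --> \oo] --> expR (x * y - D * y ^+ 2 / 2).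
    by apply: continuous_cvg => //; exact: continuous_expR.
  apply: cvg_trans; apply: near_eq_cvg; near=> N.
  have hN : `|h N| < 1 / 2.
    by near: N; move/cvgr0Pnorm_lt : h0 => /(_ (1 / 2)); apply; lra.
  have /andP[h1 h2] : - (1 / 2) < h N < 1 / 2 by rewrite -ltr_norml.
  rewrite expRD !expRM_natl !lnK// posrE; lra.
have : d N * h N - m N * h N ^+ 2 / 2 @[N --> \oo] --> x * y - D * y ^+ 2 / 2.
  apply: cvgB => //; apply: cvgM => //; exact: cvg_cst.
move=> main; apply/cvgrPdist_lt => e e0.
near=> N.
have hN : `|h N| < 1 / 2.
  by near: N; move/cvgr0Pnorm_lt : h0 => /(_ (1 / 2)); apply; lra.
have /andP[h1 h2] : - (1 / 2) < h N < 1 / 2 by rewrite -ltr_norml.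
have e1 : `|x * y - D * y ^+ 2 / 2 - (d N * h N - m N * h N ^+ 2 / 2)| < e / 2.
  by near: N; move/cvgrPdist_lt : main; apply; lra.
have e2 : `|err N| < e / 2.
  by near: N; move/cvgr0Pnorm_lt : err0; apply; lra.
have hh : `|h N| <= 2^-1 by lra.
have q1 := @ln1D_quad (h N) hh.
have q2 : `|ln (1 - h N) - (- h N)| <= 2 * (- h N) ^+ 2.
  by apply: ln1D_quad; rewrite normrN.
have q3 : `|ln (1 - h N ^+ 2) - (- h N ^+ 2)| <= 2 * (- h N ^+ 2) ^+ 2.
  apply: ln1D_quad; rewrite normrN ger0_norm ?sqr_ge0//; nra.
have lnhh : ln (1 + h N) + ln (1 - h N) = ln (1 - h N ^+ 2).
  by rewrite -lnM ?posrE; [congr ln; ring|lra|lra].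
set a := ln (1 + h N) in q1 lnhh *; set b := ln (1 - h N) in q2 lnhh *.
set c := ln _ in q3 lnhh.
have m0 : 0 <= m N by rewrite addr_ge0.
have -> : (k N)%:R * a + (l N)%:R * b =
    m N / 2 * (a + b) + d N / 2 * (a - b) by rewrite /m /d; field.
rewrite lnhh.
have E : `|d N * h N - m N * h N ^+ 2 / 2 - (m N / 2 * c + d N / 2 * (a - b))|
    <= err N.
  have -> : d N * h N - m N * h N ^+ 2 / 2 - (m N / 2 * c + d N / 2 * (a - b)) =
    - (m N / 2 * (c - - h N ^+ 2)) - (d N / 2 * ((a - h N) - (b - - h N))) by field.
  rewrite (le_trans (ler_normB _ _))// normrN !normrM /err lerD//.
    rewrite (ger0_norm m0) ger0_norm//.
    apply: le_trans (ler_wpM2l _ q3) _; first by rewrite mulr_ge0.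
    by rewrite le_eqVlt; apply/orP; left; apply/eqP; field.
  rewrite (ger0_norm (_ : 0 <= 2^-1)) ?invr_ge0//.
  have e3 : `|a - h N - (b - - h N)| <= 4 * (`|h N| * `|h N|).
    apply: le_trans (ler_normB _ _) _.
    rewrite -normrM -expr2 ger0_norm ?sqr_ge0//.
    by move: q1 q2; rewrite sqrrN; lra.
  have := ler_wpM2l (normr_ge0 (d N)) e3.
  rewrite [`|d N * h N * h N|]normrM [`|d N * h N|]normrM.
  by move: (`|h N|) => g; lra.
have := ler_norm (err N).
move: (x * y - D * y ^+ 2 / 2) e1 E => L e1 E e3.
apply: le_lt_trans (ler_distD (d N * h N - m N * h N ^+ 2 / 2) _ _) _.
by lra.
Unshelve. all: by end_near.
Qed.

End binomial_shape.

(** * The beta integral in rescaled form *)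

Section beta_clt.
Variable R : realType.
Local Notation mu := (@lebesgue_measure R).

(** The affine map from [[-s, s]] onto [[0, 1]] turns this into the beta integral, at the cost of
    [2^(k + l)] and the slope [1 / (2 s)]. *)
Lemma integral_binomial_shape (k l : nat) (s : R) : 0 < s ->
  (\int[mu]_(y in `[(- s)%R, s]) ((1 + y / s) ^+ k * (1 - y / s) ^+ l)%R%:E =
   (2 * s * 2 ^+ (k + l) * (k`! * l`!)%:R / ((k + l).+1)`!%:R)%R%:E)%E.
Proof.
move=> s0.
pose F (y : R) := y * (2 * s)^-1 + 2^-1.
have Fs : F s = 1 by rewrite /F; field; rewrite gt_eqF.
have FNs : F (- s) = 0 by rewrite /F; field; rewrite gt_eqF.
have dF (y : R) : is_derive y 1 F (2 * s)^-1.
  rewrite /F; apply: is_derive_eq.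
  by rewrite !scaler0 add0r addr0 /GRing.scale/= mulr1.
have F' : (F^`())%classic = cst (2 * s)^-1.
  by apply/funext => y0; rewrite derive1E (@derive_val _ _ _ _ _ _ _ (dF y0)).
have cF : continuous F.
  move=> y; apply: differentiable_continuous; apply/derivable1_diffP.
  exact: (@ex_derive _ _ _ _ _ _ _ (dF y)).
have := @integration_by_substitution_increasing R F (XMonemX k l) (- s) s.
rewrite Fs FNs F'.
have -> : (\int[mu]_(x in `[0%R, 1%R]) (XMonemX k l x)%:E)%E =
    (beta_fun k.+1 l.+1)%:E.
  rewrite EFin_beta_fun /= [LHS]integral_mkcond; apply: eq_integral => x _.
  by rewrite restrict_EFin.
rewrite beta_fun_fact => sub.
have {}sub : ((k`! * l`!)%:R / (k + l).+1`!%:R)%:E =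
   (\int[mu]_(x in `[(- s)%R, s]) (((XMonemX k l \o F) * cst (2 * s)^-1)%R x)%:E)%E.
  apply: sub.
  - lra.
  - by move=> x y _ _ xy; rewrite /F ltrD2r ltr_pM2r// invr_gt0 mulr_gt0.
  - by move=> x _; exact: cst_continuous.
  - exact: is_cvg_cst.
  - exact: is_cvg_cst.
  - split.
    + by move=> x _; exact: (@ex_derive _ _ _ _ _ _ _ (dF x)).
    + by rewrite -?Fs -?FNs; apply: cvg_at_right_filter; exact: cF.
    + by apply: cvg_at_left_filter; exact: cF.
  - exact: within_continuous_XMonemX.
transitivity (\int[mu]_(y in `[(- s)%R, s]) ((2 * s * 2 ^+ (k + l))%R%:E *
    (((XMonemX k l \o F) * cst (2 * s)^-1)%R y)%:E))%E.
  apply: eq_integral => y _; rewrite -EFinM; congr EFin.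
  rewrite exprD.
  change (((XMonemX k l \o F) * cst (2 * s)^-1) y) with
    (F y ^+ k * (1 - F y) ^+ l * (2 * s)^-1).
  rewrite /F.
  have -> : y / (2 * s) + 2^-1 = 2^-1 * (1 + y / s) by field; rewrite gt_eqF.
  have -> : 1 - 2^-1 * (1 + y / s) = 2^-1 * (1 - y / s) by field; rewrite gt_eqF.
  rewrite [RHS](_ : _ = 2 * s * (2 ^+ k * 2 ^+ l) *
    ((2^-1 * (1 + y / s)) ^+ k * (2^-1 * (1 - y / s)) ^+ l * (2 * s)^-1))//.
  rewrite !exprMn !exprVn; field.
  by rewrite gt_eqF//= !expf_neq0// pnatr_eq0.
rewrite ge0_integralZl//.
- by rewrite -sub -EFinM; congr EFin; ring.
- apply/measurable_EFinP; apply: measurable_funM; last exact: measurable_cst.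
  apply: measurable_funTS; apply: measurableT_comp.
    exact: measurable_XMonemX.
  exact: continuous_measurable_fun.
- move=> y; rewrite /= in_itv/= => /andP[y1 y2]; rewrite lee_fin mulr_ge0//.
    apply: XMonemX_ge0; rewrite in_itv/= -Fs -FNs.
    by rewrite /F !lerD2r !ler_pM2r ?invr_gt0 ?mulr_gt0// y1.
  by rewrite invr_ge0 mulr_ge0// ltW.
- by rewrite lee_fin !mulr_ge0// ltW.
Qed.

End beta_clt.

(** * Laplace's method for the beta integral *)

Section local_clt.
Variable R : realType.
Local Notation mu := (@lebesgue_measure R).

(** Completing the square: mean [x / D], variance [1 / D]. *)
Lemma gauss_shift_pdf (D x y : R) : 0 < D ->
  expR (x * y - D * y ^+ 2 / 2) =
  Num.sqrt (2 * pi / D) * expR (x ^+ 2 / (2 * D)) *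
  normal_pdf (x / D) (Num.sqrt D)^-1 y.
Proof.
move=> D0.
have sD : (Num.sqrt D)^-1 != 0 by rewrite invr_neq0// gt_eqF// sqrtr_gt0.
have sD2 : (Num.sqrt D)^-1 ^+ 2 = D^-1 by rewrite exprVn sqr_sqrtr// ltW.
rewrite /normal_pdf (negbTE sD) /normal_peak /normal_fun sD2.
rewrite (_ : D^-1 * pi *+ 2 = 2 * pi / D); last by rewrite -mulr_natr; ring.
set S := Num.sqrt _.
have S0 : S != 0 by rewrite gt_eqF// sqrtr_gt0 divr_gt0// mulr_gt0// pi_gt0.
rewrite mulrACA mulfV// mul1r -expRD; congr expR.
by rewrite -mulr_natr; field; rewrite gt_eqF.
Qed.

Lemma integral_gauss_shift (D x : R) : 0 < D ->
  (\int[mu]_y (expR (x * y - D * y ^+ 2 / 2))%:E =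
   (Num.sqrt (2 * pi / D) * expR (x ^+ 2 / (2 * D)))%:E)%E.
Proof.
move=> D0; under eq_integral => y _ do rewrite gauss_shift_pdf// EFinM.
rewrite ge0_integralZl//=.
- by rewrite integral_normal_pdf mule1.
- by apply/measurable_EFinP; exact: measurable_normal_pdf.
- by move=> y _; rewrite lee_fin normal_pdf_ge0.
Qed.

Lemma measurable_gauss_shift (D x : R) :
  measurable_fun [set: R] (fun y => expR (x * y - D * y ^+ 2 / 2)).
Proof.
apply: measurableT_comp => //; apply: measurable_funB.
  exact: measurable_funM.
by apply: measurable_funM => //; apply: measurable_funM => //; exact: measurable_funX.
Qed.

Lemma integrable_gauss_shift (D x : R) : 0 < D ->
  mu.-integrable setT (fun y => (expR (x * y - D * y ^+ 2 / 2))%:E).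
Proof.
move=> D0; apply/integrableP; split.
  by apply/measurable_EFinP; exact: measurable_gauss_shift.
under eq_integral do rewrite /= ger0_norm ?expR_ge0//.
by rewrite integral_gauss_shift// ltry.
Qed.

(** Pair the factors: [minn k l] products [(1 + h) (1 - h) <= exp (- h^2)], and at most [exp |h|]
    for each of the [|k - l|] unpaired ones. *)
Lemma binomial_shape_le (k l : nat) (h : R) : `|h| <= 1 ->
  (1 + h) ^+ k * (1 - h) ^+ l <=
  expR (- ((minn k l)%:R * h ^+ 2) + `|(k%:R - l%:R) * h|).
Proof.
wlog kl : k l h / (l <= k)%N => [wl h1|].
  have [lk|lk] := orP (leq_total l k); first by apply: wl.
  have := wl _ _ (- h) lk; rewrite normrN => /(_ h1).
  by rewrite opprK mulrC minnC sqrrN normrM normrN -normrM normrM distrC -normrM.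
move=> h1; have /andP[h2 h3] : - 1 <= h <= 1 by rewrite -ler_norml.
rewrite (minn_idPr kl) -[in (1 + h) ^+ k](subnK kl) exprD -mulrA -exprMn mulrC expRD.
apply: ler_pM; rewrite ?exprn_ge0//; [nra|lra| |].
- rewrite -mulrN expRM_natl lerXn2r ?nnegrE ?expR_ge0//; first nra.
  by rewrite (le_trans _ (expR_ge1Dx _))//; lra.
- rewrite -natrB//; apply: (@le_trans _ _ (expR ((k - l)%:R * h))).
    rewrite expRM_natl lerXn2r ?nnegrE ?expR_ge0//; first lra.
    exact: expR_ge1Dx.
  by rewrite ler_expR ler_norm.
Qed.

(** The absolute value in the exponent is removed by [exp (C |y|) <= exp (C y) + exp (- C y)], which
    leaves two Gaussians already known to be integrable. *)
Lemma binomial_shape_dom (k l N : nat) (D C y : R) : (0 < N)%N ->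
  D * N%:R <= (minn k l)%:R -> `|k%:R - l%:R| <= C * Num.sqrt N%:R ->
  `|y| <= Num.sqrt N%:R ->
  (1 + y / Num.sqrt N%:R) ^+ k * (1 - y / Num.sqrt N%:R) ^+ l <=
  expR (C * y - (2 * D) * y ^+ 2 / 2) + expR (- C * y - (2 * D) * y ^+ 2 / 2).
Proof.
move=> N0 DN CN yN.
have s0 : 0 < Num.sqrt N%:R :> R by rewrite sqrtr_gt0 ltr0n.
apply: le_trans (binomial_shape_le _ _ _) _.
  by rewrite normrM normfV (gtr0_norm s0) ler_pdivrMr// mul1r.
set e := expR _.
have C0 : 0 <= C by rewrite -(pmulr_lge0 _ s0) (le_trans _ CN).
have : e <= expR (C * `|y| - 2 * D * y ^+ 2 / 2).
  rewrite ler_expR [leRHS]addrC lerD//.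
    rewrite lerN2 expr_div_n sqr_sqrtr// [leRHS]mulrA ler_pdivlMr ?ltr0n//.
    have := ler_wpM2r (sqr_ge0 y) DN; lra.
  rewrite normrM normrM normfV (gtr0_norm s0) [leLHS]mulrA ler_pdivrMr//.
  by rewrite [leRHS]mulrAC ler_wpM2r.
move/le_trans; apply.
have [y0|y0] := leP 0 y.
  by rewrite ger0_norm// lerDl expR_ge0.
by rewrite ltr0_norm// mulrN -mulNr lerDr expR_ge0.
Qed.

Lemma cvg_integral_binomial_shape (k l : nat -> nat) (D x : R) : 0 < D ->
  ((k N)%:R + (l N)%:R) / N%:R @[N --> \oo] --> D ->
  ((k N)%:R - (l N)%:R) / Num.sqrt N%:R @[N --> \oo] --> x ->
  2 * Num.sqrt N%:R * 2 ^+ (k N + l N) * ((k N)`! * (l N)`!)%:R /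
    ((k N + l N).+1)`!%:R @[N --> \oo] -->
  Num.sqrt (2 * pi / D) * expR (x ^+ 2 / (2 * D)).
Proof.
move=> D0 kD kx.
(* Eventually [k + l >= D / 2 * N] and [|k - l| <= C * sqrt N <= D / 4 * N], so
   [minn k l >= D / 8 * N]. *)
pose C := `|x| + 1.
pose P N := [/\ (0 < N)%N, D / 8 * N%:R <= (minn (k N) (l N))%:R &
  `|(k N)%:R - (l N)%:R| <= C * Num.sqrt N%:R].
have [N0 _ HN0] : \forall N \near \oo, P N.
  near=> N.
  have N0 : (0 < N)%N by near: N; exact: nbhs_infty_gt.
  have NR0 : 0 < N%:R :> R by rewrite ltr0n.
  have s0 : 0 < Num.sqrt N%:R :> R by rewrite sqrtr_gt0 ltr0n.
  have ss : Num.sqrt N%:R ^+ 2 = N%:R :> R by rewrite sqr_sqrtr.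
  have h1 : D / 2 <= ((k N)%:R + (l N)%:R) / N%:R.
    near: N; apply: (cvgr_ge D) => //; lra.
  have h2 : `|((k N)%:R - (l N)%:R) / Num.sqrt N%:R| <= C.
    near: N; apply: (cvgr_norm_le _ kx); rewrite /C; lra.
  have h3 : 4 * C / D <= Num.sqrt N%:R.
    by near: N; move/cvgryPge : (@cvg_sqrt_natr R); apply.
  rewrite normrM normfV (gtr0_norm s0) ler_pdivrMr// in h2.
  split => //.
  rewrite ler_pdivlMr// in h1; rewrite ler_pdivrMr// in h3.
  have h4 : C * Num.sqrt N%:R <= D / 4 * N%:R.
    by rewrite -[X in _ <= _ * X]ss; have := ler_wpM2r (ltW s0) h3; lra.
  have := le_trans h2 h4; rewrite ler_norml => /andP[h5 h6].
  have [_|_] := leqP (k N) (l N); lra.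
(* The shift by [N0] makes the bounds of [P] hold for every index, as dominated convergence
   demands. *)
pose sq N : R := Num.sqrt (N + N0)%:R.
pose K N := k (N + N0)%N; pose L N := l (N + N0)%N.
pose f N (y : R) : R := (1 + y / sq N) ^+ K N * (1 - y / sq N) ^+ L N *
  \1_(`[- sq N, sq N]) y.
pose g (y : R) : R := expR (C * y - 2 * (D / 8) * y ^+ 2 / 2) +
  expR (- C * y - 2 * (D / 8) * y ^+ 2 / 2).
have sq0 N : 0 < sq N.
  rewrite /sq sqrtr_gt0 ltr0n; have [+ _ _] := HN0 (N + N0)%N (leq_addl _ _).
  by [].
have D8 : 0 < 2 * (D / 8) by lra.
pose J N : R := 2 * Num.sqrt N%:R * 2 ^+ (k N + l N) * ((k N)`! * (l N)`!)%:R /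
    ((k N + l N).+1)`!%:R.
have fJ N : (\int[mu]_y (f N y)%:E = (J (N + N0)%N)%:E)%E.
  rewrite /J -integral_binomial_shape; last exact: sq0.
  rewrite [RHS]integral_mkcond; apply: eq_integral => y _.
  rewrite patchE /f indicE; case: ifPn => _; rewrite ?mulr1 ?mulr0//.
suff : (\int[mu]_y (f N y)%:E)%E @[N --> \oo] -->
    (\int[mu]_y (expR (x * y - D * y ^+ 2 / 2))%:E)%E.
  rewrite integral_gauss_shift//; under eq_fun do rewrite fJ.
  move=> /fine_cvgP[_ /= JJ].
  suff : J @ \oo --> Num.sqrt (2 * pi / D) * expR (x ^+ 2 / (2 * D)) by [].
  by rewrite -(cvg_shiftn N0).
have [] := @dominated_convergence _ _ R mu setT measurableT
  (fun N y => (f N y)%:E) (fun y => (expR (x * y - D * y ^+ 2 / 2))%:E)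
  (fun y => (g y)%:E) _ _ _ _ _; last by [].
- move=> N; apply/measurable_EFinP; apply: measurable_funM => //.
  apply: measurable_funM; apply: measurable_funX.
    by apply: measurable_funD => //; exact: measurable_funM.
  by apply: measurable_funB => //; exact: measurable_funM.
- by apply/measurable_EFinP; exact: measurable_gauss_shift.
- apply: aeW => y _; apply/cvg_EFin; first by apply: nearW.
  pose u N := (1 + y / Num.sqrt N%:R) ^+ k N * (1 - y / Num.sqrt N%:R) ^+ l N.
  have ulim : u @ \oo --> expR (x * y - D * y ^+ 2 / 2).
    exact: cvg_binomial_shape.
  have : [sequence u (N + N0)%N]_N @ \oo --> expR (x * y - D * y ^+ 2 / 2).
    by rewrite cvg_shiftn.
  apply: cvg_trans; apply: near_eq_cvg; near=> N.
  rewrite /f/= indicE mem_set ?mulr1//= in_itv/= -ler_norml.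
  have : `|y| <= Num.sqrt N%:R.
    by near: N; move/cvgryPge : (@cvg_sqrt_natr R); apply.
  by move/le_trans; apply; rewrite ler_wsqrtr// ler_nat leq_addr.
- rewrite (_ : (fun y => (g y)%:E) = ((fun y => (expR (C * y - 2 * (D / 8) * y ^+ 2 / 2))%:E) \+
    (fun y => (expR (- C * y - 2 * (D / 8) * y ^+ 2 / 2))%:E))%E).
    by apply: integrableD => //; exact: integrable_gauss_shift.
  by apply/funext => y; rewrite EFinD.
- apply: aeW => y N _; rewrite /f indicE lee_fin.
  have [yN|yN] := boolP (y \in `[- sq N, sq N]%classic); last first.
    by rewrite mulr0 normr0 /g addr_ge0 ?expR_ge0.
  have {}yN : `|y| <= sq N by move: yN; rewrite inE/= in_itv/= ler_norml.
  have [P1 P2 P3] := HN0 (N + N0)%N (leq_addl _ _).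
  have /andP[yl yr] : -1 <= y / sq N <= 1.
    by rewrite -ler_norml normrM normfV (gtr0_norm (sq0 N)) ler_pdivrMr// mul1r.
  rewrite mulr1 ger0_norm; last by rewrite mulr_ge0// exprn_ge0//; lra.
  exact: binomial_shape_dom.
Unshelve. all: by end_near.
Qed.

Lemma powRNhalf (a : R) : 0 < a -> a `^ (- 2^-1) = (Num.sqrt a)^-1.
Proof. by move=> a0; rewrite powRN powR12_sqrt// ltW. Qed.

(* By the beta integral, [2^r / C(r, k)] is [(r + 1) / 2] times the integral
   of [(1 + h)^k (1 - h)^(r - k)] over [-1, 1], to which Laplace's method
   applies with [h = y / sqrt N]. *)
Lemma cvg_binom_pmf (r a b : nat -> nat) (D x : R) : 0 < D ->
  (r N)%:R / N%:R @[N --> \oo] --> D ->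
  ((b N)%:R - (a N)%:R - (r N)%:R / 2) * (2 / Num.sqrt N%:R) @[N --> \oo] --> x ->
  Num.sqrt N%:R / 2 * binom_pmf R (r N) (a N) (b N) @[N --> \oo] -->
  heat_kernel D x.
Proof.
move=> D0 rD bx.
have bD : ((b N)%:R - (a N)%:R) / N%:R @[N --> \oo] --> D / 2.
  suff : ((b N)%:R - (a N)%:R - (r N)%:R / 2) * (2 / Num.sqrt N%:R) *
     ((Num.sqrt N%:R)^-1 / 2) + (r N)%:R / N%:R / 2 @[N --> \oo] --> D / 2.
    apply: cvg_trans; apply: near_eq_cvg; near=> N.
    have N0 : 0 < N%:R :> R by rewrite ltr0n; near: N; exact: nbhs_infty_gt.
    have ss : Num.sqrt N%:R ^+ 2 = N%:R :> R by rewrite sqr_sqrtr// ltW.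
    have s0 : Num.sqrt N%:R != 0 :> R by rewrite gt_eqF// sqrtr_gt0.
    by move: (Num.sqrt N%:R) ss s0 => s <- s0; field.
  rewrite -[D / 2]add0r -[X in X + _](mulr0 x); apply: cvgD.
    apply: cvgM => //; rewrite -(mul0r 2^-1); apply: cvgM; last exact: cvg_cst.
    exact: cvg_sqrt_natrV.
  by apply: cvgM => //; exact: cvg_cst.
(* [k] counts the bits equal to 1 and [l] those equal to 0; both subtractions are eventually exact
   because [k / N] tends to [D / 2]. *)
pose k N := (b N - a N)%N; pose l N := (r N - k N)%N.
have good : \forall N \near \oo, [/\ (0 < N)%N, (a N <= b N)%N & (k N <= r N)%N].
  near=> N.
  have N0 : (0 < N)%N by near: N; exact: nbhs_infty_gt.
  have NR0 : 0 < N%:R :> R by rewrite ltr0n.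
  have h1 : D / 4 <= ((b N)%:R - (a N)%:R) / N%:R.
    by near: N; apply: (cvgr_ge _ bD); lra.
  have h2 : ((b N)%:R - (a N)%:R) / N%:R <= 3 * D / 4.
    by near: N; apply: (cvgr_le _ bD); lra.
  have h3 : 3 * D / 4 <= (r N)%:R / N%:R.
    by near: N; apply: (cvgr_ge _ rD); lra.
  have ab : (a N <= b N)%N.
    rewrite -(ler_nat R) -subr_ge0 -(pmulr_lge0 _ (_ : 0 < N%:R^-1)) ?invr_gt0//.
    lra.
  split => //; rewrite -(ler_nat R) natrB//.
  by rewrite -(ler_pM2r (_ : 0 < N%:R^-1)) ?invr_gt0//; lra.
have kD : ((k N)%:R + (l N)%:R) / N%:R @[N --> \oo] --> D.
  move: rD; apply: cvg_trans; apply: near_eq_cvg.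
  by apply: filterS good => N [_ _ kr]; rewrite -natrD /l subnKC.
have kx : ((k N)%:R - (l N)%:R) / Num.sqrt N%:R @[N --> \oo] --> x.
  move: bx; apply: cvg_trans; apply: near_eq_cvg.
  apply: filterS good => N [N0 ab kr]; rewrite /l natrB// /k natrB//.
  by rewrite natrB//; field; rewrite gt_eqF// sqrtr_gt0 ltr0n.
have J := cvg_integral_binomial_shape D0 kD kx.
have r1 : ((r N)%:R + 1) / N%:R @[N --> \oo] --> D.
  suff : (r N)%:R / N%:R + (Num.sqrt N%:R)^-1 * (Num.sqrt N%:R)^-1 @[N --> \oo] --> D.
    apply: cvg_trans; apply: near_eq_cvg; near=> N.
    by rewrite mulrDl mul1r -invfM -expr2 sqr_sqrtr.
  rewrite -[D]addr0 -[X in _ + X](mulr0 0).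
  by apply: cvgD => //; apply: cvgM; exact: cvg_sqrt_natrV.
have hk : heat_kernel D x =
    (D * (Num.sqrt (2 * pi / D) * expR (x ^+ 2 / (2 * D))))^-1.
  rewrite /heat_kernel mulNr expRN powRNhalf ?mulr_gt0 ?pi_gt0//.
  rewrite -invfM mulrA; congr (_ * _)^-1.
  have pi2 : 0 <= 2 * pi :> R by rewrite mulr_ge0 ?pi_ge0.
  rewrite sqrtrM// [in RHS]sqrtrM// sqrtrV ?(ltW D0)//.
  have s0 : Num.sqrt D != 0 by rewrite gt_eqF// sqrtr_gt0.
  by rewrite -[X in _ = X * _](sqr_sqrtr (ltW D0)); field.
rewrite hk.
have : (((r N)%:R + 1) / N%:R * (2 * Num.sqrt N%:R * 2 ^+ (k N + l N) *
  ((k N)`! * (l N)`!)%:R / ((k N + l N).+1)`!%:R))^-1 @[N --> \oo] -->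
  (D * (Num.sqrt (2 * pi / D) * expR (x ^+ 2 / (2 * D))))^-1.
  apply: cvgV; last exact: cvgM.
  by rewrite gt_eqF// !mulr_gt0 ?expR_gt0// sqrtr_gt0 !mulr_gt0 ?invr_gt0 ?pi_gt0.
apply: cvg_trans; apply: near_eq_cvg; apply: filterS good => N [N0 ab kr].
rewrite /binom_pmf ab -/(k N) /l subnKC//.
have fr : ('C(r N, k N))%:R * ((k N)`! * (r N - k N)`!)%:R = ((r N)`!)%:R :> R.
  by rewrite -natrM bin_fact.
have f0 : ((k N)`! * (r N - k N)`!)%:R != 0 :> R.
  by rewrite gt_eqF// ltr0n muln_gt0 !fact_gt0.
have s0 : Num.sqrt N%:R != 0 :> R by rewrite gt_eqF// sqrtr_gt0 ltr0n.
have ss : Num.sqrt N%:R ^+ 2 = N%:R :> R by rewrite sqr_sqrtr.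
have N0' : N%:R != 0 :> R by rewrite pnatr_eq0 -lt0n.
have C0 : ('C(r N, k N))%:R != 0 :> R by rewrite pnatr_eq0 -lt0n bin_gt0.
have r0 : 1 + (r N)%:R != 0 :> R by rewrite nat1r pnatr_eq0.
have t0 : 2 ^+ r N != 0 :> R by rewrite expf_neq0// pnatr_eq0.
have -> : ((r N).+1`!)%:R = (1 + (r N)%:R) * (('C(r N, k N))%:R *
    ((k N)`! * (r N - k N)`!)%:R) :> R by rewrite fr factS natrM nat1r.
rewrite [_ + 1]addrC.
move: (Num.sqrt N%:R) ss s0 => s ss s0; rewrite -ss; field.
by rewrite s0 t0 C0 r0 !gt_eqF ?ltr0n ?fact_gt0.
Unshelve. all: by end_near.
Qed.

End local_clt.

(** * The law of one line of the particle process *)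

Lemma big_tuple_cons (V : nmodType) (A : finType) n (F : seq A -> V) :
  \sum_(t : n.+1.-tuple A) F t = \sum_x \sum_(t : n.-tuple A) F (x :: t).
Proof.
rewrite pair_big /=.
rewrite (reindex (fun p : A * n.-tuple A => cons_tuple p.1 p.2)) //=.
exists (fun t : n.+1.-tuple A => (thead t, [tuple of behead t])) => [[x t]|t] _ /=.
  by congr pair; apply: val_inj.
by rewrite [RHS]tuple_eta; apply: val_inj.
Qed.

Lemma sum_measure_le d (T : measurableType d) (R : realType)
    (mu : {measure set T -> \bar R}) (I : finType) (F : I -> set T) (A : set T) :
  measurable A -> (forall i, measurable (F i)) -> trivIset setT F ->
  (forall i, F i `<=` A) -> (\sum_i mu (F i) <= mu A)%E.
Proof.
move=> mA mF tF FA.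
rewrite fsbig_seq ?index_enum_uniq//.
have -> : [set` index_enum I] = [set: I].
  by apply/seteqP; split => // x _; rewrite /= mem_index_enum.
rewrite -measure_fin_bigcup//; last exact: finite_finset.
apply: le_measure; rewrite ?inE//.
  by apply: fin_bigcup_measurable => //; exact: finite_finset.
by move=> x [i _ Fx]; exact: FA Fx.
Qed.

(** * Measurability of maps into countable types *)

Section fibers.
Context d (T : measurableType d).

(** Stated by fibres, so that no sigma-algebra on the target has to be chosen. *)
Definition measurable_fibers (C : Type) (f : T -> C) :=
  forall c, measurable (f @^-1` [set c]).

Lemma fibers_preimage (C : countType) (f : T -> C) (B : set C) :
  measurable_fibers f -> measurable (f @^-1` B).
Proof.
move=> mf; have -> : f @^-1` B = \bigcup_c
    (if c \in B then f @^-1` [set c] else set0).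
  apply/seteqP; split => [x Bx|x [c _]].
    by exists (f x) => //; rewrite mem_set.
  by case: ifPn => // /set_mem Bc /= ->.
apply: countable_bigcupT_measurable; first exact: countableP.
by move=> c; case: ifP.
Qed.

Lemma fibers_comp (C : countType) (D : Type) (f : T -> C) (g : C -> D) :
  measurable_fibers f -> measurable_fibers (g \o f).
Proof. by move=> mf c; rewrite comp_preimage; exact: fibers_preimage. Qed.

Lemma fibers_pair (C D : Type) (f : T -> C) (g : T -> D) :
  measurable_fibers f -> measurable_fibers g ->
  measurable_fibers (fun x => (f x, g x)).
Proof.
move=> mf mg [c c'].
rewrite (_ : _ @^-1` _ = (f @^-1` [set c]) `&` (g @^-1` [set c'])).
  exact: measurableI.
by apply/seteqP; split => x /= [-> ->].
Qed.

Lemma fibers_cst (C : Type) (c : C) : measurable_fibers (fun=> c).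
Proof.
move=> c'; have [->|cc] := pselect (c = c').
  by rewrite (_ : _ @^-1` _ = setT)//; apply/seteqP; split.
by rewrite (_ : _ @^-1` _ = set0)//; apply/seteqP; split.
Qed.

Lemma fibers_measurable_fun d' (T' : measurableType d') (C : countType)
    (f : T -> C) (g : C -> T') :
  measurable_fibers f -> measurable_fun setT (g \o f).
Proof.
by move=> mf _ B mB; rewrite setTI comp_preimage; exact: fibers_preimage.
Qed.

Lemma fibers_aztec (beta : nat -> nat -> nat -> T -> bool) t j i :
  (forall j i s, measurable_fibers (beta j i s)) ->
  measurable_fibers (fun w => aztec (fun j i s => beta j i s w) t j i).
Proof.
move=> mb; elim: t j i => [|t IHt] j i; first exact: fibers_cst.
rewrite /=; elim: j i => [|j IHj] i /=; first exact: fibers_cst.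
set x := fun w => aztec (fun j0 i0 s => beta j0 i0 s w) t.
set y := fun w => aztec_step (x w) (fun j0 i0 => beta j0 i0 t.+1 w) j.
have md := fibers_pair (fibers_pair (IHt j.+1 i) (mb j.+1 i t.+1))
  (fibers_pair (fibers_pair (IHj 1%N) (IHj j)) (fibers_pair (IHj i) (IHj i.-1))).
pose g (a : int * bool * ((int * int) * (int * int))) : int :=
  let z := a.1.1 + a.1.2%:Z in
  if (j.+1 == 1)%N then z
  else if i == 1%N then z - (z == a.2.1.1 + 1)%:Z
  else if i == j.+1 then z + (z == a.2.1.2)%:Z
  else z - (z == a.2.2.1 + 1)%:Z + (z == a.2.2.2)%:Z.
exact: (@fibers_comp _ _ _ g md).
Qed.

End fibers.

(** * Path weights of two neighbouring lines *)

Section path_weights.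
Variables (R : realFieldType) (M : nat).
Local Notation line := (line M.+1).

Definition start n : line n := [ffun i : 'I_n => inord i.+1].

Lemma startE n (i : 'I_n) : (n <= M)%N -> start n i = i.+1 :> nat.
Proof. by move=> nM; rewrite ffunE inordK// ltnS (leq_trans _ nM). Qed.

Lemma strict_start n : (n <= M)%N -> strict (start n).
Proof. by move=> nM; apply/strictP => i j ij; rewrite !startE. Qed.

Lemma interlace_start n (v : line n) : (n.+1 <= M)%N ->
  interlace (start n.+1) v = (v == start n).
Proof.
move=> nM; have nM' := ltnW nM.
apply/forallP/eqP => [H|-> i]; last first.
  by rewrite !startE// lift_max lift0 !ltnS leqnn.
apply/ffunP => i; apply: val_inj => /=.
have := H i; rewrite !startE// lift_max lift0 ltnS => /andP[h1 h2].
by apply/eqP; rewrite eqn_leq h1 h2.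
Qed.

Lemma gt_count_start n : (n <= M)%N -> gt_count (start n) = 1%N.
Proof.
elim: n => [//|n IH] nM /=; rewrite (big_pred1 (start n)) ?IH ?(ltnW nM)//.
by move=> v; rewrite /= interlace_start.
Qed.

(** The h-transform in telescoped form: killed steps times the pattern count of the endpoint.
    Division by the count at the starting point would give a probability, and for the packed start
    that count is 1. *)
Fixpoint path_weight n (u : line n) (us : seq (line n)) : R :=
  if us is u' :: us' then bern_kernel R u u' * path_weight u' us'
  else (gt_count u)%:R.

Fixpoint move_path_weight n (u : line n.+1) (vs : seq (line n))
    (us : seq (line n.+1)) : R :=
  match vs, us with
  | v' :: vs', u' :: us' => move_weight R u v' u' * move_path_weight u' vs' us'
  | _, _ => 1
  end.

Lemma path_weight_ge0 n (u : line n) us : 0 <= path_weight u us.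
Proof. by elim: us u => [|v us IH] u //=; rewrite mulr_ge0 ?bern_kernel_ge0. Qed.

(** Each use of [bern_interlace] moves the interlacing constraint one time step ahead; at the end of
    the path the remaining sum over interlacing [v] is the recursion defining [gt_count]. *)
Lemma sum_path_weight n (u : line n.+1) (us : seq (line n.+1)) : strict u ->
  \sum_(v | interlace u v) \sum_(vs : (size us).-tuple (line n))
    path_weight v vs * move_path_weight u vs us = path_weight u us.
Proof.
elim: us u => [|u' us IH] u su /=.
  rewrite natr_sum; apply: eq_bigr => v _.
  rewrite (big_pred1 [tuple]) ?mulr1// => t.
  by rewrite [t]tuple0; apply/esym/eqP.
under eq_bigr => v _ do rewrite (big_tuple_cons _ (fun vs =>
    path_weight v vs * move_path_weight u vs (u' :: us))) /=.
transitivity (\sum_(v' : line n) bern_kernel R u u' * (interlace u' v')%:R *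
  \sum_(vs : (size us).-tuple (line n))
    path_weight v' vs * move_path_weight u' vs us).
  rewrite exchange_big /=; apply: eq_bigr => v' _.
  rewrite -bern_interlace// mulr_suml mulr_suml; apply: eq_bigr => v _.
  rewrite mulr_sumr; apply: eq_bigr => vs _.
  by rewrite mulrACA !mulrA.
under eq_bigr => v' _ do rewrite -mulrA.
rewrite -mulr_sumr; have [su'|su'] := boolP (strict u').
  rewrite -IH// [X in _ = _ * X]big_mkcond; congr (_ * _).
  by apply: eq_bigr => v' _; case: ifP; rewrite ?mul1r ?mul0r.
by rewrite /bern_kernel (negbTE su') andbF mulr0 !mul0r.
Qed.

Lemma move_path_weightE n (u0 u : line n.+1) (v0 : line n) vs us :
  size vs = size us ->
  move_path_weight u vs us = \prod_(t < size us)
    move_weight R (nth u0 (u :: us) t) (nth v0 vs t) (nth u0 us t).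
Proof.
elim: us u vs => [|u' us IH] u [|v' vs]//=; first by rewrite big_ord0.
by move=> [e]; rewrite big_ord_recl /= IH.
Qed.

End path_weights.

(** * Lower bound for the probability of a path of one line *)

Section chain_law.
Context (R : realType) d (T : measurableType d) (P : probability T R).
Variables (m M : nat) (beta : nat -> nat -> nat -> {RV P >-> bool}).
Hypothesis fair : fair_bits m beta.
Hypothesis mM : (m <= M)%N.
Local Notation line := (line M.+1).

Definition particle (t j i : nat) (w : T) : int :=
  aztec (fun j i s => beta j i s w) t j i.

Definition path_event n (us : seq (line n)) : set T :=
  [set w | forall t (l : 'I_n), (t < size us)%N ->
    particle t.+1 n l.+1 w = (nth (start M n) us t l)%:Z].

Lemma fibers_particle t j i : measurable_fibers (particle t j i).
Proof.
apply: fibers_aztec => j' i' s [|]; rewrite -[X in measurable X]setTI;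
  exact: measurable_funPT.
Qed.

Lemma measurable_path_event n (us : seq (line n)) : measurable (path_event us).
Proof.
have -> : path_event us =
    \bigcap_t \bigcap_(l in [set: 'I_n]) (if (t < size us)%N then
      particle t.+1 n l.+1 @^-1` [set (nth (start M n) us t l)%:Z] else setT).
  apply/seteqP; split => [w H t _ l _|w H t l tus].
    by case: ifP => // tus; exact: H.
  by have := H t I l I; rewrite /= tus.
apply: bigcapT_measurable => t; apply: fin_bigcap_measurable => // l _.
by case: ifP => // _; exact: fibers_particle.
Qed.

(** Entry [t] of [us0 :: us] is the configuration before the move at time [t + 1], entry [t] of [us]
    the one after it. *)
Definition move_bits n (us : seq (line n.+1)) (vs : seq (line n)) t i : set bool :=
  let us0 := start M n.+1 in
  [set e | moved (nth us0 (us0 :: us) t) (nth (start M n) vs t) (inord i) e =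
    (nth us0 us t (inord i))%:Z].

Lemma path_eventS n (us : seq (line n.+1)) (vs : seq (line n)) w :
  (n.+1 <= m)%N -> size vs = size us -> path_event vs w ->
  (forall t i, (t < size us)%N -> (i < n.+1)%N ->
    move_bits us vs t i (beta n.+1 i.+1 t.+1 w)) ->
  path_event us w.
Proof.
move=> nm sz ev H; set u0 := start M n.+1.
have nM := leq_trans nm mM.
suff main t : (t <= size us)%N -> forall l : 'I_n.+1,
    particle t n.+1 l.+1 w = (nth u0 (u0 :: us) t l)%:Z.
  by move=> t l tus; exact: (main t.+1).
elim: t => [_ l|t IH tus l]; first by rewrite /particle /= startE.
have := H t l tus (ltn_ord l); rewrite /move_bits inord_val /= => <-.
have {}IH := IH (ltnW tus).
have Y (k : 'I_n) : aztec_step (aztec (fun j i s => beta j i s w) t)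
   (fun j i => beta j i t.+1 w) n k.+1 = (nth (start M n) vs t k)%:Z.
  by rewrite -ev// sz.
rewrite /particle /= -/u0 /moved -IH -/(particle t n.+1 l.+1 w).
set z := _ + _; set y := aztec_step _ _ n in Y *.
rewrite !eqSS.
case: (unliftP ord_max l) => [k|] el; case: (unliftP ord0 l) => [k'|] el'.
- have lk : l = k :> nat by rewrite el lift_max.
  have lk' : l = k'.+1 :> nat by rewrite el' lift0.
  have n0 : (n == 0%N) = false by have := ltn_ord k; lia.
  have l0 : (l == 0%N :> nat) = false by rewrite lk'.
  have ln : (l == n :> nat) = false by rewrite lk ltn_eqF.
  rewrite n0 l0 ln /= {1}lk lk' !Y.
  by [].
- have lk : l = k :> nat by rewrite el lift_max.
  have n0 : (n == 0%N) = false by have := ltn_ord k; lia.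
  rewrite n0 el' /= addr0 -Y.
  by have <- : 0%N = k by rewrite -lk el'.
- have lk' : l = k'.+1 :> nat by rewrite el' lift0.
  have ln : l = n :> nat by rewrite el.
  have n0 : (n == 0%N) = false by have := ltn_ord k'; lia.
  have l0 : (l == 0%N :> nat) = false by rewrite lk'.
  rewrite n0 l0 ln eqxx subr0 -Y.
  have e : y n = y k'.+1 by congr (y _); rewrite -lk' ln.
  by rewrite e.
- have n0 : n == 0%N by have := congr1 (@nat_of_ord _) el; rewrite el' /= => e; apply/eqP/esym.
  by rewrite n0 subr0 addr0.
Qed.

Let bit (a : nat * nat * nat) := beta a.1.1 a.1.2 a.2.

Lemma measurable_bit a (B : set bool) : measurable (bit a @^-1` B).
Proof. by rewrite -[X in measurable X]setTI; exact: measurable_funPT. Qed.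

Lemma prob_bit (a : nat * nat * nat) (B : set bool) :
  (0 < a.1.2 <= a.1.1)%N -> (a.1.1 <= m)%N -> (0 < a.2)%N ->
  fine (P (bit a @^-1` B)) = 2^-1 * \sum_(e : bool) (e \in B)%:R.
Proof.
move=> h1 h2 h3; have [_ /(_ a) half] := fair.
have {}half v : P (bit a @^-1` [set v]) = (2^-1)%:E by exact: half.
have -> : bit a @^-1` B = \bigcup_(e in B) (bit a @^-1` [set e]).
  by apply/seteqP; split => [w Bw|w [e Be /= ->//]]; exists (bit a w).
rewrite measure_fin_bigcup//; last 3 first.
- exact: finite_finset.
- by move=> e e' _ _ [w [/= <- <-]].
- by move=> e _; exact: measurable_bit.
rewrite fsbig_mkcond/=.
rewrite (_ : [set: bool] = [set` [:: true; false]]); last first.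
  by apply/seteqP; split => // -[].
rewrite -fsbig_seq//= !big_cons big_nil adde0 big_bool /patch.
by case: ifP; case: ifP; rewrite ?half/= ?mulr0 ?add0r ?addr0 ?mulr1 ?fine0//; lra.
Qed.

(* The extra bits [s] belong to the lines above [n]; they make the induction on
   [n] go through, where the bits of line [n + 1] are consumed. *)
Lemma path_law n (us : seq (line n)) (s : seq (nat * nat * nat))
    (B : nat * nat * nat -> set bool) : (n <= m)%N -> uniq s ->
  (forall a, a \in s ->
    [/\ (0 < a.1.2 <= a.1.1)%N, (n < a.1.1 <= m)%N & (0 < a.2)%N]) ->
  ((path_weight R (start M n) us * \prod_(a <- s) fine (P (bit a @^-1` B a)))%:E <=
   P (path_event us `&` \bigcap_(a in [set` s]) bit a @^-1` B a))%E.
Proof.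
elim: n us s B => [|n IH] us s B nm us_s Hs.
  have w1 : path_weight R (start M 0) us = 1.
    elim: us (start M 0) => [|u us IH] u0 //=.
    rewrite IH mulr1 /bern_kernel expr0 mul1r.
    have -> : jump u0 u by apply/forallP; case.
    by have -> : strict u by apply/strictP; case.
  have -> : path_event us = setT by apply/seteqP; split => // w _ t [].
  rewrite setTI w1 mul1r; have [indep _] := fair.
  by rewrite /bit indep// => a /= /Hs[h1 /andP[_ h2] h3].
set Tm := size us.
(* The bits driving line [n + 1]; they join [s] when the induction hypothesis is applied to line
   [n]. *)
pose new := [seq (n.+1, i.+1, t.+1) | t <- index_iota 0 Tm, i <- index_iota 0 n.+1].
have new_lvl a : a \in new -> a.1.1 = n.+1.
  by move=> /allpairsP[[t i] [_ _ ->]].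
have s_lvl a : a \in s -> (n.+1 < a.1.1)%N by move=> /Hs[_ /andP[]].
pose B' (vs : seq (line n)) a :=
  if a.1.1 == n.+1 then move_bits us vs a.2.-1 a.1.2.-1 else B a.
have us_new : uniq (new ++ s).
  rewrite cat_uniq us_s andbT; apply/andP; split.
    rewrite allpairs_uniq ?iota_uniq// => -[t i] [t' i'] _ _ /= [-> ->].
    by [].
  by apply/hasPn => a /s_lvl; apply: contraTN => /new_lvl ->; rewrite ltnn.
have Hnew a : a \in new ++ s ->
    [/\ (0 < a.1.2 <= a.1.1)%N, (n < a.1.1 <= m)%N & (0 < a.2)%N].
  rewrite mem_cat => /orP[/allpairsP[[t i] [_ + ->]]|/Hs[-> /andP[h ->] ->]].
    by rewrite mem_index_iota /= ltnS => ->; rewrite ltnSn.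
  by rewrite (ltnW h).
pose E := \bigcap_(a in [set` s]) bit a @^-1` B a.
have mE : measurable E.
  by apply: fin_bigcap_measurable => [|a _]; [exact: finite_seq|exact: measurable_bit].
pose F (vs : Tm.-tuple (line n)) := path_event vs `&`
  \bigcap_(a in [set` new ++ s]) bit a @^-1` B' vs a.
have mF vs : measurable (F vs).
  apply: measurableI; first exact: measurable_path_event.
  by apply: fin_bigcap_measurable => [|a _]; [exact: finite_seq|exact: measurable_bit].
(* The events [F vs] are disjoint, since the lower path determines [vs], and each lies in the target
   event. Only this inclusion is established, hence an inequality. *)
suff step : (\sum_vs P (F vs) <= P (path_event us `&` E))%E; first last.
apply: sum_measure_le.
- by apply: measurableI => //; exact: measurable_path_event.
- exact: mF.
- move=> vs vs' _ _ [w [[ev _] [ev' _]]]; apply/val_inj/(@eq_from_nth _ (start M n)).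
    by rewrite !size_tuple.
  move=> t; rewrite size_tuple => tT; apply/ffunP => l; apply/val_inj.
  have := ev t l; have := ev' t l; rewrite !size_tuple => /(_ tT) -> /(_ tT).
  by case.
- move=> vs w [ev H]; split.
    apply: (path_eventS nm _ ev); first by rewrite size_tuple.
    move=> t i tT iN; have := H (n.+1, i.+1, t.+1).
    rewrite /B' eqxx /=; apply; rewrite mem_cat; apply/orP; left.
    by apply/allpairsP; exists (t, i); rewrite !mem_index_iota.
  move=> a /= sa; have := H a; rewrite /B' /= mem_cat sa orbT => /(_ isT).
  by rewrite (gtn_eqF (s_lvl _ sa)).
apply: le_trans step.
apply: (@le_trans _ _ (\sum_(vs : Tm.-tuple (line n))
    (path_weight R (start M n) vs * \prod_(a <- new ++ s)
      fine (P (bit a @^-1` B' vs a)))%:E)%E); last first.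
  apply: lee_sum => vs _; apply: IH => //; exact: ltnW.
rewrite sumEFin lee_fin.
have nM := leq_trans nm mM.
(* The packed line interlaces only with the packed line below, so the sum over lower starting points
   has a single term. *)
rewrite -(@sum_path_weight R M n (start M n.+1) us (strict_start nM)).
rewrite (big_pred1 (start M n)) => [|v]; last by rewrite /= interlace_start.
rewrite mulr_suml; apply: ler_sum => vs _; rewrite big_cat /= -mulrA.
rewrite ler_wpM2l ?path_weight_ge0//.
rewrite (move_path_weightE R (start M n.+1) _ (start M n)) ?size_tuple//.
rewrite big_allpairs_dep big_mkord le_eqVlt; apply/orP; left; apply/eqP.
congr (_ * _).
  apply: eq_bigr => t _; rewrite big_mkord; apply: eq_bigr => i _.
  rewrite prob_bit ?ltn_ord//=.
  rewrite /B' eqxx /=; congr (_ * _); apply: eq_bigr => e _.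
  congr (_%:R); congr nat_of_bool; apply/idP/idP.
    by move=> /eqP h; apply/mem_set; rewrite /move_bits/= inord_val.
  by move=> /set_mem; rewrite /move_bits/= inord_val => /eqP.
by apply: eq_big_seq => a /s_lvl sa; rewrite /B' (gtn_eqF sa).
Qed.

End chain_law.

(** * Observing the walk at finitely many times *)

Section observations.
Variables (R : realType) (M n N : nat).
Local Notation line := (line M.+1).
Local Notation V := (n.-tuple R).

Definition obs_time (t : R) : nat := Num.truncn (N%:R * t).

Definition rescaled k (u : line n) : V :=
  [tuple ((u i)%:R - k%:R / 2) * (2 / Num.sqrt N%:R) | i < n].

Definition upd (h : R -> V) t (z : V) : R -> V :=
  fun t' => if t' == t then z else h t'.

Definition obs_kernel k k' (u u' : line n) : R :=
  (gt_count u')%:R / (gt_count u)%:R * bern_iter R (k' - k) u u'.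

(** Expectation of [Phi] under the h-transformed walk observed at the times [ts]. Observations
    accumulate in [h], a function of real time, so that the continuous analogue has the same
    shape. *)
Fixpoint obs_sum (Phi : (R -> V) -> R) (ts : seq R) k (u : line n)
    (h : R -> V) : R :=
  if ts is t :: ts' then
    \sum_(u' | strict u') obs_kernel k (obs_time t) u u' *
      obs_sum Phi ts' (obs_time t) u' (upd h t (rescaled (obs_time t) u'))
  else Phi h.

(** The list [us] starts at time [k + 1], which accounts for the predecessor in the argument of
    [drop]. *)
Fixpoint obs_hist (ts : seq R) k (us : seq (line n)) (h : R -> V) : R -> V :=
  if ts is t :: ts' then
    if drop (obs_time t - k).-1 us is u' :: us' then
      obs_hist ts' (obs_time t) us' (upd h t (rescaled (obs_time t) u'))
    else h
  else h.

Fixpoint obs_length (ts : seq R) k : nat :=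
  if ts is t :: ts' then (obs_time t - k + obs_length ts' (obs_time t))%N else 0.

Lemma gt_count_gt0 (u : line n) : strict u -> 0 < (gt_count u)%:R :> R.
Proof.
move=> su; rewrite gt_count_vandermonde// mulr_gt0//.
  by rewrite invr_gt0 prodr_gt0// => i _; rewrite ltr0n fact_gt0.
apply: prodr_gt0 => i _; apply: prodr_gt0 => j ij.
by rewrite subr_gt0 ltr_nat; exact: (elimT (strictP u)).
Qed.

Lemma obs_kernel_ge0 k k' (u u' : line n) : 0 <= obs_kernel k k' u u'.
Proof. by rewrite mulr_ge0 ?bern_iter_ge0// mulr_ge0// invr_ge0. Qed.

Lemma obs_sum_ge0 (Phi : (R -> V) -> R) ts k u h :
  (forall h, 0 <= Phi h) -> 0 <= obs_sum Phi ts k u h.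
Proof.
move=> Phi0; elim: ts k u h => [|t ts IH] k u h //=.
by apply: sumr_ge0 => u' _; rewrite mulr_ge0// obs_kernel_ge0.
Qed.

(** Chapman-Kolmogorov along the path: the first [r] configurations are summed out and the observed
    one becomes the head of the list. *)
Lemma sum_path_weight_iter r l (u : line n) (Psi : seq (line n) -> R) :
  \sum_(us : (r.+1 + l).-tuple (line n)) path_weight R u us * Psi (drop r us) =
  \sum_u' bern_iter R r.+1 u u' *
    \sum_(us : l.-tuple (line n)) path_weight R u' us * Psi (u' :: us).
Proof.
elim: r u => [|r IH] u.
  etransitivity; first exact: (big_tuple_cons l (fun us =>
    path_weight R u us * Psi (drop 0 us))).
  apply: eq_bigr => u' _.
  have -> : bern_iter R 1 u u' = bern_kernel R u u'.
    rewrite /= (bigD1 u')//= eqxx mulr1 big1 ?addr0// => v vu.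
    by rewrite (negbTE vu) mulr0.
  by rewrite mulr_sumr; apply: eq_bigr => us _; rewrite mulrA.
etransitivity; first exact: (big_tuple_cons (r.+1 + l)%N (fun us =>
    path_weight R u us * Psi (drop r.+1 us))).
transitivity (\sum_v bern_kernel R u v * \sum_u' bern_iter R r.+1 v u' *
    \sum_(us : l.-tuple (line n)) path_weight R u' us * Psi (u' :: us)).
  apply: eq_bigr => v _; rewrite -IH mulr_sumr.
  by apply: eq_bigr => us _; rewrite mulrA.
under eq_bigr => v _ do rewrite mulr_sumr.
rewrite exchange_big /=; apply: eq_bigr => u' _.
by rewrite mulr_suml; apply: eq_bigr => v _; rewrite mulrA.
Qed.

(** The quotients of pattern counts telescope against the factor [gt_count u]; observations that are
    not strict are discarded from the right-hand side. *)
Lemma obs_sum_le (Phi : (R -> V) -> R) ts k l (u : line n) h :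
  (forall h, 0 <= Phi h) -> strict u ->
  path ltn k (map obs_time ts) -> l = obs_length ts k ->
  (gt_count u)%:R * obs_sum Phi ts k u h <=
  \sum_(us : l.-tuple (line n)) path_weight R u us * Phi (obs_hist ts k us h).
Proof.
move=> Phi0; elim: ts k l u h => [|t ts IH] k l u h su.
  move=> _ /= ->; rewrite (big_pred1 [tuple])//.
  by move=> us; rewrite [us]tuple0; apply/esym/eqP.
move=> /= /andP[kt tts] ->.
set k' := obs_time t in kt tts *.
have rE : (k' - k = (k' - k).-1.+1)%N by rewrite prednK// subn_gt0.
set r := (k' - k).-1 in rE *; rewrite /obs_kernel rE.
rewrite [leRHS](@sum_path_weight_iter r _ u (fun us => Phi
  (if us is u' :: us' then
      obs_hist ts k' us' (upd h t (rescaled k' u')) else h))).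
rewrite mulr_sumr; rewrite big_mkcond /=; apply: ler_sum => u' _.
case: ifP => su'; last first.
  rewrite mulr_ge0// -/(bern_iter R r.+1 u u') ?bern_iter_ge0//.
  by apply: sumr_ge0 => us _; rewrite mulr_ge0 ?path_weight_ge0.
rewrite -/(bern_iter R r.+1 u u').
have := IH k' _ u' (upd h t (rescaled k' u')) su' tts erefl.
move=> /(ler_wpM2l (bern_iter_ge0 R r.+1 u u')); apply: le_trans.
rewrite le_eqVlt; apply/orP; left; apply/eqP.
have := gt_count_gt0 su; set G := (gt_count u)%:R => G0.
by field; rewrite gt_eqF.
Qed.

End observations.

(** * From path probabilities to expectations *)

Section observed_particles.
Context (R : realType) d (T : measurableType d) (P : probability T R).
Variables (m M n N : nat) (beta : nat -> nat -> nat -> {RV P >-> bool}).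
Hypothesis fair : fair_bits m beta.
Hypothesis mM : (m <= M)%N.
Hypothesis nm : (n <= m)%N.
Local Notation line := (line M.+1).
Local Notation V := (n.-tuple R).

Definition rescaled_particle k (w : T) : V :=
  [tuple ((particle beta k n i.+1 w)%:~R - k%:R / 2) * (2 / Num.sqrt N%:R) | i < n].

Lemma obs_hist_particle ts k (us : seq (line n)) (h : R -> V) w t :
  path ltn k (map (obs_time N) ts) -> size us = obs_length N ts k ->
  (forall j (l : 'I_n), (j < size us)%N ->
    particle beta (k + j).+1 n l.+1 w = (nth (start M n) us j l)%:Z) ->
  obs_hist N ts k us h t =
    if t \in ts then rescaled_particle (obs_time N t) w else h t.
Proof.
elim: ts k us h => [|t0 ts IH] k us h //= /andP[kt tts] sz ev.
set k' := obs_time N t0 in kt tts sz *.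
set r := (k' - k)%N in sz *.
have r0 : (0 < r)%N by rewrite subn_gt0.
have rus : (r.-1 < size us)%N by rewrite sz; lia.
rewrite (drop_nth (start M n) rus) prednK//; set u' := nth _ us r.-1.
rewrite IH//; last 2 first.
- by rewrite size_drop sz addKn.
- move=> j l; rewrite size_drop => js.
  rewrite nth_drop -ev; last by rewrite -ltn_subRL.
  by rewrite addnA subnKC// ltnW.
rewrite in_cons /upd; case: (eqVneq t t0) => [->|//]/=.
have -> : t0 \in ts = false.
  apply/negP => tts0; have := order_path_min ltn_trans tts.
  by move=> /allP/(_ k'); rewrite ltnn => /(_ (map_f _ tts0)).
apply: eq_mktuple => i; congr ((_ - _) * _).
have := ev r.-1 i rus; rewrite -addnS prednK// subnKC ?(ltnW kt)// => ->.
by rewrite -pmulrn.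
Qed.

(** Events of different paths are disjoint, so the bounds of [path_law] add up. [Psi] is kept apart
    from [Phi] because the actual process is interpolated, whereas [Phi] sees integer times only. *)
Lemma obs_sum_le_integral (Phi : (R -> V) -> R) (ts : seq R) (h : R -> V)
    (Psi : T -> R) :
  (forall h, 0 <= Phi h) -> (forall w, 0 <= Psi w) -> measurable_fun setT Psi ->
  path ltn 0 (map (obs_time N) ts) ->
  (forall w, Phi (fun t => if t \in ts then rescaled_particle (obs_time N t) w
                           else h t) <= Psi w) ->
  ((obs_sum N Phi ts 0 (start M n) h)%:E <= \int[P]_w (Psi w)%:E)%E.
Proof.
move=> Phi0 Psi0 mPsi tts PhiPsi.
have nM := leq_trans nm mM.
set l := obs_length N ts 0.
pose F (us : l.-tuple (line n)) (w : T) : R :=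
  Phi (obs_hist N ts 0 us h) * \1_(path_event beta us) w.
have mF us : measurable_fun setT (F us).
  apply: measurable_funM => //; apply: measurable_indic.
  exact: measurable_path_event.
have FPsi w : \sum_us F us w <= Psi w.
  have [[us ev]|noev] := pselect (exists us : l.-tuple (line n), path_event beta us w).
    rewrite (bigD1 us)//= big1 ?addr0 => [|vs vsus]; last first.
      rewrite /F indicE memNset ?mulr0// => ev'; case/eqP : vsus.
      apply/val_inj/(@eq_from_nth _ (start M n)); rewrite !size_tuple// => t tl.
      apply/ffunP => i; apply/val_inj.
      have := ev t i; have := ev' t i; rewrite !size_tuple => /(_ tl) -> /(_ tl).
      by case.
    rewrite /F indicE mem_set// mulr1; apply: le_trans (PhiPsi w).
    rewrite le_eqVlt; apply/orP; left; apply/eqP; congr Phi; apply/funext => t.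
    by apply: obs_hist_particle; rewrite ?size_tuple// => j i jl; rewrite ev ?size_tuple.
  rewrite big1// => us _; rewrite /F indicE memNset ?mulr0// => ev.
  by apply: noev; exists us.
apply: (@le_trans _ _ (\int[P]_w (\sum_us F us w)%:E)%E); last first.
  apply: ge0_le_integral => //.
  - by move=> w _; rewrite lee_fin sumr_ge0// => us _; rewrite mulr_ge0.
  - by apply/measurable_EFinP; exact: measurable_sum.
  - exact/measurable_EFinP.
  - by move=> w _; rewrite lee_fin.
under eq_integral => w _ do rewrite -sumEFin.
rewrite ge0_integral_sum//; last 2 first.
- by move=> us; apply/measurable_EFinP.
- by move=> us w _; rewrite lee_fin mulr_ge0.
apply: (@le_trans _ _ (\sum_(us : l.-tuple (line n))
    (path_weight R (start M n) us * Phi (obs_hist N ts 0 us h))%:E)%E).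
  rewrite sumEFin lee_fin.
  have := @obs_sum_le R M n N Phi ts 0 l (start M n) h Phi0 (strict_start nM) tts erefl.
  by rewrite gt_count_start// mul1r.
apply: lee_sum => us _; under eq_integral do rewrite EFinM.
rewrite ge0_integralZl//; last 2 first.
- by apply/measurable_EFinP/measurable_indic; exact: measurable_path_event.
- by rewrite lee_fin.
rewrite integral_indic ?setIT//; last exact: measurable_path_event.
rewrite mulrC EFinM lee_wpmul2l ?lee_fin//.
have := @path_law R d T P m M beta fair mM n us [::] (fun=> setT) nm isT.
by rewrite big_nil mulr1 set_nil bigcap_set0 setIT; apply.
Qed.

End observed_particles.

(** * Iterated Dyson kernels and their discrete approximations *)

Section lebesgue_box.
Variable R : realType.

Definition box n (a b : 'I_n -> R) : set (n.-tuple R) :=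
  [set z | forall i, a i <= tnth z i < b i].

Lemma measurable_box n (a b : 'I_n -> R) : measurable (box a b).
Proof.
have -> : box a b = \bigcap_(i in [set: 'I_n])
    ((fun z : n.-tuple R => tnth z i) @^-1` `[a i, b i[%classic).
  apply/seteqP; split => z /= H i => [_|]; first by rewrite /= in_itv/= H.
  by have := H i I; rewrite /= in_itv.
apply: fin_bigcap_measurable => [|i _]; first exact: finite_finset.
by rewrite -[X in measurable X]setTI; apply: measurable_tnth.
Qed.

Lemma lebesgue_tuple_box n (a b : 'I_n -> R) : (forall i, a i <= b i) ->
  lebesgue_tuple R n (box a b) = (\prod_i (b i - a i))%:E.
Proof.
elim: n a b => [|n IH] a b ab.
  by rewrite big_ord0 /= diracE mem_set// => -[].
rewrite big_ord_recl EFinM -(IH (a \o lift ord0) (b \o lift ord0)); last first.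
  by move=> i; exact: ab.
rewrite /= /lebesgue_cons /pushforward.
have -> : @cons_pair R n @^-1` box a b =
    `[a ord0, b ord0[%classic `*` box (a \o lift ord0) (b \o lift ord0).
  apply/seteqP; split => [[x v] /= H|[x v] /= [H1 H2] i].
    split; first by have := H ord0; rewrite /= in_itv/= (tnth_nth x).
    by move=> i; have := H (lift ord0 i); rewrite /= !(tnth_nth x).
  case: (unliftP ord0 i) => [j ->|->].
    by have := H2 j; rewrite /= !(tnth_nth x).
  by move: H1; rewrite in_itv/= (tnth_nth x).
rewrite product_measure1E//; last exact: measurable_box.
congr (_ * _)%E.
transitivity (lebesgue_measure (`[a ord0, b ord0[%classic : set R)) => //.
rewrite lebesgue_measure_itv/= lte_fin.
have [_|ba] := ltP (a ord0) (b ord0); first by rewrite EFinB.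
by rewrite (@le_anti _ _ (a ord0) (b ord0)) ?subrr// ba ab.
Qed.

Lemma measurable_weyl_chamber n : measurable (@weyl_chamber R n).
Proof.
have -> : @weyl_chamber R n = \bigcap_(p in [set: 'I_n * 'I_n])
    (if (p.1 < p.2)%N then
      (fun z : n.-tuple R => (tnth z p.2 - tnth z p.1)) @^-1` `]0, +oo[%classic
     else setT).
  apply/seteqP; split => [z H [i j] _|z H i j ij] /=.
    by case: ifP => //= ij; rewrite in_itv/= andbT subr_gt0 H.
  by have /= := H (i, j) I; rewrite ij /= in_itv/= andbT subr_gt0.
apply: fin_bigcap_measurable => [|[i j] _ /=]; first exact: finite_finset.
case: ifP => // ij; rewrite -[X in measurable X]setTI.
suff : measurable_fun [set: n.-tuple R] (fun z => tnth z j - tnth z i) by apply.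
by apply: measurable_funB; exact: measurable_tnth.
Qed.

Lemma measurable_fun_inv d (T : measurableType d) (f : T -> R) :
  measurable_fun setT f -> measurable_fun setT (fun x => (f x)^-1).
Proof.
move=> mf; have -> : (fun x => (f x)^-1) = (fun x => f x * (f x ^+ 2) `^ (-1)).
  apply/funext => x; rewrite powR_inv1 ?sqr_ge0//.
  have [->|f0] := eqVneq (f x) 0; first by rewrite invr0 mul0r.
  by field.
apply: measurable_funM => //; apply: (measurableT_comp (measurable_powR _)).
exact: measurable_funX.
Qed.

Section measurability.
Variable n : nat.
Context d (T : measurableType d).
Local Notation V := (n.-tuple R).

Lemma measurable_vandermonde (z : T -> V) : measurable_fun setT z ->
  measurable_fun setT (fun x => vandermonde (z x)).
Proof.
move=> mz; apply: measurable_prod => i _.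
apply: (eq_measurable_fun (fun x => \prod_(j < n)
    (if (i < j)%N then tnth (z x) j - tnth (z x) i else 1))) => [x _|].
  by rewrite [RHS]big_mkcond.
apply: measurable_prod => j _; case: (i < j)%N => //.
by apply: measurable_funB; exact: (measurableT_comp (measurable_tnth _)).
Qed.

Lemma measurable_heat_kernel t (f : T -> R) : measurable_fun setT f ->
  measurable_fun setT (fun x => heat_kernel t (f x)).
Proof.
move=> mf; apply: measurable_funM => //; apply: measurableT_comp => //.
apply: measurable_funM => //; apply: measurableT_comp => //.
exact: measurable_funX.
Qed.

Lemma measurable_dyson_transition t (y z : T -> V) :
  measurable_fun setT y -> measurable_fun setT z ->
  measurable_fun setT (fun x => dyson_transition t (y x) (z x)).
Proof.
move=> my mz; apply: measurable_funM.
  apply: measurable_funM; first exact: measurable_vandermonde.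
  by apply: measurable_fun_inv; exact: measurable_vandermonde.
rewrite /determinant; apply: measurable_sum => s.
apply: measurable_funM => //; apply: measurable_prod => i _.
move: (_ i) => j.
apply: (eq_measurable_fun (fun x =>
    heat_kernel t (tnth (z x) j - tnth (y x) i))) => [x _|].
  by rewrite mxE.
apply: measurable_heat_kernel.
by apply: measurable_funB; exact: (measurableT_comp (measurable_tnth _)).
Qed.

Lemma measurable_dyson_entrance t (z : T -> V) : measurable_fun setT z ->
  measurable_fun setT (fun x => dyson_entrance t (z x)).
Proof.
move=> mz; apply: measurable_funM.
  apply: measurable_funM => //; apply: measurableT_comp => //.
  apply: measurableT_comp => //; apply: measurable_sum => i.
  apply: measurable_funM => //; apply: measurable_funX.
  exact: (measurableT_comp (measurable_tnth _)).
apply: measurable_prod => i _.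
apply: (eq_measurable_fun (fun x => \prod_(j < n)
    (if (i < j)%N then (tnth (z x) j - tnth (z x) i) ^+ 2 else 1))) => [x _|].
  by rewrite [RHS]big_mkcond.
apply: measurable_prod => j _; case: (i < j)%N => //; apply: measurable_funX.
by apply: measurable_funB; exact: (measurableT_comp (measurable_tnth _)).
Qed.

End measurability.

Section dyson_iter.
Variable n : nat.
Local Notation V := (n.-tuple R).
Local Notation leb := (lebesgue_tuple R n).

(* [dyson_transition t y z] may be negative when [y] is outside the Weyl chamber;
   the maximum makes the kernel nonnegative everywhere. *)
Definition dyson_kernel t (y z : V) : R :=
  Num.max 0 (dyson_transition t y z) * \1_(@weyl_chamber R n) z.

(** The continuous analogue of [obs_sum], for the process that is at [h s] at time [s]. *)
Fixpoint dyson_iter (Phi : (R -> V) -> R) (ts : seq R) (s : R) (h : R -> V)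
    : \bar R :=
  if ts is t :: ts' then
    (\int[leb]_z ((dyson_kernel (t - s) (h s) z)%:E *
       dyson_iter Phi ts' t (upd h t z)))%E
  else (Phi h)%:E.

(* Measurability for the product sigma-algebra on [R -> V]. *)
Definition cylinder_measurable (Phi : (R -> V) -> R) :=
  forall d (T : measurableType d) (eta : T -> R -> V),
    (forall t, measurable_fun setT (fun x => eta x t)) ->
    measurable_fun setT (fun x => Phi (eta x)).

Lemma dyson_kernel_ge0 t y z : 0 <= dyson_kernel t y z.
Proof. by rewrite mulr_ge0// le_max lexx. Qed.

Lemma dyson_iter_ge0 (Phi : (R -> V) -> R) ts s h : (forall h, 0 <= Phi h) ->
  (0 <= dyson_iter Phi ts s h)%E.
Proof.
move=> Phi0; elim: ts s h => [|t ts IH] s h /=; first by rewrite lee_fin.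
by apply: integral_ge0 => z _; rewrite mule_ge0// lee_fin dyson_kernel_ge0.
Qed.

Lemma measurable_dyson_kernel d (T : measurableType d) t (y z : T -> V) :
  measurable_fun setT y -> measurable_fun setT z ->
  measurable_fun setT (fun x => dyson_kernel t (y x) (z x)).
Proof.
move=> my mz; apply: measurable_funM.
  by apply: measurable_maxr => //; exact: measurable_dyson_transition.
have m1 : measurable_fun setT (\1_(@weyl_chamber R n) : V -> R).
  by apply: measurable_indic; exact: measurable_weyl_chamber.
exact: (measurableT_comp m1 mz).
Qed.

(** The parameter space [T] is general because the induction enlarges it to [T * V]; Tonelli handles
    the integral over the new variable. *)
Lemma measurable_dyson_iter (Phi : (R -> V) -> R) ts s d (T : measurableType d)
    (eta : T -> R -> V) :
  (forall h, 0 <= Phi h) -> cylinder_measurable Phi ->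
  (forall t, measurable_fun setT (fun x => eta x t)) ->
  measurable_fun setT (fun x => dyson_iter Phi ts s (eta x)).
Proof.
move=> Phi0 mPhi; elim: ts s d T eta => [|t ts IH] s d T eta meta /=.
  by apply/measurable_EFinP; exact: mPhi.
pose F (p : T * V) : \bar R := ((dyson_kernel (t - s) (eta p.1 s) p.2)%:E *
   dyson_iter Phi ts t (upd (eta p.1) t p.2))%E.
have mF : measurable_fun setT F.
  apply: emeasurable_funM.
    apply/measurable_EFinP; apply: measurable_dyson_kernel => //.
    exact: (measurableT_comp (meta s)).
  apply: (IH t _ (T * V)%type (fun p => upd (eta p.1) t p.2)) => t'.
  rewrite /upd; case: (t' == t); first exact: measurable_snd.
  exact: (measurableT_comp (meta t') (@measurable_fst _ _ T V)).
apply: (measurable_fun_fubini_tonelli_F (m2 := leb) F mF) => p.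
by rewrite mule_ge0 ?dyson_iter_ge0// lee_fin dyson_kernel_ge0.
Qed.

End dyson_iter.
End lebesgue_box.

(** * Limits of the discrete kernels *)

Section limits.
Variable R : realType.

Lemma cvg_big_sum (I : Type) (s : seq I) (P : pred I) (f : I -> nat -> R) (g : I -> R) :
  (forall i, f i N @[N --> \oo] --> g i) ->
  \sum_(i <- s | P i) f i N @[N --> \oo] --> \sum_(i <- s | P i) g i.
Proof.
move=> fg; elim: s => [|i s IH].
  by under eq_fun do rewrite big_nil; rewrite big_nil; exact: cvg_cst.
under eq_fun do rewrite big_cons; rewrite big_cons; case: (P i) => //.
exact: cvgD.
Qed.

Lemma cvg_big_prod (I : Type) (s : seq I) (P : pred I) (f : I -> nat -> R) (g : I -> R) :
  (forall i, f i N @[N --> \oo] --> g i) ->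
  \prod_(i <- s | P i) f i N @[N --> \oo] --> \prod_(i <- s | P i) g i.
Proof.
move=> fg; elim: s => [|i s IH].
  by under eq_fun do rewrite big_nil; rewrite big_nil; exact: cvg_cst.
under eq_fun do rewrite big_cons; rewrite big_cons; case: (P i) => //.
exact: cvgM.
Qed.

Lemma cvg_det n (A : nat -> 'I_n -> 'I_n -> R) (B : 'I_n -> 'I_n -> R) :
  (forall i j, A N i j @[N --> \oo] --> B i j) ->
  \det (\matrix_(i, j) A N i j) @[N --> \oo] --> \det (\matrix_(i, j) B i j).
Proof.
move=> AB; have AB' i j : (\matrix_(i, j) A N i j) i j @[N --> \oo] -->
    (\matrix_(i, j) B i j) i j.
  rewrite mxE (_ : (fun N => _) = (fun N => A N i j)); first exact: AB.
  by apply/funext => N; rewrite mxE.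
rewrite /determinant; apply: cvg_big_sum => s.
apply: cvgM; first exact: cvg_cst.
by apply: cvg_big_prod => i; exact: AB'.
Qed.

Lemma cvg_vandermonde n (v : nat -> n.-tuple R) (z : n.-tuple R) :
  (forall i, tnth (v N) i @[N --> \oo] --> tnth z i) ->
  vandermonde (v N) @[N --> \oo] --> vandermonde z.
Proof.
move=> vz; apply: cvg_big_prod => i; apply: cvg_big_prod => j.
exact: (cvgB (vz j) (vz i)).
Qed.

Lemma vandermonde_gt0 n (z : n.-tuple R) : weyl_chamber z -> 0 < vandermonde z.
Proof.
move=> Wz; apply: prodr_gt0 => i _; apply: prodr_gt0 => j ij.
by rewrite subr_gt0; exact: Wz.
Qed.

Section fixed_dimension.
Variable n : nat.
Local Notation V := (n.-tuple R).

(** All powers of [sqrt N] are collected in a factor independent of [u], which cancels in the ratio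
    of two counts. *)
Lemma gt_count_rescaled M N k (u : line M.+1 n) : (0 < N)%N -> strict u ->
  (gt_count u)%:R = (\prod_(i < n) (i`!)%:R)^-1 *
    (\prod_(i < n) \prod_(j < n | (i < j)%N) (Num.sqrt N%:R / 2)) *
    vandermonde (rescaled R N k u) :> R.
Proof.
move=> N0 su; rewrite gt_count_vandermonde// -mulrA; congr (_ * _).
rewrite /vandermonde -big_split /=; apply: eq_bigr => i _.
rewrite -big_split /=; apply: eq_bigr => j _; rewrite !tnth_mktuple.
by field; rewrite gt_eqF// sqrtr_gt0 ltr0n.
Qed.

Variables (M : nat -> nat).
Local Notation ln N := (line (M N).+1 n).

(** The prefactor is the reciprocal volume of a lattice cell. Distributed over the rows of the
    Karlin-McGregor determinant, it makes the entries converge to heat kernels. *)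
Lemma cvg_obs_kernel (k k' : nat -> nat) (u v : forall N, ln N) (D : R) (y z : V) :
  0 < D -> weyl_chamber y ->
  (\forall N \near \oo, (k N <= k' N)%N) ->
  (k' N - k N)%:R / N%:R @[N --> \oo] --> D ->
  (forall N, strict (u N)) -> (\forall N \near \oo, strict (v N)) ->
  (forall i, tnth (rescaled R N (k N) (u N)) i @[N --> \oo] --> tnth y i) ->
  (forall i, tnth (rescaled R N (k' N) (v N)) i @[N --> \oo] --> tnth z i) ->
  (Num.sqrt N%:R / 2) ^+ n * obs_kernel R (k N) (k' N) (u N) (v N)
    @[N --> \oo] --> dyson_transition D y z.
Proof.
move=> D0 Wy kk' kD su sv uy vz.
suff main : vandermonde (rescaled R N (k' N) (v N)) /
    vandermonde (rescaled R N (k N) (u N)) *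
    \det (\matrix_(i, j) (Num.sqrt N%:R / 2 *
      binom_pmf R (k' N - k N) (u N i) (v N j))) @[N --> \oo] -->
    dyson_transition D y z.
  move: main; apply: cvg_trans; apply: near_eq_cvg; near=> N.
  have N0 : (0 < N)%N by near: N; exact: nbhs_infty_gt.
  have svN : strict (v N) by near: N.
  rewrite det_scale_rows prodr_const card_ord det_binom_pmf// /obs_kernel.
  rewrite (gt_count_rescaled (k N) N0 (su N)) (gt_count_rescaled (k' N) N0 svN).
  set F := (\prod_(i < n) (i`!)%:R)^-1.
  set K := \prod_(i < n) \prod_(j < n | _) (Num.sqrt N%:R / 2).
  have F0 : F != 0.
    apply: invr_neq0; rewrite gt_eqF//; apply: prodr_gt0 => i _.
    by rewrite ltr0n fact_gt0.
  have K0 : K != 0.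
    rewrite gt_eqF// prodr_gt0// => i _; apply: prodr_gt0 => j _.
    by rewrite divr_gt0// sqrtr_gt0 ltr0n.
  rewrite mulrCA; congr (_ * _); congr (_ * _).
  by rewrite invfM mulrACA mulfV ?mulf_neq0// mul1r.
apply: cvgM.
  apply: cvgM; first exact: cvg_vandermonde.
  by apply: cvgV; [rewrite gt_eqF// vandermonde_gt0|exact: cvg_vandermonde].
apply: cvg_det => i j; apply: cvg_binom_pmf => //.
suff : tnth (rescaled R N (k' N) (v N)) j - tnth (rescaled R N (k N) (u N)) i
    @[N --> \oo] --> tnth z j - tnth y i.
  apply: cvg_trans; apply: near_eq_cvg; near=> N.
  have kN : (k N <= k' N)%N by near: N.
  by rewrite !tnth_mktuple natrB//; ring.
exact: cvgB.
Unshelve. all: by end_near.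
Qed.

(** The exponents add up as [k / 2 + k (k - 1) / 2 = k^2 / 2]. *)
Lemma powR_square_exponent (t : R) (k : nat) : 0 < t ->
  (t `^ (- 2^-1)) ^+ k * \prod_(j < k) (t ^- j) = t `^ (- (k ^ 2)%:R / 2).
Proof.
move=> t0; elim: k => [|k IH].
  by rewrite big_ord0 expr0 mulr1 mulr0n oppr0 mul0r powRr0.
rewrite exprS big_ord_recr /=.
set p := _ `^ _ in IH *; set Q := \prod_(j < k) _ in IH *.
transitivity ((p ^+ k * Q) * (p * t ^- k)); first by ring.
have nt : t != 0 by rewrite gt_eqF.
have -> : t ^- k = t `^ (- k%:R) by rewrite powRN powR_mulrn// ltW.
rewrite IH /p -!powRD ?nt ?implybT//; congr (_ `^ _).
by rewrite !natrX -natr1; field.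
Qed.

(** The shape in which the limit arises: a heat kernel per particle, one Vandermonde factor from the
    transition determinant and one from the pattern count. *)
Lemma dyson_entranceE (t : R) (z : V) : 0 < t ->
  dyson_entrance t z = \prod_(j < n) heat_kernel t (tnth z j) *
    vandermonde z ^+ 2 * (\prod_(j < n) t ^- j) * (\prod_(j < n) (j`!)%:R)^-1.
Proof.
move=> t0; rewrite /dyson_entrance -powR_square_exponent// /dyson_norm.
rewrite /heat_kernel big_split /= prodr_const card_ord.
have -> : \prod_(i < n) expR (- tnth z i ^+ 2 / (2 * t)) =
    expR (- \sum_(i < n) tnth z i ^+ 2 / (2 * t)).
  rewrite -sumrN; elim/big_rec2: _ => [|i x y _ ->]; first by rewrite expR0.
  by rewrite expRD mulNr.
have -> : \prod_(i < n) \prod_(j < n | (i < j)%N) (tnth z j - tnth z i) ^+ 2 =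
    vandermonde z ^+ 2.
  rewrite /vandermonde -prodrXl; apply: eq_bigr => i _; by rewrite -prodrXl.
have pi2 : 0 <= 2 * pi :> R by rewrite mulr_ge0 ?pi_ge0.
have -> : (2 * pi * t) `^ (- 2^-1) = (2 * pi) `^ (- 2^-1) * t `^ (- 2^-1).
  by rewrite powRM// ltW.
rewrite exprMn invfM.
have -> : ((2 * pi) `^ (- 2^-1)) ^+ n = ((2 * pi) `^ (n%:R / 2))^-1 :> R.
  by rewrite -powR_mulrn ?powR_ge0// -powRrM -powRN; congr (_ `^ _); ring.
by ring.
Qed.

(* [det_bin_shift] evaluates the transition from the packed configuration in
   closed form. *)
Lemma bern_iter_start N k (v : line (M N).+1 n) : (n <= M N)%N -> strict v ->
  (forall i, (0 < v i)%N) ->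
  bern_iter R k (start (M N) n) v =
  (\prod_(j < n) binom_pmf R (k + n.-1) 1 (v j)) * (\prod_(j < n) 4 ^+ j) *
  (\prod_(j < n) ((k + n.-1) ^_ j)%:R)^-1 *
  \prod_(i < n) \prod_(j < n | (i < j)%N) ((v j)%:R - (v i)%:R).
Proof.
move=> nM sv v0; rewrite -det_binom_pmf ?strict_start//.
(* Subtracting 1 from all positions puts the packed configuration at [0, ..., n - 1], as
   [det_bin_shift] expects. *)
transitivity (\det (\matrix_(i, j < n) (2 ^- k *
   (if (i <= (v j).-1)%N then 'C(k, (v j).-1 - i) else 0)%:R)) : R).
  congr (\det _); apply/matrixP => i j; rewrite !mxE startE// /binom_pmf mulrC.
  by have := v0 j; case: (nat_of_ord (v j)) => // w _ /=; rewrite ltnS subSS.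
rewrite det_scale_rows det_bin_shift prodr_const card_ord !mulrA.
congr (_ * _ * _); last first.
  apply: eq_bigr => i _; apply: eq_bigr => j _.
  have := v0 i; have := v0 j.
  case: (nat_of_ord (v j)) => // wj _; case: (nat_of_ord (v i)) => // wi _ /=.
  by rewrite -!natr1; ring.
rewrite [RHS]mulrC /binom_pmf.
(* Normalising [n] binomials by [2^(k + n - 1)] in place of [2^k] costs [2^(n (n - 1))], the product
   of the [4^j]. *)
have -> : \prod_(j < n) 4 ^+ j = (2 ^+ n.-1) ^+ n :> R.
  transitivity (\prod_(j < n) (2 ^+ j * 2 ^+ j : R)).
    by apply: eq_bigr => j _; rewrite -exprMn; congr (_ ^+ _); ring.
  rewrite big_split /= [X in X * _](reindex_inj rev_ord_inj) /= -big_split /=.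
  rewrite -[in RHS](card_ord n) -prodr_const; apply: eq_bigr => j _.
  by rewrite -exprD; congr (_ ^+ _); rewrite card_ord; have := ltn_ord j; lia.
rewrite -[X in _ ^+ X](card_ord n) -prodr_const -big_split /=.
rewrite -[X in _ ^+ X * _](card_ord n) -prodr_const -big_split /=.
apply: eq_bigr => j _; rewrite v0 subn1 exprD.
by field; rewrite !expf_neq0 ?pnatr_eq0.
Qed.

Lemma prod_upper_const (c : R) :
  \prod_(i < n) \prod_(j < n | (i < j)%N) c = \prod_(j < n) c ^+ j.
Proof.
rewrite (exchange_big_dep xpredT)//=; apply: eq_bigr => j _.
rewrite -(big_ord_widen n (fun=> c)) ?prodr_const ?card_ord//.
exact/ltnW/ltn_ord.
Qed.

Lemma cvg_natrV : (N%:R : R)^-1 @[N --> \oo] --> (0 : R).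
Proof.
suff : (Num.sqrt N%:R)^-1 * (Num.sqrt N%:R)^-1 @[N --> \oo] --> (0 : R).
  apply: cvg_trans; apply: near_eq_cvg; near=> N.
  by rewrite /= -invfM -expr2 sqr_sqrtr.
by rewrite -[X in _ --> X](mulr0 0); apply: cvgM; exact: cvg_sqrt_natrV.
Unshelve. all: by end_near.
Qed.

Lemma cvg_ffact (s : nat -> nat) (t : R) j :
  (s N)%:R / N%:R @[N --> \oo] --> t -> (forall N, (j <= (s N).+1)%N) ->
  ((s N) ^_ j)%:R / N%:R ^+ j @[N --> \oo] --> t ^+ j.
Proof.
move=> st; elim: j => [|j IH] sj.
  by under eq_fun do rewrite ffactn0 expr0 divr1; exact: cvg_cst.
have sj' N : (j <= s N)%N by have := sj N; lia.
have h : ((s N)%:R / N%:R - j%:R * N%:R^-1) @[N --> \oo] --> t.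
  rewrite -[t]subr0 -[X in _ - X](mulr0 j%:R); apply: cvgB => //.
  by apply: cvgM; [exact: cvg_cst|exact: cvg_natrV].
suff : ((s N) ^_ j)%:R / N%:R ^+ j * ((s N)%:R / N%:R - j%:R * N%:R^-1)
    @[N --> \oo] --> t ^+ j.+1.
  apply: cvg_trans; apply: near_eq_cvg; near=> N.
  by rewrite ffactnSr natrM natrB// exprSr invfM; ring.
by rewrite exprSr; apply: cvgM => //; apply: IH => N; exact/leqW/sj'.
Unshelve. all: by end_near.
Qed.

Lemma cvg_obs_kernel_start (k : nat -> nat) (v : forall N, ln N) (t : R) (z : V) :
  0 < t -> (forall N, (n <= M N)%N) ->
  (k N)%:R / N%:R @[N --> \oo] --> t ->
  (\forall N \near \oo, strict (v N)) ->
  (forall i, tnth (rescaled R N (k N) (v N)) i @[N --> \oo] --> tnth z i) ->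
  (Num.sqrt N%:R / 2) ^+ n * obs_kernel R 0 (k N) (start (M N) n) (v N)
    @[N --> \oo] --> dyson_entrance t z.
Proof.
move=> t0 nM kt sv vz; rewrite dyson_entranceE//.
pose S N := (k N + n.-1)%N.
have St : (S N)%:R / N%:R @[N --> \oo] --> t.
  suff : ((k N)%:R / N%:R + n.-1%:R * N%:R^-1) @[N --> \oo] --> t.
    by apply: cvg_trans; apply: near_eq_cvg; near=> N; rewrite natrD mulrDl.
  rewrite -[t]addr0 -[X in _ + X](mulr0 n.-1%:R); apply: cvgD => //.
  by apply: cvgM; [exact: cvg_cst|exact: cvg_natrV].
have vpos : \forall N \near \oo, forall i, (0 < v N i)%N.
  have hi i : \forall N \near \oo, (0 < v N i)%N.
    have vs : (tnth (rescaled R N (k N) (v N)) i * ((Num.sqrt N%:R)^-1 / 2) +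
        (k N)%:R / N%:R / 2) @[N --> \oo] --> t / 2.
      rewrite -[t / 2]add0r -[X in X + _](mulr0 (tnth z i)); apply: cvgD.
        apply: cvgM => //; rewrite -(mul0r 2^-1); apply: cvgM; last exact: cvg_cst.
        exact: cvg_sqrt_natrV.
      by apply: cvgM => //; exact: cvg_cst.
    near=> N.
    have N0 : 0 < N%:R :> R by rewrite ltr0n; near: N; exact: nbhs_infty_gt.
    have s0 : Num.sqrt N%:R != 0 :> R by rewrite gt_eqF// sqrtr_gt0.
    have ss : Num.sqrt N%:R ^+ 2 = N%:R :> R by rewrite sqr_sqrtr// ltW.
    have : 0 < tnth (rescaled R N (k N) (v N)) i * ((Num.sqrt N%:R)^-1 / 2) +
        (k N)%:R / N%:R / 2.
      by near: N; apply: (cvgr_gt _ vs); rewrite divr_gt0.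
    rewrite tnth_mktuple (_ : _ + _ = (v N i)%:R / N%:R).
      by rewrite pmulr_lgt0 ?invr_gt0// ltr0n.
    by move: (Num.sqrt N%:R) s0 ss => s s0 <-; field.
  exact: filter_forall.
suff main : \prod_(j < n) (Num.sqrt N%:R / 2 * binom_pmf R (S N) 1 (v N j)) *
    vandermonde (rescaled R N (k N) (v N)) ^+ 2 *
    (\prod_(j < n) (((S N) ^_ j)%:R / N%:R ^+ j))^-1 *
    (\prod_(j < n) (j`!)%:R)^-1 @[N --> \oo] -->
    \prod_(j < n) heat_kernel t (tnth z j) *
    vandermonde z ^+ 2 * (\prod_(j < n) t ^- j) * (\prod_(j < n) (j`!)%:R)^-1.
  move: main; apply: cvg_trans; apply: near_eq_cvg; near=> N.
  have N0 : (0 < N)%N by near: N; exact: nbhs_infty_gt.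
  have s0 : Num.sqrt N%:R != 0 :> R by rewrite gt_eqF// sqrtr_gt0 ltr0n.
  have ss : Num.sqrt N%:R ^+ 2 = N%:R :> R by rewrite sqr_sqrtr.
  have svN : strict (v N) by near: N.
  have v0 : forall i, (0 < v N i)%N by near: N.
  rewrite /obs_kernel gt_count_start// divr1 subn0 bern_iter_start// -/(S N).
  have := gt_count_rescaled (k N) N0 svN; rewrite gt_count_vandermonde// -mulrA.
  set F := (\prod_(i < n) (i`!)%:R)^-1 => /mulfI.
  have F0 : F != 0.
    apply: invr_neq0; rewrite gt_eqF//; apply: prodr_gt0 => i _.
    by rewrite ltr0n fact_gt0.
  move=> /(_ F0) ->.
  set W := vandermonde _; rewrite prod_upper_const.
  rewrite big_split /= prodr_const card_ord.
  (* The two Vandermonde scalings give [(N / 4)^j], and the factor [4^j] turns this into [N^j]. *)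
  have -> : (\prod_(j < n) (((S N) ^_ j)%:R / N%:R ^+ j))^-1 =
      (\prod_(j < n) (Num.sqrt N%:R / 2) ^+ j) ^+ 2 * (\prod_(j < n) 4 ^+ j) *
      (\prod_(j < n) ((S N) ^_ j)%:R)^-1 :> R.
    rewrite expr2 -!prodfV -!big_split /=; apply: eq_bigr => j _.
    rewrite invfM invrK mulrC -expr2 -exprM mulnC exprM expr_div_n ss -exprMn.
    by congr (_ ^+ _ * _); field.
  by ring.
apply: cvgM; last exact: cvg_cst.
apply: cvgM; last first.
  rewrite prodfV; apply: cvgV.
    by rewrite gt_eqF// prodr_gt0// => i _; rewrite exprn_gt0.
  apply: cvg_big_prod => j; apply: cvg_ffact => // N.
  by have := ltn_ord j; rewrite /S; lia.
apply: cvgM; last by rewrite expr2; apply: cvgM; exact: cvg_vandermonde.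
apply: cvg_big_prod => j; apply: (cvg_binom_pmf (a := fun=> 1%N)) => //.
(* Starting at 1 with [n - 1] extra steps moves the centre by a constant, negligible after division
   by [sqrt N]. *)
suff : tnth (rescaled R N (k N) (v N)) j - (1 + n.-1%:R / 2) * 2 * (Num.sqrt N%:R)^-1
    @[N --> \oo] --> tnth z j.
  apply: cvg_trans; apply: near_eq_cvg; near=> N.
  by rewrite tnth_mktuple /S natrD; ring.
rewrite -[tnth z j]subr0 -[X in _ - X](mulr0 ((1 + n.-1%:R / 2) * 2)).
apply: cvgB => //; apply: cvgM; first exact: cvg_cst.
exact: cvg_sqrt_natrV.
Unshelve. all: by end_near.
Qed.

End fixed_dimension.
End limits.

(** * Inequalities for the limit inferior *)

Section limn_einf_lemmas.
Variable R : realType.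
Implicit Types (a : (\bar R)^nat) (b : \bar R).

Lemma lte_dense b b' : (b < b')%E -> exists r : R, (b < r%:E)%E /\ (r%:E < b')%E.
Proof.
case: b b' => [x| |] [y| |]// xy.
- exists ((x + y) / 2); rewrite !lte_fin in xy *; split; lra.
- by exists (x + 1); rewrite lte_fin ltry; split => //; lra.
- by exists (y - 1); rewrite lte_fin ltNyr; split => //; lra.
- by exists 0; rewrite ltry ltNyr.
Qed.

Lemma limn_einfE a : limn_einf a = ereal_sup (range (einfs a)).
Proof. by rewrite limn_einf_lim; apply/cvg_lim => //; exact: cvg_einfs_sup. Qed.

Lemma near_le_limn_einf a b :
  (\forall N \near \oo, (b <= a N)%E) -> (b <= limn_einf a)%E.
Proof.
move=> [N0 _ H]; rewrite limn_einfE.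
apply: (@le_trans _ _ (einfs a N0)); last by apply: ereal_sup_ubound; exists N0.
by apply: le_ereal_inf_tmp => _ [k /= Nk <-]; exact: H.
Qed.

Lemma limn_einf_near a b :
  (b < limn_einf a)%E -> \forall N \near \oo, (b <= a N)%E.
Proof.
rewrite limn_einfE => /ereal_sup_gt[_ [N0 _ <-]] bN.
exists N0 => // k /= Nk; apply: le_trans (ltW bN) _.
by apply: ereal_inf_lbound; exists k.
Qed.

Lemma le_limn_einfP a b :
  (forall r : R, (r%:E < b)%E -> \forall N \near \oo, (r%:E <= a N)%E) ->
  (b <= limn_einf a)%E.
Proof.
move=> H; rewrite leNgt; apply/negP => /lte_dense[r [r1 r2]].
by have := near_le_limn_einf (H r r2); rewrite leNgt r1.
Qed.

Lemma near_le_limn_einf2 a a' : (\forall N \near \oo, (a N <= a' N)%E) ->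
  (limn_einf a <= limn_einf a')%E.
Proof.
move=> aa; apply: le_limn_einfP => r /limn_einf_near ra.
by near=> N; apply: (@le_trans _ _ (a N)); near: N.
Unshelve. all: by end_near.
Qed.

(** If [0 <= r < p * liminf], some [q] lies between [r / p] and the limit inferior, and
    [r = (r / q) * q] is bounded factor by factor. For [p = 0] the convention [0 * +oo = 0] excludes
    such [r]. *)
Lemma limn_einf_cvgM (c : nat -> R) (p : R) a :
  c N @[N --> \oo] --> p -> (forall N, 0 <= c N) -> (forall N, (0 <= a N)%E) ->
  (p%:E * limn_einf a <= limn_einf (fun N => (c N)%:E * a N))%E.
Proof.
move=> cp c0 a0.
have p0 : 0 <= p.
  by apply: (cvgr_to_ge cp); exact: nearW.
have L0 : (0 <= limn_einf a)%E by apply: near_le_limn_einf; exact: nearW.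
apply: le_limn_einfP => r rpL.
have [r0|r0] := ltP r 0.
  near=> N; apply: (@le_trans _ _ 0%E); first by rewrite lee_fin ltW.
  by rewrite mule_ge0// lee_fin.
have {}p0 : 0 < p.
  rewrite lt_neqAle p0 andbT; apply/eqP => p0'; move: rpL.
  by rewrite -p0' mul0e lte_fin ltNge r0.
have : ((r / p)%:E < limn_einf a)%E.
  by rewrite mulrC EFinM lte_pdivrMl//.
move=> /lte_dense[q [rq qL]]; rewrite lte_fin in rq.
have q0 : 0 < q by apply: le_lt_trans rq; rewrite divr_ge0// ltW.
have qa := limn_einf_near qL.
near=> N.
have h1 : (q%:E <= a N)%E by near: N.
have h2 : r / q <= c N.
  by near: N; apply: (cvgr_ge _ cp); rewrite ltr_pdivrMr// mulrC -ltr_pdivrMr.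
have -> : r = (r / q) * q by rewrite divfK// gt_eqF.
by rewrite EFinM lee_pmul// lee_fin ?divr_ge0// ltW.
Unshelve. all: by end_near.
Qed.

End limn_einf_lemmas.

(** * Rounding points to lattice configurations *)

Section lattice_rounding.
Variables (R : realType) (n : nat) (M : nat -> nat).
Local Notation V := (n.-tuple R).
Local Notation ln N := (line (M N).+1 n).
Hypothesis nM : forall N, (n <= M N)%N.

Definition cell N k (u : ln N) : set V :=
  box (fun i => ((u i)%:R - k%:R / 2) * (2 / Num.sqrt N%:R))
      (fun i => ((u i)%:R + 1 - k%:R / 2) * (2 / Num.sqrt N%:R)).

Lemma lebesgue_cell N k (u : ln N) : (0 < N)%N ->
  lebesgue_tuple R n (cell k u) = ((2 / Num.sqrt N%:R) ^+ n)%:E.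
Proof.
move=> N0; have e0 : 0 < 2 / Num.sqrt N%:R :> R.
  by rewrite divr_gt0// sqrtr_gt0 ltr0n.
rewrite lebesgue_tuple_box => [|i]; last by rewrite ler_pM2r//; lra.
congr EFin; rewrite -[in RHS](card_ord n) -prodr_const.
by apply: eq_bigr => i _; ring.
Qed.

(* [start] is a default for the case where rounding merges two particles. *)
Definition lattice_point N k (z : V) : ln N :=
  let u := [ffun i => inord (Num.truncn (tnth z i * (Num.sqrt N%:R / 2) + k%:R / 2))]
  in if strict u then u else start (M N) n.

Lemma strict_lattice_point N k z : strict (lattice_point N k z).
Proof. by rewrite /lattice_point; case: ifP => // _; exact: strict_start. Qed.

(** The unscaled coordinates divided by [N] tend to [t / 2], strictly between 0 and [t], so they
    stay in the window; the gaps grow like [sqrt N] and eventually reach 1, so rounding keeps the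
    order strict. *)
Lemma mem_cell_lattice_point (k : nat -> nat) (t : R) (z : V) : 0 < t ->
  (forall N, (k N <= M N)%N) -> (k N)%:R / N%:R @[N --> \oo] --> t ->
  weyl_chamber z ->
  \forall N \near \oo, cell (k N) (lattice_point N (k N) z) z.
Proof.
move=> t0 kM kt Wz.
pose w N i : R := tnth z i * (Num.sqrt N%:R / 2) + (k N)%:R / 2.
have wt i : w N i / N%:R @[N --> \oo] --> t / 2.
  suff : tnth z i / 2 * (Num.sqrt N%:R)^-1 + (k N)%:R / N%:R / 2 @[N --> \oo] --> t / 2.
    apply: cvg_trans; apply: near_eq_cvg; near=> N.
    have N0 : 0 < N%:R :> R by rewrite ltr0n; near: N; exact: nbhs_infty_gt.
    have s0 : Num.sqrt N%:R != 0 :> R by rewrite gt_eqF// sqrtr_gt0.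
    have ss : Num.sqrt N%:R ^+ 2 = N%:R :> R by rewrite sqr_sqrtr// ltW.
    by rewrite /w; move: (Num.sqrt N%:R) s0 ss => s s0 <-; field.
  rewrite -[t / 2]add0r -[X in X + _](mulr0 (tnth z i / 2)); apply: cvgD.
    by apply: cvgM; [exact: cvg_cst|exact: cvg_sqrt_natrV].
  by apply: cvgM => //; exact: cvg_cst.
have wpos : \forall N \near \oo, forall i, 0 <= w N i < (k N)%:R.
  apply: filter_forall => i; near=> N.
  have N0 : 0 < N%:R^-1 :> R by rewrite invr_gt0 ltr0n; near: N; exact: nbhs_infty_gt.
  rewrite -(pmulr_lge0 _ N0) -(ltr_pM2r N0); apply/andP; split.
    by near: N; apply: (cvgr_ge _ (wt i)); lra.
  apply: (@lt_trans _ _ (3 * t / 4)).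
    by near: N; apply: (cvgr_lt _ (wt i)); lra.
  by near: N; apply: (cvgr_gt _ kt); lra.
have gap : \forall N \near \oo, forall p : 'I_n * 'I_n,
    (p.1 < p.2)%N -> 1 <= w N p.2 - w N p.1.
  apply: filter_forall => -[i j] /=; near=> N => ij.
  have zij : 0 < tnth z j - tnth z i by rewrite subr_gt0; exact: Wz.
  have : 2 / (tnth z j - tnth z i) <= Num.sqrt N%:R.
    by near: N; move/cvgryPge : (@cvg_sqrt_natr R); apply.
  by rewrite ler_pdivrMr// /w; lra.
near=> N.
have N0 : (0 < N)%N by near: N; exact: nbhs_infty_gt.
have s0 : 0 < Num.sqrt N%:R :> R by rewrite sqrtr_gt0 ltr0n.
have wN : forall i, 0 <= w N i < (k N)%:R by near: N.
have gN : forall p : 'I_n * 'I_n, (p.1 < p.2)%N -> 1 <= w N p.2 - w N p.1 by near: N.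
set u : ln N := [ffun i => inord (Num.truncn (w N i))].
have uE i : (u i : nat)%:R <= w N i < (u i : nat)%:R + 1.
  have /andP[w0 wk] := wN i; have := truncn_itv w0.
  rewrite ffunE inordK ?natr1// ltnS (leq_trans _ (kM N))//.
  by rewrite truncn_le_nat (lt_trans wk)// ltr_nat.
have su : strict u.
  apply/strictP => i j ij; have := gN (i, j) ij => /= g.
  have /andP[h1 h2] := uE i; have /andP[h3 h4] := uE j.
  have : (u i : nat)%:R + 1 < (u j : nat)%:R + 1 :> R by lra.
  by rewrite ltrD2r ltr_nat.
rewrite /lattice_point -/u su => i.
have e0 : 0 < 2 / Num.sqrt N%:R :> R by rewrite divr_gt0.
have -> : tnth z i = (w N i - (k N)%:R / 2) * (2 / Num.sqrt N%:R).
  by rewrite /w addrK; field; rewrite gt_eqF.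
by rewrite ler_pM2r// ltr_pM2r// lerD2r ltrD2r.
Unshelve. all: by end_near.
Qed.

Lemma cvg_rescaled_lattice_point (k : nat -> nat) (z : V) :
  (\forall N \near \oo, cell (k N) (lattice_point N (k N) z) z) ->
  forall i, tnth (rescaled R N (k N) (lattice_point N (k N) z)) i
    @[N --> \oo] --> tnth z i.
Proof.
move=> mem i; apply/cvgrPdist_le => e e0; near=> N.
have N0 : (0 < N)%N by near: N; exact: nbhs_infty_gt.
have : cell (k N) (lattice_point N (k N) z) z by near: N.
move=> /(_ i)/andP[h1 h2]; rewrite tnth_mktuple.
have h3 : 2 * (Num.sqrt N%:R)^-1 <= e.
  near: N; apply: (cvgr_le (2 * 0)); last by rewrite mulr0.
  by apply: cvgM; [exact: cvg_cst|exact: cvg_sqrt_natrV].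
rewrite ler_norml; apply/andP; split; first lra.
by move: h2 h1; rewrite mulrBl mulrDl mulrBl => h2 h1; lra.
Unshelve. all: by end_near.
Qed.

End lattice_rounding.

Section observation_times.
Variable R : realType.

Lemma obs_time_itv N (t : R) : 0 <= t ->
  (obs_time N t)%:R <= N%:R * t < (obs_time N t)%:R + 1.
Proof. by move=> t0; rewrite natr1; apply: truncn_itv; rewrite mulr_ge0. Qed.

Lemma cvg_obs_time (t : R) : 0 <= t ->
  (obs_time N t)%:R / N%:R @[N --> \oo] --> t.
Proof.
move=> t0; apply/cvgrPdist_le => e e0; near=> N.
have N0 : 0 < N%:R :> R by rewrite ltr0n; near: N; exact: nbhs_infty_gt.
have /andP[h1 h2] := obs_time_itv N t0.
have h3 : 1 * N%:R^-1 <= e.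
  near: N; apply: (cvgr_le (1 * 0)); last by rewrite mulr0.
  by apply: cvgM; [exact: cvg_cst|exact: cvg_natrV].
rewrite [X in X - _](_ : t = N%:R * t / N%:R); last first.
  by rewrite mulrAC mulfV ?mul1r// gt_eqF.
rewrite -mulrBl normrM [X in _ * X]gtr0_norm ?invr_gt0//.
apply: le_trans h3; rewrite ler_pM2r ?invr_gt0// ler_norml.
by apply/andP; split; lra.
Unshelve. all: by end_near.
Qed.

Lemma obs_time_lt (s t : R) : 0 <= s -> s < t ->
  \forall N \near \oo, (obs_time N s < obs_time N t)%N.
Proof.
move=> s0 st; near=> N.
have N0 : 0 < N%:R^-1 :> R by rewrite invr_gt0 ltr0n; near: N; exact: nbhs_infty_gt.
rewrite -(ltr_nat R) -(ltr_pM2r N0); apply: (@lt_trans _ _ ((s + t) / 2)).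
  by near: N; apply: (cvgr_lt s); [exact: cvg_obs_time|lra].
by near: N; apply: (cvgr_gt t); [apply: cvg_obs_time; lra|lra].
Unshelve. all: by end_near.
Qed.

Lemma cvg_obs_timeB (s t : R) : 0 <= s -> s < t ->
  (obs_time N t - obs_time N s)%:R / N%:R @[N --> \oo] --> t - s.
Proof.
move=> s0 st.
suff : (obs_time N t)%:R / N%:R - (obs_time N s)%:R / N%:R @[N --> \oo] --> t - s.
  apply: cvg_trans; apply: near_eq_cvg; near=> N.
  have lt : (obs_time N s < obs_time N t)%N by near: N; exact: obs_time_lt.
  by rewrite natrB ?(ltnW lt)// mulrBl.
by apply: cvgB; apply: cvg_obs_time => //; lra.
Unshelve. all: by end_near.
Qed.

End observation_times.

(** * Fatou's lemma for iterated kernels *)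

Section liminf.
Variables (R : realType) (n : nat) (M : nat -> nat).
Local Notation V := (n.-tuple R).
Local Notation W := (@weyl_chamber R n).
Local Notation leb := (lebesgue_tuple R n).
Local Notation ln N := (line (M N).+1 n).
Hypothesis nM : forall N, (n <= M N)%N.

(** Each configuration is spread over its cell, whose volume cancels the prefactor. The sum becomes
    an integral over a space independent of [N]. *)
Lemma sum_strict_integral N k (c : ln N -> R) : (0 < N)%N ->
  (forall u, 0 <= c u) ->
  ((\sum_(u | strict u) c u)%:E =
  \int[leb]_z (\sum_(u | strict u)
    (Num.sqrt N%:R / 2) ^+ n * c u * \1_(cell k u) z)%:E)%E.
Proof.
move=> N0 c0.
have s0 : 0 < Num.sqrt N%:R :> R by rewrite sqrtr_gt0 ltr0n.
have a0 (u : ln N) : 0 <= (Num.sqrt N%:R / 2) ^+ n * c u.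
  by rewrite mulr_ge0// exprn_ge0// divr_ge0// ltW.
have m1 (u : ln N) : measurable_fun setT
    (fun z : V => (((Num.sqrt N%:R / 2) ^+ n * c u * \1_(cell k u) z)%:E : \bar R)).
  apply/measurable_EFinP; apply: measurable_funM => //.
  by apply: measurable_indic; exact: measurable_box.
under eq_integral => z _ do rewrite -sumEFin big_mkcond.
rewrite ge0_integral_sum//; last 2 first.
- by move=> u; case: (strict u) => //.
- by move=> u z _; case: ifP => // _; rewrite lee_fin mulr_ge0.
rewrite -sumEFin big_mkcond; apply: eq_bigr => u _.
case: ifP => _; last by rewrite integral0.
under eq_integral do rewrite EFinM.
rewrite ge0_integralZl//; last 2 first.
- by apply/measurable_EFinP/measurable_indic; exact: measurable_box.
- by rewrite lee_fin.
rewrite integral_indic ?setIT//; last exact: measurable_box.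
rewrite [X in _ = (_ * X)%E](_ : _ = ((2 / Num.sqrt N%:R) ^+ n)%:E); last exact: lebesgue_cell.
rewrite -EFinM; congr EFin.
have e1 : Num.sqrt N%:R / 2 * (2 / Num.sqrt N%:R) = 1 :> R.
  by field; rewrite gt_eqF.
by rewrite mulrAC -exprMn e1 expr1n mul1r.
Qed.

(** For fixed [z] only the term of the cell containing [z] is kept: its kernel [c] converges, and
    its continuation [a] is bounded below in the limit inferior. *)
Lemma one_step_liminf (k : nat -> nat) (t : R) (c a : forall N, ln N -> R)
    (p : V -> R) (b : V -> \bar R) : 0 < t ->
  (forall N, (k N <= M N)%N) -> (k N)%:R / N%:R @[N --> \oo] --> t ->
  (forall N u, 0 <= c N u) -> (forall N u, 0 <= a N u) ->
  (forall z, (0 <= b z)%E) ->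
  measurable_fun setT (fun z => ((Num.max 0 (p z) * \1_W z)%:E * b z)%E) ->
  (forall z, W z -> (Num.sqrt N%:R / 2) ^+ n * c N (lattice_point M N (k N) z)
    @[N --> \oo] --> p z) ->
  (forall z, W z ->
    (b z <= limn_einf (fun N => (a N (lattice_point M N (k N) z))%:E))%E) ->
  (\int[leb]_z ((Num.max 0 (p z) * \1_W z)%:E * b z) <=
   limn_einf (fun N => (\sum_(u | strict u) c N u * a N u)%:E))%E.
Proof.
move=> t0 kM kt c0 a0 b0 mK cp ab.
have r0 N : 0 <= (Num.sqrt N%:R / 2) ^+ n :> R by rewrite exprn_ge0// divr_ge0.
pose G N (z : V) : \bar R := (\sum_(u | strict u)
    (Num.sqrt N%:R / 2) ^+ n * (c N u * a N u) * \1_(cell (k N) u) z)%:E.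
have G0 N z : (0 <= G N z)%E.
  by rewrite lee_fin sumr_ge0// => u _; rewrite !mulr_ge0.
have mG N : measurable_fun setT (G N).
  apply/measurable_EFinP.
  apply: (eq_measurable_fun (fun z => \sum_(u : ln N) (if strict u then
    (Num.sqrt N%:R / 2) ^+ n * (c N u * a N u) * \1_(cell (k N) u) z else 0))).
    by move=> z _; rewrite [RHS]big_mkcond.
  apply: measurable_sum => u; case: (strict u) => //.
  apply: measurable_funM => //.
  by apply: measurable_indic; exact: measurable_box.
have -> : limn_einf (fun N => (\sum_(u | strict u) c N u * a N u)%:E) =
   limn_einf (fun N => (\int[leb]_z G N z)%E).
  apply/eqP; rewrite eq_le; apply/andP; split; apply: near_le_limn_einf2; near=> N;
    by rewrite (sum_strict_integral (k N)) ?lexx// => [|u]; rewrite ?mulr_ge0//;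
    near: N; exact: nbhs_infty_gt.
apply: le_trans (fatou _ _ mG _) => //.
have mL : measurable_fun setT (fun z => limn_einf (G^~ z)).
  rewrite /limn_einf; apply: measurableT_comp => //.
  by apply: measurable_fun_limn_esup => N; exact: measurableT_comp.
apply: ge0_le_integral => //.
- by move=> z _; rewrite mule_ge0// lee_fin mulr_ge0// le_max lexx.
- move=> z _; have [Wz|Wz] := pselect (W z); last first.
    rewrite indicE memNset// mulr0 mul0e.
    by apply: near_le_limn_einf; exact: nearW.
  rewrite indicE mem_set// mulr1.
  have := cp z Wz; set cz := (fun N => _) => czp.
  have cz0 N : 0 <= cz N by rewrite mulr_ge0.
  have pz : 0 <= p z by apply: (cvgr_to_ge czp); exact: nearW.
  rewrite (max_idPr pz).
  apply: (@le_trans _ _ ((p z)%:E *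
      limn_einf (fun N => (a N (lattice_point M N (k N) z))%:E)))%E.
    by rewrite lee_wpmul2l ?lee_fin// ab.
  apply: le_trans (limn_einf_cvgM czp cz0 _) _.
    by move=> N; rewrite lee_fin.
  apply: near_le_limn_einf2; near=> N.
  have mem : cell (k N) (lattice_point M N (k N) z) z.
    by near: N; exact: (mem_cell_lattice_point t0 kM kt Wz).
  rewrite /G -EFinM lee_fin (bigD1 (lattice_point M N (k N) z)) ?strict_lattice_point//=.
  have -> : \1_(cell (k N) (lattice_point M N (k N) z)) z = 1 :> R.
    by rewrite indicE mem_set.
  rewrite mulr1 /cz mulrA lerDl.
  by rewrite sumr_ge0// => u _; rewrite !mulr_ge0.
Unshelve. all: by end_near.
Qed.

Definition history_cvg (hN : nat -> R -> V) (h : R -> V) :=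
  forall t i, tnth (hN N t) i @[N --> \oo] --> tnth (h t) i.

Lemma history_cvg_upd (hN : nat -> R -> V) h (zN : nat -> V) z t :
  history_cvg hN h -> (forall i, tnth (zN N) i @[N --> \oo] --> tnth z i) ->
  history_cvg (fun N => upd (hN N) t (zN N)) (upd h t z).
Proof.
by move=> hNh zNz t' i; rewrite /upd; case: (t' == t); [exact: zNz|exact: hNh].
Qed.

Variables (Phi : nat -> (R -> V) -> R) (Phi0 : (R -> V) -> R).
Hypothesis Phi_ge0 : forall N h, 0 <= Phi N h.
Hypothesis Phi0_ge0 : forall h, 0 <= Phi0 h.
Hypothesis mPhi0 : cylinder_measurable Phi0.
Hypothesis Phi_liminf : forall hN h, history_cvg hN h ->
  ((Phi0 h)%:E <= limn_einf (fun N => (Phi N (hN N))%:E))%E.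

Lemma measurable_upd (h : R -> V) t t' :
  measurable_fun setT (fun z : V => upd h t z t').
Proof. by rewrite /upd; case: (t' == t). Qed.

(** Induction on the observation times, starting from configurations that converge to a point of the
    chamber; letting [Phi N] vary with [N] leaves room for rounding errors. *)
Lemma dyson_iter_liminf (ts : seq R) (s : R) (u : forall N, ln N)
    (hN : nat -> R -> V) (h : R -> V) :
  0 < s -> path <%R s ts ->
  (forall t N, t \in ts -> (obs_time N t <= M N)%N) ->
  (forall N, strict (u N)) -> history_cvg hN h ->
  (forall i, tnth (rescaled R N (obs_time N s) (u N)) i @[N --> \oo] -->
    tnth (h s) i) ->
  W (h s) ->
  (dyson_iter Phi0 ts s h <= limn_einf (fun N =>
    (obs_sum N (Phi N) ts (obs_time N s) (u N) (hN N))%:E))%E.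
Proof.
elim: ts s u hN h => [|t ts IH] s u hN h s0 /=.
  by move=> _ _ _ hNh _ _; exact: Phi_liminf.
move=> /andP[st tts] tM su hNh us Wh.
have t0 : 0 < t := lt_trans s0 st.
have kM N : (obs_time N t <= M N)%N by apply: tM; rewrite mem_head.
have kt := cvg_obs_time (ltW t0).
apply: (@one_step_liminf (fun N => obs_time N t) t
  (fun N u' => obs_kernel R (obs_time N s) (obs_time N t) (u N) u')
  (fun N u' => obs_sum N (Phi N) ts (obs_time N t) u'
     (upd (hN N) t (rescaled R N (obs_time N t) u')))
  (dyson_transition (t - s) (h s))
  (fun z => dyson_iter Phi0 ts t (upd h t z))) => //.
- by move=> N u'; exact: obs_kernel_ge0.
- by move=> N u'; apply: obs_sum_ge0.
- by move=> z; exact: dyson_iter_ge0.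
- apply: emeasurable_funM.
    by apply/measurable_EFinP; exact: measurable_dyson_kernel.
  apply: (@measurable_dyson_iter R n Phi0 ts t _ _ (fun z => upd h t z)) => // t'.
  exact: measurable_upd.
- move=> z Wz; apply: cvg_obs_kernel => //.
  + by rewrite subr_gt0.
  + near=> N; apply: ltnW; near: N; exact: obs_time_lt (ltW s0) st.
  + exact: cvg_obs_timeB (ltW s0) st.
  + by apply: nearW => N; exact: strict_lattice_point.
  + apply: cvg_rescaled_lattice_point.
    exact: (mem_cell_lattice_point t0 kM kt Wz).
- move=> z Wz.
  have zN := cvg_rescaled_lattice_point (mem_cell_lattice_point t0 kM kt Wz).
  apply: IH => //.
  + by move=> t' N t'ts; apply: tM; rewrite in_cons t'ts orbT.
  + by move=> N; exact: strict_lattice_point.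
  + exact: history_cvg_upd.
  + by rewrite /upd eqxx.
  + by rewrite /upd eqxx.
Unshelve. all: by end_near.
Qed.

(** The first step is separate because it starts from the packed configuration and uses the entrance
    density; from time [t] on the process is in the chamber and [dyson_iter_liminf] applies. *)
Lemma dyson_entrance_liminf (t : R) (ts : seq R) (h : R -> V) :
  0 < t -> path <%R t ts ->
  (forall t' N, t' \in t :: ts -> (obs_time N t' <= M N)%N) ->
  (\int[leb]_z ((Num.max 0 (dyson_entrance t z) * \1_W z)%:E *
     dyson_iter Phi0 ts t (upd h t z)) <=
   limn_einf (fun N =>
     (obs_sum N (Phi N) (t :: ts) 0 (start (M N) n) h)%:E))%E.
Proof.
move=> t0 tts tM.
have kM N : (obs_time N t <= M N)%N by apply: tM; rewrite mem_head.
have kt := cvg_obs_time (ltW t0).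
apply: (@one_step_liminf (fun N => obs_time N t) t
  (fun N u' => obs_kernel R 0 (obs_time N t) (start (M N) n) u')
  (fun N u' => obs_sum N (Phi N) ts (obs_time N t) u'
     (upd h t (rescaled R N (obs_time N t) u')))
  (dyson_entrance t)
  (fun z => dyson_iter Phi0 ts t (upd h t z))) => //.
- by move=> N u'; exact: obs_kernel_ge0.
- by move=> N u'; apply: obs_sum_ge0.
- by move=> z; exact: dyson_iter_ge0.
- apply: emeasurable_funM.
    apply/measurable_EFinP; apply: measurable_funM.
      by apply: measurable_maxr => //; exact: measurable_dyson_entrance.
    by apply: measurable_indic; exact: measurable_weyl_chamber.
  apply: (@measurable_dyson_iter R n Phi0 ts t _ _ (fun z => upd h t z)) => // t'.
  exact: measurable_upd.
- move=> z Wz; apply: cvg_obs_kernel_start => //.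
  + by apply: nearW => N; exact: strict_lattice_point.
  + apply: cvg_rescaled_lattice_point.
    exact: (mem_cell_lattice_point t0 kM kt Wz).
- move=> z Wz.
  have zN := cvg_rescaled_lattice_point (mem_cell_lattice_point t0 kM kt Wz).
  apply: dyson_iter_liminf => //.
  + by move=> t' N t'ts; apply: tM; rewrite in_cons t'ts orbT.
  + by move=> N; exact: strict_lattice_point.
  + by apply: history_cvg_upd => // t' i; exact: cvg_cst.
  + by rewrite /upd eqxx.
  + by rewrite /upd eqxx.
Qed.

End liminf.

(* The transition density is a limit of nonnegative transition probabilities. *)
Lemma dyson_transition_ge0 (R : realType) n (D : R) (y z : n.-tuple R) : 0 < D ->
  weyl_chamber y -> weyl_chamber z -> 0 <= dyson_transition D y z.
Proof.
move=> D0 Wy Wz.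
(* The walk is observed at times 1 and [1 + D]: a positive first time leaves room for rounding
   [y]. *)
pose M N := (n + obs_time N (1 : R) + obs_time N (1 + D))%N.
have nM N : (n <= M N)%N by rewrite /M; lia.
have k1M N : (obs_time N (1 : R) <= M N)%N by rewrite /M; lia.
have k2M N : (obs_time N (1 + D) <= M N)%N by rewrite /M; lia.
have D1 : 1 < 1 + D by rewrite ltrDl.
have my := mem_cell_lattice_point ltr01 k1M (cvg_obs_time ler01) Wy.
have mz := mem_cell_lattice_point (lt_trans ltr01 D1) k2M
  (cvg_obs_time (ltW (lt_trans ltr01 D1))) Wz.
have := @cvg_obs_kernel R n M _ _ _ _ D y z D0 Wy _ _ _ _
  (cvg_rescaled_lattice_point my) (cvg_rescaled_lattice_point mz).
move=> lim; apply: (cvgr_to_ge (lim _ _ _ _)).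
- near=> N; apply: ltnW; near: N; exact: obs_time_lt ler01 D1.
- by have := cvg_obs_timeB ler01 D1; rewrite [1 + D]addrC addrK.
- by move=> N; exact: strict_lattice_point.
- by apply: nearW => N; exact: strict_lattice_point.
- apply: nearW => N; rewrite mulr_ge0 ?obs_kernel_ge0// exprn_ge0//.
Unshelve. all: by end_near.
Qed.

(** * Finite-dimensional laws of Dyson Brownian motion *)

Section density.
Context d (S : measurableType d) (R : realType) (mu : {measure set S -> \bar R}).
Variable rho : S -> R.
Hypothesis rho0 : forall x, 0 <= rho x.
Hypothesis mrho : measurable_fun setT rho.

(* The two proofs are arguments so that the measure structure can be attached. *)
Definition density of (forall x, 0 <= rho x) & measurable_fun setT rho :=
  fun A : set S => (\int[mu]_(x in A) (rho x)%:E)%E.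

Let mrhoE : measurable_fun setT (fun x => (rho x)%:E).
Proof. exact/measurable_EFinP. Qed.

Let density0 : density rho0 mrho set0 = 0%E.
Proof. by rewrite /density integral_set0. Qed.

Let density_ge0 A : (0 <= density rho0 mrho A)%E.
Proof. by apply: integral_ge0 => x _; rewrite lee_fin. Qed.

Let density_sigma_additive : semi_sigma_additive (density rho0 mrho).
Proof.
move=> /= F mF tF mUF; rewrite /density; apply: cvg_toP.
  apply: ereal_nondecreasing_is_cvgn => m n mn.
  apply: lee_sum_nneg_natr => // k _ _.
  by apply: integral_ge0 => x _; rewrite lee_fin.
rewrite ge0_integral_bigcup//=; first exact: measurable_funTS.
by move=> x _; rewrite lee_fin.
Qed.

HB.instance Definition _ := isMeasure.Build _ _ _ (density rho0 mrho)
  density0 density_ge0 density_sigma_additive.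

Import HBNNSimple.

Variable m : {measure set S -> \bar R}.
Hypothesis m_density : forall A, measurable A -> m A = (\int[mu]_(x in A) (rho x)%:E)%E.

Let integral_density_nnsfun (f : {nnsfun S >-> R}) :
  (\int[m]_x (f x)%:E = \int[mu]_x ((f x)%:E * (rho x)%:E))%E.
Proof.
under [LHS]eq_integral do rewrite fimfunE -fsumEFin//.
rewrite [LHS]ge0_integral_fsum//; last 2 first.
- by move=> r; exact/measurable_EFinP/measurableT_comp.
- by move=> k x _; rewrite EFinM nnfun_muleindic_ge0.
under [RHS]eq_integral.
  move=> x xD; rewrite fimfunE -fsumEFin// ge0_mule_fsuml; last first.
    by move=> r; rewrite EFinM nnfun_muleindic_ge0.
  over.
rewrite [RHS]ge0_integral_fsum//; last 2 first.
- move=> r; apply: emeasurable_funM => //.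
  by apply/measurable_EFinP/measurableT_comp.
- move=> k x _; apply: mule_ge0; last by rewrite lee_fin.
  by rewrite EFinM nnfun_muleindic_ge0.
apply: eq_fsbigr => r rf.
have [r0|r0] := ltP r 0.
  have e x : r * \1_(f @^-1` [set r]) x = 0.
    by apply: EFin_inj; rewrite preimage_nnfun0// indic0 mulr0.
  by rewrite !integral0_eq// => x _; rewrite e ?mul0e.
have mfr : measurable (f @^-1` [set r]) by [].
under eq_integral do rewrite EFinM.
rewrite ge0_integralZl//; last by apply/measurable_EFinP/measurable_indic.
rewrite integral_indic// setIT m_density//.
rewrite integral_mkcond -ge0_integralZl//; last 2 first.
- by apply/(measurable_restrictT _ _).1 => //; exact: measurable_funTS.
- by move=> x _; rewrite erestrict_ge0// => y _; rewrite lee_fin.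
apply: eq_integral => x _; rewrite EFinM -muleA; congr (_ * _)%E.
rewrite patchE indicE; case: (_ \in _); first by rewrite mul1e.
by rewrite mul0e.
Qed.

Lemma integral_density (f : S -> \bar R) :
  measurable_fun setT f -> (forall x, 0 <= f x)%E ->
  (\int[m]_x f x = \int[mu]_x (f x * (rho x)%:E))%E.
Proof.
move=> mf f0.
pose f_ := nnsfun_approx measurableT mf.
transitivity (lim (\int[m]_x (f_ n x)%:E @[n --> \oo])%E).
  rewrite -monotone_convergence//=.
  - apply: eq_integral => ? /[!inE] xD; apply/esym/cvg_lim => //=.
    exact: cvg_nnsfun_approx.
  - by move=> n; exact/measurable_EFinP/measurable_funTS.
  - by move=> n ? _; rewrite lee_fin.
  - by move=> ? _ ? ? mn; rewrite lee_fin; exact/lefP/nd_nnsfun_approx.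
under eq_fun do rewrite integral_density_nnsfun.
rewrite -monotone_convergence//=.
- apply: eq_integral => x _; apply/cvg_lim => //=.
  by apply: cvgeZr => //; exact: cvg_nnsfun_approx.
- by move=> n; apply: emeasurable_funM => //; exact/measurable_EFinP/measurable_funTS.
- by move=> n ? _; rewrite mule_ge0 ?lee_fin.
- move=> x _ ? ? mn; rewrite lee_wpmul2r ?lee_fin//.
  exact/lefP/nd_nnsfun_approx.
Qed.

End density.

(** * Conditional densities *)

Section conditional_density.
Context d0 d1 d2 (T0 : measurableType d0) (S : measurableType d1)
  (V : measurableType d2) (R : realType) (P : probability T0 R)
  (mu : {sigma_finite_measure set V -> \bar R}).
Variables (X : T0 -> S) (Z : T0 -> V) (rho : S -> V -> R).
Hypothesis mX : measurable_fun setT X.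
Hypothesis mZ : measurable_fun setT Z.
Hypothesis rho0 : forall x z, 0 <= rho x z.
Hypothesis mrho : measurable_fun setT (fun p : S * V => rho p.1 p.2).
Hypothesis rho_law : forall A B, measurable A -> measurable B ->
  P (X @^-1` A `&` Z @^-1` B) =
  (\int[P]_(w in X @^-1` A) \int[mu]_(z in B) (rho (X w) z)%:E)%E.

Let XRV := HB.pack_for {mfun T0 >-> S} X (isMeasurableFun.Build _ _ _ _ X mX).

Let G w := (X w, Z w).
Let mG : measurable_fun setT G.
Proof. exact: measurable_fun_pair. Qed.
Let GRV := HB.pack_for {mfun T0 >-> (S * V)%type} G
  (isMeasurableFun.Build _ _ _ _ G mG).

Let nu := (distribution P XRV \x mu)%E.

Let rho_pair (p : S * V) := rho p.1 p.2.
Let rho_pair0 p : 0 <= rho_pair p. Proof. exact: rho0. Qed.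

Let mrhoE : measurable_fun setT (fun p : S * V => (rho p.1 p.2)%:E).
Proof. exact/measurable_EFinP. Qed.

Let joint_lawX A B : measurable A -> measurable B ->
  distribution P GRV (A `*` B) = density nu rho_pair0 mrho (A `*` B).
Proof.
move=> mA mB; rewrite /density.
rewrite [LHS](_ : _ = P (X @^-1` A `&` Z @^-1` B))// rho_law//.
rewrite [RHS]integral_mkcond; set g := (_ \_ _).
have g0 p : (0 <= g p)%E.
  by rewrite /g patchE; case: ifP => // _; rewrite lee_fin.
have mg : measurable_fun setT g.
  apply/(measurable_restrictT _ _).1; first exact: measurableX.
  exact: measurable_funTS.
rewrite fubini_tonelli1// ge0_integral_distribution; last 2 first.
- exact: measurable_fun_fubini_tonelli_F.
- by move=> x; exact: integral_ge0.
rewrite integral_mkcond; apply: eq_integral => w _ /=.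
rewrite patchE /fubini_F /g; case: ifPn => [|].
  rewrite inE /= => Aw; rewrite integral_mkcond; apply: eq_integral => z _.
  rewrite !patchE; congr (if _ then _ else _).
  by apply/idP/idP; rewrite !inE /=; [move=> Bz|case].
rewrite notin_setE /= => Aw; rewrite integral0_eq// => z _.
by rewrite patchE memNset// => -[].
Qed.

Let joint_law C : measurable C ->
  distribution P GRV C = (\int[nu]_(p in C) (rho_pair p)%:E)%E.
Proof.
pose D : set (set (S * V)) :=
  [set C | exists A, measurable A /\ exists B, measurable B /\ C = A `*` B].
apply: (measure_unique D (fun=> setT) _ _ _ _ (distribution P GRV)
  (density nu rho_pair0 mrho)).
- rewrite measurable_prod_measurableType //; congr (<<s _ >>).
  rewrite predeqE; split => [[A mA [B mB <-]]|[A [mA [B [mB ->]]]]].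
    by exists A; split => //; exists B.
  by exists A => //; exists B.
- move=> /= _ _ [X1 [mX1 [X2 [mX2 ->]]]] [Y1 [mY1 [Y2 [mY2 ->]]]].
  rewrite -setXI; exists (X1 `&` Y1); split; first exact: measurableI.
  by exists (X2 `&` Y2); split => //; exact: measurableI.
- by move=> n; exists setT; split => //; exists setT; rewrite setXTT.
- by rewrite bigcup_const.
- by move=> A [A1 [mA1 [A2 [mA2 ->]]]]; exact: joint_lawX.
- by move=> k; rewrite (le_lt_trans (probability_le1 _ _))// ltry.
Qed.

(** The law of [(X, Z)] and the measure with density [rho] with respect to the law of [X] times [mu]
    agree on rectangles, hence everywhere; Tonelli then separates the variables. *)
Lemma integral_conditional_density (F : S * V -> \bar R) :
  measurable_fun setT F -> (forall p, 0 <= F p)%E ->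
  (\int[P]_w F (X w, Z w) =
   \int[P]_w \int[mu]_z ((rho (X w) z)%:E * F (X w, z)))%E.
Proof.
move=> mF F0.
rewrite -(ge0_integral_distribution GRV mF F0).
rewrite (integral_density rho_pair0 mrho joint_law mF F0).
have m1 : measurable_fun setT (fun p => F p * (rho_pair p)%:E)%E.
  by apply: emeasurable_funM.
have p1 p : (0 <= F p * (rho_pair p)%:E)%E by rewrite mule_ge0 ?lee_fin.
rewrite fubini_tonelli1// ge0_integral_distribution; last 2 first.
- exact: measurable_fun_fubini_tonelli_F.
- by move=> x; exact: integral_ge0.
by apply: eq_integral => w _; apply: eq_integral => z _; rewrite muleC.
Qed.

End conditional_density.

(** * The Markov property for functionals of the past *)

Section dyson_markov.
Context (R : realType) (n : nat) (d : measure_display) (T : measurableType d)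
  (P : probability T R) (Y : R -> {RV P >-> n.-tuple R}).
Hypothesis HY : dyson_brownian_motion Y.
Local Notation V := (n.-tuple R).
Local Notation leb := (lebesgue_tuple R n).
Local Notation W := (@weyl_chamber R n).

(** The family generating [natural_filtration Y s], named so that [T] with that sigma-algebra
    becomes a type of its own, [H s]. *)
Definition past s : set (set T) :=
  [set A | exists r (B : set V),
    [/\ 0 <= r <= s, measurable B & A = Y r @^-1` B]].

Local Notation H s := (g_sigma_algebraType (past s)).

Lemma natural_filtration_measurable s A : natural_filtration Y s A -> measurable A.
Proof.
apply: smallest_sub; first exact: sigma_algebra_measurable.
by move=> _ [r [B [_ mB ->]]]; rewrite -[X in measurable X]setTI; exact: measurable_funPT.
Qed.

Lemma measurable_past s : measurable_fun [set: T] (id : T -> H s).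
Proof. by move=> _ A mA; rewrite setTI; exact: natural_filtration_measurable mA. Qed.

Lemma measurable_past_coord r s : 0 <= r <= s ->
  measurable_fun [set: H s] (Y r : H s -> V).
Proof.
move=> rs _ B mB; rewrite setTI; apply: sub_sigma_algebra.
by exists r, B; split.
Qed.

Lemma measurable_past_le r s (g : T -> V) : r <= s ->
  measurable_fun [set: H r] g -> measurable_fun [set: H s] (g : H s -> V).
Proof.
move=> rs mg _ B mB; have := mg measurableT B mB; rewrite !setTI.
apply: (@sub_smallest2r _ _ (past r)); first exact: smallest_sigma_algebra.
move=> _ [r' [B' [/andP[r0 r's] mB' ->]]].
by exists r', B'; split => //; rewrite r0 (le_trans r's).
Qed.

(** For [Y s] in the chamber the truncation at 0 in [dyson_kernel] changes nothing, by
    [dyson_transition_ge0]; the complementary event is null and drops out on both sides. *)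
Lemma dyson_transition_law s t A B : 0 < s -> 0 < t ->
  natural_filtration Y s A -> measurable B ->
  P (A `&` Y (s + t) @^-1` B) =
  (\int[P]_(w in A) \int[leb]_(z in B) (dyson_kernel t (Y s w) z)%:E)%E.
Proof.
move=> s0 t0 FA mB; have [_ aeW _ markov] := HY.
pose N := ~` (Y s @^-1` W).
have FW : natural_filtration Y s (Y s @^-1` W).
  apply: sub_sigma_algebra; exists s, W.
  by split => //; [rewrite lexx ltW|exact: measurable_weyl_chamber].
have mW := natural_filtration_measurable FW.
have mA := natural_filtration_measurable FA.
have mN : measurable N by exact: measurableC.
have PN : P N = 0%E.
  by apply/eqP; rewrite -measure_le0; have /negligibleP := aeW s s0; move=> /(_ mN) ->.
have FAW : natural_filtration Y s (A `\` N).
  rewrite setDE setCK.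
  exact: (@measurableI _ (H s) A (Y s @^-1` W) FA FW).
have mYB : measurable (Y (s + t) @^-1` B).
  by rewrite -[X in measurable X]setTI; exact: measurable_funPT.
have -> : P (A `&` Y (s + t) @^-1` B) = P ((A `\` N) `&` Y (s + t) @^-1` B).
  apply/esym; rewrite setIDAC setIDA measureD//; last 2 first.
  - exact: measurableI.
  - by rewrite (le_lt_trans (probability_le1 _ _)) ?ltry//; exact: measurableI.
  rewrite [X in (_ - X)%E](_ : _ = 0%E) ?sube0//.
  apply/eqP; rewrite -measure_le0 -PN le_measure ?inE//.
  by apply: measurableI => //; exact: measurableI.
pose g (p : T * V) := ((fun z => (dyson_kernel t (Y s p.1) z)%:E) \_ B) p.2.
have g0 p : (0 <= g p)%E.
  by rewrite /g patchE; case: ifP => // _; rewrite lee_fin dyson_kernel_ge0.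
have mg : measurable_fun setT g.
  rewrite /g; under eq_fun do rewrite epatch_indic.
  apply: emeasurable_funM; apply/measurable_EFinP.
    by apply: measurable_dyson_kernel => //; exact: measurableT_comp.
  by apply: measurableT_comp => //; exact: measurable_indic.
under [RHS]eq_integral do rewrite integral_mkcond.
rewrite markov// [RHS](@ge0_negligible_integral _ _ _ _ _ N)//; first last.
- by move=> w _; apply: integral_ge0 => z _; exact: (g0 (w, z)).
- apply: measurable_funTS.
  rewrite (_ : (fun _ => _) = fubini_F leb g)//.
  exact: measurable_fun_fubini_tonelli_F.
apply: eq_integral => w; rewrite inE => -[_ /notP Ww].
rewrite -integral_mkcond integral_mkcondr; apply: eq_integral => z _.
rewrite patchE /dyson_kernel indicE; case: ifPn => [|_]; rewrite ?mulr0// mulr1 inE.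
by move=> Wz; rewrite max_r// dyson_transition_ge0.
Qed.

(** The conditioning variable is the identity from [T] to [H s], so [F] may depend on everything up
    to time [s]. *)
Lemma integral_dyson_transition s t (F : H s * V -> \bar R) : 0 < s -> 0 < t ->
  measurable_fun setT F -> (forall p, 0 <= F p)%E ->
  (\int[P]_w F (w, Y (s + t) w) =
   \int[P]_w \int[leb]_z ((dyson_kernel t (Y s w) z)%:E * F (w, z)))%E.
Proof.
move=> s0 t0 mF F0.
apply: (@integral_conditional_density _ _ _ T (H s) V R P leb id (Y (s + t))
  (fun w z => dyson_kernel t (Y s w) z)) => //.
- exact: measurable_past.
- by move=> w z; exact: dyson_kernel_ge0.
- apply: measurable_dyson_kernel => //.
  apply: (measurableT_comp (measurable_past_coord _)) => //.
  by rewrite ltW//=.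
- by move=> A B mA mB; exact: dyson_transition_law.
Qed.

Variable Phi : (R -> V) -> R.
Hypothesis Phi0 : forall h, 0 <= Phi h.
Hypothesis mPhi : cylinder_measurable Phi.

(** [eta] holds the observations already made and is measurable for the past, so the next
    observation can be integrated out by the Markov property while [eta] is kept. *)
Lemma integral_dyson_iter ts s (eta : T -> R -> V) : 0 < s -> path <%R s ts ->
  (forall r, measurable_fun [set: H s] (fun w : H s => eta w r)) ->
  (forall w, eta w s = Y s w) ->
  (\int[P]_w (Phi (fun r => if r \in ts then Y r w else eta w r))%:E =
   \int[P]_w dyson_iter Phi ts s (eta w))%E.
Proof.
elim: ts s eta => [|t ts IH] s eta s0 /=; first by [].
move=> /andP[st tts] meta etas.
have t0 := lt_trans s0 st.
pose F (p : H s * V) := dyson_iter Phi ts t (upd (eta p.1) t p.2).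
have mF : measurable_fun setT F.
  apply: (@measurable_dyson_iter R n Phi ts t) => // r; rewrite /upd.
  case: (r == t); first exact: measurable_snd.
  exact: (measurableT_comp (meta r)).
have F0 p : (0 <= F p)%E by exact: dyson_iter_ge0.
have ts0 : 0 < t - s by rewrite subr_gt0.
have := integral_dyson_transition s0 ts0 mF F0; rewrite subrKC.
under [X in _ = X -> _]eq_integral do under eq_integral do rewrite -etas.
move=> <-; rewrite /F /= -(IH _ (fun w => upd (eta w) t (Y t w)))//.
- apply: eq_integral => w _; congr (Phi _)%:E; apply/funext => r.
  by rewrite inE /upd; case: (r \in ts); case: eqP => // ->.
- move=> r; rewrite /upd; case: (r == t).
    by apply: measurable_past_coord; rewrite lexx ltW.
  exact: (measurable_past_le (ltW st)).
- by move=> w; rewrite /upd eqxx.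
Qed.

Lemma integral_dyson_entrance t ts (h : R -> V) : 0 < t -> path <%R t ts ->
  (\int[P]_w (Phi (fun r => if r \in t :: ts then Y r w else h r))%:E =
   \int[leb]_z ((Num.max 0 (dyson_entrance t z) * \1_W z)%:E *
     dyson_iter Phi ts t (upd h t z)))%E.
Proof.
move=> t0 tts.
have [_ _ entrance _] := HY.
have mupd r : measurable_fun setT (fun z : V => upd h t z r).
  by rewrite /upd; case: (r == t).
have mF : measurable_fun setT (fun z : V => dyson_iter Phi ts t (upd h t z)).
  exact: (@measurable_dyson_iter R n Phi ts t).
have F0 z : (0 <= dyson_iter Phi ts t (upd h t z))%E by exact: dyson_iter_ge0.
pose rho (z : V) := Num.max 0 (dyson_entrance t z) * \1_W z.
have rho0 z : 0 <= rho z by rewrite mulr_ge0// le_max lexx.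
have mrho : measurable_fun setT rho.
  apply: measurable_funM.
    by apply: measurable_maxr => //; exact: measurable_dyson_entrance.
  by apply: measurable_indic; exact: measurable_weyl_chamber.
have law B : measurable B ->
    distribution P (Y t) B = (\int[leb]_(z in B) (rho z)%:E)%E.
  move=> mB; rewrite [LHS]entrance// integral_mkcondr; apply: eq_integral => z _.
  rewrite patchE /rho indicE; case: ifPn => [|_]; rewrite ?mulr0// mulr1 inE.
  move=> Wz; rewrite max_r// /dyson_entrance mulr_ge0//; last first.
    by apply: prodr_ge0 => i _; apply: prodr_ge0 => j _; exact: sqr_ge0.
  rewrite !mulr_ge0 ?expR_ge0 ?powR_ge0// invr_ge0 mulr_ge0 ?powR_ge0//.
  by apply: prodr_ge0 => i _.
under [RHS]eq_integral do rewrite muleC.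
rewrite -(integral_density rho0 mrho law mF F0) (ge0_integral_distribution _ mF F0).
rewrite /= -(integral_dyson_iter (eta := fun w => upd h t (Y t w)) t0 tts)//.
- apply: eq_integral => w _; congr (Phi _)%:E; apply/funext => r.
  by rewrite inE /upd; case: (r \in ts); case: eqP => // ->.
- move=> r; rewrite /upd; case: (r == t) => //.
  by apply: measurable_past_coord; rewrite lexx ltW.
- by move=> w; rewrite /upd eqxx.
Qed.

End dyson_markov.

(** * Convergence of expectations *)

Section continuous_matrix.
Variables (R : realType) (k n : nat) (g : 'M[R]_(k, n) -> R).
Hypothesis cg : continuous g.

Lemma continuous_matrix_dist (A : 'M[R]_(k, n)) (e : R) : 0 < e ->
  exists2 r : R, 0 < r & forall B : 'M[R]_(k, n),
    (forall i j, `|A i j - B i j| < r) -> `|g A - g B| < e.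
Proof.
move=> e0; have cA : g B @[B --> A] --> g A by exact: cg.
have /cvgrPdist_lt/(_ e e0)/nbhs_ballP[r /= r0 H] := cA.
by exists r => // B AB; apply: H; split.
Qed.

Lemma cvg_continuous_matrix (A_ : nat -> 'M[R]_(k, n)) (A : 'M[R]_(k, n)) :
  (forall i j, A_ N i j @[N --> \oo] --> A i j) -> g (A_ N) @[N --> \oo] --> g A.
Proof.
move=> AA; apply/cvgrPdist_lt => e /(continuous_matrix_dist A)[r r0 H].
have H1 : \forall N \near \oo, forall i j, `|A i j - A_ N i j| < r.
  apply: filter_forall => i; apply: filter_forall => j.
  by have /cvgrPdist_lt := AA i j; exact.
by near=> N; apply: H; near: N.
Unshelve. all: by end_near.
Qed.

Lemma measurable_continuous_matrix d (T : measurableType d)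
    (A : T -> 'M[R]_(k, n)) :
  (forall i j, measurable_fun setT (fun x => A x i j)) ->
  measurable_fun setT (fun x => g (A x)).
Proof.
move=> mA.
(* Rounding the entries down to multiples of 1/(N+1) leaves countably many
   values. *)
pose F N x : 'M[int]_(k, n) := \matrix_(i, j) Num.floor (N.+1%:R * A x i j).
pose G N (B : 'M[int]_(k, n)) := g (\matrix_(i, j) ((B i j)%:~R / N.+1%:R)).
have mF N : measurable_fibers (F N).
  move=> B; have -> : F N @^-1` [set B] =
    \bigcap_(p in [set: 'I_k * 'I_n])
      ((fun x => N.+1%:R * A x p.1 p.2) @^-1`
        `[(B p.1 p.2)%:~R, (B p.1 p.2 + 1)%:~R[%classic).
    apply/seteqP; split => [x /= <- [i j] _|x H /=].
      by rewrite /= in_itv/= !mxE /= floor_itv.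
    apply/matrixP => i j; rewrite !mxE; apply/floor_def.
    by have := H (i, j) I; rewrite /= in_itv.
  apply: fin_bigcap_measurable => [|p _]; first exact: finite_finset.
  rewrite -[X in measurable X]setTI; apply: measurable_funM => //.
apply: (measurable_fun_cvg (h := fun N => G N \o F N)).
  by move=> N; exact: fibers_measurable_fun.
move=> x _; apply: cvg_continuous_matrix => i j.
apply/cvgrPdist_le => e e0; near=> N.
rewrite !mxE; set y := A x i j.
have N0 : 0 < N.+1%:R^-1 :> R by rewrite invr_gt0.
have /andP[h1 h2] := floor_itv (N.+1%:R * y).
have -> : y = N.+1%:R * y / N.+1%:R by rewrite mulrAC mulfV ?mul1r.
rewrite [X in Num.floor X](_ : _ = N.+1%:R * y); last first.
  by rewrite mulrA mulrAC mulfV ?mul1r.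
rewrite -mulrBl normrM [X in _ * X]gtr0_norm//.
rewrite intrD in h2.
apply: (@le_trans _ _ (1 * N.+1%:R^-1)).
  by rewrite ler_pM2r// ler_norml; apply/andP; split; lra.
rewrite mul1r; near: N; apply: (cvgr_le 0) => //.
by apply: cvg_harmonic.
Unshelve. all: by end_near.
Qed.

End continuous_matrix.

(** * Errors from interpolation and from the initial positions *)

Section rescaling_error.
Variable beta : nat -> nat -> nat -> bool.

(** The bit contributes 0 or 1, blocking at most -1 and pushing at most 1. *)
Lemma aztec_increment t j i :
  -1 <= aztec beta t.+1 j.+1 i - aztec beta t j.+1 i <= 2.
Proof.
rewrite /=; set x := aztec beta t j.+1 i; set b := beta _ _ _.
by case: ifP => _; [|case: ifP => _; [|case: ifP => _]];
  case: b; repeat case: (_ == _); rewrite /=; lia.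
Qed.

Variables (R : realType) (n N : nat).

(** With [s = N t], [k] its integer part and [y - x] the increment, the difference is
    [(s - k) (2 (y - x) - 1) / sqrt N]; the increment lies in [[-1, 2]], hence the 3. *)
Lemma aztec_rescaled_obs_time (t : R) (i : 'I_n) : 0 <= t ->
  `|tnth (aztec_rescaled beta n N t) i -
    ((aztec beta (obs_time N t) n i.+1)%:~R - (obs_time N t)%:R / 2)
      * (2 / Num.sqrt N%:R)| <= 3 * (Num.sqrt N%:R)^-1.
Proof.
case: n i => [[]//|n'] i t0; rewrite tnth_mktuple /linear_interp -/(obs_time N t).
have /andP[h1 h2] := obs_time_itv N t0.
set k := obs_time N t in h1 h2 *.
have /andP[h3 h4] := aztec_increment k n' i.+1.
set a := aztec _ _ _ _; set a' := aztec _ _ _ _.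
have {}h3 : -1 <= a'%:~R - a%:~R :> R by rewrite -intrB (ler_int _ (-1)).
have {}h4 : a'%:~R - a%:~R <= 2 :> R by rewrite -intrB (ler_int _ _ 2).
have s0 : 0 <= (Num.sqrt N%:R)^-1 :> R by rewrite invr_ge0.
rewrite invfM invrK.
move: (_^-1) (N%:R * t) h1 h2 s0 => r s h1 h2 r0.
move: (a%:~R : R) (a'%:~R : R) (k%:R : R) h1 h2 h3 h4 => x y z h1 h2 h3 h4.
have -> : (x + (s - z) * (y - x) - 2^-1 * s) * (2 * r) - (x - z / 2) * (2 * r) =
  ((s - z) * (2 * (y - x) - 1)) * r by field.
rewrite normrM (ger0_norm r0) ler_wpM2r// ler_norml; apply/andP; split; nra.
Qed.

Lemma aztec_rescaled0 (i : 'I_n) :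
  `|tnth (aztec_rescaled beta n N (0 : R)) i| <= 2 * n%:R * (Num.sqrt N%:R)^-1.
Proof.
rewrite tnth_mktuple /linear_interp mulr0 truncn0 /= subr0 mul0r addr0 mulr0 subr0.
rewrite invfM invrK normrM [X in _ * X]ger0_norm ?mulr_ge0 ?invr_ge0//.
rewrite mulrA ler_wpM2r ?invr_ge0// mulrC ler_wpM2l// ger0_norm//.
by rewrite ler_nat.
Qed.

End rescaling_error.

(** * Infimum over a small ball *)

Section matrix_infimum.
Variables (R : realType) (k n : nat) (g : 'M[R]_(k, n) -> R).
Hypothesis g0 : forall A, 0 <= g A.

(** A lower bound for [g] at every point within [r] in each entry, so that errors of this size in
    the sampled positions respect a lower estimate. *)
Definition ball_inf (r : R) (A : 'M[R]_(k, n)) : R :=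
  inf [set g B | B in [set B : 'M[R]_(k, n) | forall i j, `|A i j - B i j| <= r]].

Lemma ball_inf_le r (A B : 'M[R]_(k, n)) :
  (forall i j, `|A i j - B i j| <= r) -> ball_inf r A <= g B.
Proof.
move=> AB; apply: ge_inf; last by exists B.
by exists 0 => _ [C _ <-].
Qed.

Lemma le_ball_inf r (A : 'M[R]_(k, n)) (x : R) : 0 <= r ->
  (forall B : 'M[R]_(k, n), (forall i j, `|A i j - B i j| <= r) -> x <= g B) ->
  x <= ball_inf r A.
Proof.
move=> r0 H; apply: lb_le_inf => [|_ [B AB <-]]; last exact: H.
by exists (g A); exists A => // i j; rewrite subrr normr0.
Qed.

Lemma limn_einf_ball_inf (r : nat -> R) (A_ : nat -> 'M[R]_(k, n))
    (A : 'M[R]_(k, n)) :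
  continuous g -> (forall N, 0 <= r N) -> r N @[N --> \oo] --> 0 ->
  (forall i j, A_ N i j @[N --> \oo] --> A i j) ->
  ((g A)%:E <= limn_einf (fun N => (ball_inf (r N) (A_ N))%:E))%E.
Proof.
move=> cg r0 rcvg AA; apply: le_limn_einfP => x; rewrite lte_fin => xg.
have [e e0 He] := continuous_matrix_dist cg A (etrans (subr_gt0 x (g A)) xg).
have e20 : 0 < e / 2 by lra.
have H1 : \forall N \near \oo, forall i j, `|A i j - A_ N i j| < e / 2.
  apply: filter_forall => i; apply: filter_forall => j.
  by have /cvgrPdist_lt := AA i j; exact.
near=> N.
rewrite lee_fin; apply: le_ball_inf => // B AB.
suff : `|g A - g B| < g A - x by rewrite ltr_norml => /andP[]; lra.
apply: He => i j; rewrite -(subrKA (A_ N i j)); apply: le_lt_trans (ler_normD _ _) _.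
rewrite [ltRHS](splitr e); apply: ltr_leD.
  by move: i j; near: N.
apply: le_trans (AB i j) _; near: N; exact: (cvgr_le _ rcvg).
Unshelve. all: by end_near.
Qed.

End matrix_infimum.

(** * Lower bound for the limit of expectations *)

Section liminf_expectation.
Context (R : realType) (m n : nat) d (T : measurableType d) (P : probability T R)
  (beta : nat -> nat -> nat -> {RV P >-> bool}) d' (T' : measurableType d')
  (P' : probability T' R) (Y : R -> {RV P' >-> n.-tuple R}).
Hypothesis nm : (n <= m)%N.
Hypothesis fair : fair_bits m beta.
Hypothesis HY : dyson_brownian_motion Y.
Local Notation V := (n.-tuple R).

Definition aztec_process N (t : R) (w : T) : V :=
  aztec_rescaled (fun j i s => beta j i s w) n N t.

Lemma measurable_aztec_process N t i :
  measurable_fun setT (fun w => tnth (aztec_process N t w) i).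
Proof.
under eq_fun do rewrite tnth_mktuple.
have mp s : measurable_fun setT (fun w => (particle beta s n i.+1 w)%:~R : R).
  exact: (@fibers_measurable_fun _ _ _ _ _ _ (fun z : int => z%:~R : R)
    (fibers_particle beta s n i.+1)).
apply: measurable_funM => //; apply: measurable_funB => //.
apply: measurable_funD; first exact: mp.
apply: measurable_funM => //.
by apply: measurable_funB; [exact: (mp _.+1)|exact: mp].
Qed.

Variables (k : nat) (tau : 'I_k -> R).
Hypothesis tau0 : forall a, 0 <= tau a.
Variable g : 'M[R]_(k, n) -> R.
Hypothesis g0 : forall A, 0 <= g A.
Hypothesis cg : continuous g.

Lemma measurable_aztec_fdd N : measurable_fun setT
  (fun w => g (fdd_matrix (fun a => aztec_process N (tau a) w))).
Proof.
apply: measurable_continuous_matrix => // a i.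
by under eq_fun do rewrite mxE; exact: measurable_aztec_process.
Qed.

Lemma cylinder_measurable_fdd :
  cylinder_measurable (fun h : R -> V => g (fdd_matrix (fun a => h (tau a)))).
Proof.
move=> d0 T0 eta meta; apply: measurable_continuous_matrix => // a i.
under eq_fun do rewrite mxE.
exact: (measurableT_comp (measurable_tnth i)).
Qed.

Lemma near_path_obs_time (s : R) ts : 0 <= s -> path <%R s ts ->
  \forall N \near \oo, path ltn (obs_time N s) (map (obs_time N) ts).
Proof.
elim: ts s => [|t ts IH] s s0 /=; first by move=> _; exact: nearW.
move=> /andP[st tts]; have lt := obs_time_lt s0 st.
have IHt := IH t (ltW (le_lt_trans s0 st)) tts.
by near=> N; apply/andP; split; near: N.
Unshelve. all: by end_near.
Qed.

Lemma expectation_liminf :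
  (\int[P']_w (g (fdd_matrix (fun a => Y (tau a) w)))%:E <=
   limn_einf (fun N =>
     \int[P]_w (g (fdd_matrix (fun a => aztec_process N (tau a) w)))%:E))%E.
Proof.
(* The distinct positive times in order; 1 is added so that the list is never empty. Time 0 is
   handled by the constant history [h]. *)
pose S := sort <=%R (undup (1 :: [seq tau a | a <- enum 'I_k & 0 < tau a])).
have S_sorted : sorted <%R S by rewrite sort_lt_sorted undup_uniq.
have S_gt0 s : s \in S -> 0 < s.
  rewrite mem_sort mem_undup inE => /orP[/eqP->//|/mapP[a]].
  by rewrite mem_filter => /andP[a0 _] ->.
have tauS a : tau a \notin S -> tau a = 0.
  move=> aS; apply/eqP; apply: contraNT aS => a0.
  rewrite mem_sort mem_undup inE; apply/orP; right; apply/mapP; exists a => //.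
  by rewrite mem_filter mem_enum lt_neqAle eq_sym a0 tau0.
have S1 : 1 \in S by rewrite mem_sort mem_undup inE eqxx.
move: S_sorted S_gt0 tauS S1; case: S => [//|t ts] /= S_sorted S_gt0 tauS _.
have t0 : 0 < t by rewrite S_gt0 ?inE ?eqxx.
pose h (_ : R) : V := [tuple 0 | _ < n].
pose Phi0 (h : R -> V) := g (fdd_matrix (fun a => h (tau a))).
(* Covers both errors: 3 at the times in the list, [2 n] at time 0. *)
pose r N : R := (2 * n%:R + 3) * (Num.sqrt N%:R)^-1.
pose Phi N (h : R -> V) := ball_inf g (r N) (fdd_matrix (fun a => h (tau a))).
(* Large enough for the packed start and for all observation times; rounded positions at lattice
   time [k] are eventually below [k]. *)
pose M N := (m + \sum_(s <- t :: ts) obs_time N s)%N.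
have r0 N : 0 <= r N by rewrite mulr_ge0 ?invr_ge0 ?addr_ge0 ?mulr_ge0.
have rcvg : r N @[N --> \oo] --> 0.
  by rewrite -(mulr0 (2 * n%:R + 3)); apply: cvgM; [exact: cvg_cst|exact: cvg_sqrt_natrV].
have -> : (\int[P']_w (g (fdd_matrix (fun a => Y (tau a) w)))%:E =
    \int[P']_w (Phi0 (fun s => if s \in t :: ts then Y s w else h s))%:E)%E.
  have [Y0 _ _ _] := HY.
  apply: ge0_ae_eq_integral => //.
  - apply/measurable_EFinP; apply: (cylinder_measurable_fdd (eta := fun w s => Y s w)).
    by move=> s; exact: measurable_funPT.
  - apply/measurable_EFinP; apply: (cylinder_measurable_fdd
      (eta := fun w s => if s \in t :: ts then Y s w else h s)).
    by move=> s; case: (s \in _); [exact: measurable_funPT|exact: measurable_cst].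
  - by move=> w _; rewrite lee_fin.
  - by move=> w _; rewrite lee_fin /Phi0.
  - apply: filterS Y0 => w Yw0 _; congr (g _)%:E; congr fdd_matrix; apply/funext => a.
    by case: ifPn => // /tauS ->.
rewrite (integral_dyson_entrance HY _ cylinder_measurable_fdd)//.
apply: (le_trans (@dyson_entrance_liminf R n M _ Phi Phi0 _ _ _ _ t ts h t0 S_sorted _)).
- by move=> N; rewrite /M; lia.
- by move=> N h'; rewrite /Phi; apply: le_ball_inf => // B _; exact: g0.
- by move=> h'; exact: g0.
- exact: cylinder_measurable_fdd.
- move=> hN h' hh'; apply: limn_einf_ball_inf => // a i.
  by under eq_fun do rewrite mxE; rewrite mxE; exact: hh'.
- by move=> t' N t'S; rewrite /M (big_rem t' t'S)/=; lia.
apply: near_le_limn_einf2.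
have p0 : path <%R 0 (t :: ts) by rewrite /= t0.
have := near_path_obs_time (lexx 0) p0; apply: filterS => N.
rewrite {1}/obs_time mulr0 truncn0 => pN.
apply: (obs_sum_le_integral fair) => //.
- by rewrite /M; lia.
- by move=> h'; rewrite /Phi; apply: le_ball_inf => // B _; exact: g0.
- exact: measurable_aztec_fdd.
move=> w; apply: (ball_inf_le g0) => a i; rewrite !mxE.
have s0 : 0 <= (Num.sqrt N%:R)^-1 :> R by rewrite invr_ge0.
have ns0 : 0 <= n%:R * (Num.sqrt N%:R)^-1 :> R by rewrite mulr_ge0.
case: ifPn => [aS|/tauS ->].
  rewrite /rescaled_particle tnth_mktuple distrC.
  apply: le_trans (aztec_rescaled_obs_time _ _ _ (tau0 a)) _.
  by rewrite /r [leRHS]mulrDl lerDr -mulrA mulr_ge0.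
rewrite [tnth (h 0) i]tnth_mktuple sub0r normrN; apply: le_trans (@aztec_rescaled0 _ R n N i) _.
by rewrite /r [leRHS]mulrDl lerDl mulr_ge0.
Qed.

End liminf_expectation.

(** Boundedness gives integrability, so the bounds for [B + X] and [B - X] in extended reals become
    two bounds on one finite expectation. *)
Lemma expectation_bounded d (T : measurableType d) (R : realType)
    (P : probability T R) (X : T -> R) (B : R) :
  measurable_fun setT X -> (forall w, `|X w| <= B) ->
  exists x : R, 'E_P[X]%E = x%:E /\
    (\int[P]_w (B + X w)%:E = (B + x)%:E)%E /\
    (\int[P]_w (B - X w)%:E = (B - x)%:E)%E.
Proof.
move=> mX XB.
have ic : P.-integrable setT (EFin \o cst B).
  exact: finite_measure_integrable_cst.
have iX : P.-integrable setT (EFin \o X).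
  apply: (le_integrable measurableT _ _ ic); first exact/measurable_EFinP.
  move=> w _ /=; rewrite lee_fin; apply: le_trans (XB w) _.
  exact: ler_norm.
have fX := integrable_fin_num measurableT iX.
have intB : (\int[P]_w (EFin \o cst B) w = B%:E)%E.
  rewrite -[RHS]mule1 -(probability_setT P).
  exact: (integral_cst P measurableT B%:E).
exists (fine 'E_P[X]%E); rewrite unlock fineK//; split => //.
split.
  under eq_integral do rewrite EFinD.
  by rewrite integralD// intB -[in LHS](fineK fX) -EFinD.
under eq_integral do rewrite EFinB.
by rewrite integralB// intB -[in LHS](fineK fX) -EFinB.
Qed.

Theorem theorem1p1 (R : realType) (m n : nat)
    (d : measure_display) (T : measurableType d) (P : probability T R)
    (beta : nat -> nat -> nat -> {RV P >-> bool})
    (d' : measure_display) (T' : measurableType d') (P' : probability T' R)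
    (Y : R -> {RV P' >-> n.-tuple R}) :
  (1 <= m)%N -> (1 <= n <= m)%N ->
  fair_bits m beta ->
  dyson_brownian_motion Y ->
  fdd_cvg P
    (fun (N : nat) (t : R) (w : T) =>
       aztec_rescaled (fun j i s => beta j i s w) n N t)
    P' Y.
Proof.
move=> _ /andP[_ nm] fair HY k tau f tau0 cf [B fB].
pose XN N w := f (fdd_matrix (fun a => aztec_process n beta N (tau a) w)).
pose XY w := f (fdd_matrix (fun a => Y (tau a) w)).
have mXN N : measurable_fun setT (XN N).
  apply: measurable_continuous_matrix => // a i.
  by under eq_fun do rewrite mxE; exact: measurable_aztec_process.
have mXY : measurable_fun setT XY.
  apply: measurable_continuous_matrix => // a i.
  under eq_fun do rewrite mxE.
  by apply: (measurableT_comp (measurable_tnth i)); exact: measurable_funPT.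
have [y [Ey [Ey1 Ey2]]] := expectation_bounded P' mXY (fun w => fB _).
have {}/choice[x Ex] N := expectation_bounded P (mXN N) (fun w => fB _).
rewrite -/XY Ey.
rewrite (_ : (fun N => _) = (fun N => (x N)%:E)); last first.
  by apply/funext => N; have [-> _] := Ex N.
have fBP A : - B <= f A <= B by rewrite -ler_norml.
have low1 : ((B + y)%:E <= limn_einf (fun N => (B + x N)%:E))%E.
  rewrite -Ey1 (_ : (fun N => _) = (fun N => \int[P]_w (B + XN N w)%:E)%E).
    apply: (expectation_liminf nm fair HY tau0 (g := fun A => B + f A)).
    + by move=> A; have := fBP A; lra.
    + by move=> A; apply: (@cvgD _ _ _ (nbhs A)); [exact: cvg_cst|exact: cf].
  by apply/funext => N; have [_ [-> _]] := Ex N.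
have low2 : ((B - y)%:E <= limn_einf (fun N => (B - x N)%:E))%E.
  rewrite -Ey2 (_ : (fun N => _) = (fun N => \int[P]_w (B - XN N w)%:E)%E).
    apply: (expectation_liminf nm fair HY tau0 (g := fun A => B - f A)).
    + by move=> A; have := fBP A; lra.
    + by move=> A; apply: (@cvgB _ _ _ (nbhs A)); [exact: cvg_cst|exact: cf].
  by apply/funext => N; have [_ [_ ->]] := Ex N.
apply: cvg_EFin; first exact: nearW.
apply/cvgrPdist_le => e e0.
have near1 : \forall N \near \oo, ((B + y - e)%:E <= (B + x N)%:E)%E.
  by apply: limn_einf_near; apply: lt_le_trans low1; rewrite lte_fin; lra.
have near2 : \forall N \near \oo, ((B - y - e)%:E <= (B - x N)%:E)%E.
  by apply: limn_einf_near; apply: lt_le_trans low2; rewrite lte_fin; lra.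
near=> N.
have h1 : ((B + y - e)%:E <= (B + x N)%:E)%E by near: N.
have h2 : ((B - y - e)%:E <= (B - x N)%:E)%E by near: N.
rewrite !lee_fin in h1 h2.
by rewrite /= ler_norml; apply/andP; split; lra.
Unshelve. all: by end_near.
Qed.
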